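(* For every $N\ge0$, the Birkhoff map $\Phi$ restricts to a bijection $\Phi:\mathcal U_N\to\Omega_N$, and $\Phi(0)=0$. Moreover $\Phi$ maps $\{u\in\mathcal U_N:\lambda_0(u)>0\}$ and $\{u\in\mathcal U_N:\lambda_0(u)=0\}$ onto $\{\zeta\in\Omega_N:\zeta_0\neq0\}$ and $\{\zeta\in\Omega_N:\zeta_0=0\}$ respectively.
   Context: Notation: $\mathbb T=\mathbb R/2\pi\mathbb Z$, $\mathbb N_0=\{0,1,2,\dots\}$; $\widehat f(k)=\frac1{2\pi}\int_0^{2\pi}e^{-ikx}f(x)\,dx$; $\langle f\mid g\rangle=\frac1{2\pi}\int_0^{2\pi}f(x)\overline{g(x)}\,dx$ and $\|f\|_{L^2}^2=\langle f\mid f\rangle$. $L^2_+(\mathbb T)=\{f\in L^2(\mathbb T):\widehat f(k)=0 \text{ for } k<0\}$; $\Pi f=\sum_{k\ge0}\widehat f(k)e^{ikx}$; $Sf(x)=e^{ix}f(x)$. Lax operator: for $u\in L^2_+(\mathbb T)$, $L_u=-i\partial_x+u\,\Pi(\bar u\,\cdot)$ is the self-adjoint operator on $L^2_+(\mathbb T)$ associated with the quadratic form $f\mapsto\sum_{k\ge0}k|\widehat f(k)|^2+\|\Pi(\bar u f)\|_{L^2}^2$ of domain $H^{1/2}_+(\mathbb T)=H^{1/2}(\mathbb T)\cap L^2_+(\mathbb T)$. It is known that $L_u$ has compact resolvent and simple spectrum $0\le\lambda_0(u)<\lambda_1(u)<\cdots\to+\infty$, and that $\gamma_n(u):=\lambda_n(u)-\lambda_{n-1}(u)-1\ge0$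 for $n\ge1$. Set $\gamma_0(u):=\lambda_0(u)$. Let $(f_n)_{n\ge0}$ be the orthonormal basis of eigenfunctions, $L_uf_n=\lambda_nf_n$, with phases fixed by the transport gauge $\langle 1\mid f_0\rangle>0$ and $\langle Sf_{n-1}\mid f_n\rangle>0$ for $n\ge1$ (these inner products never vanish, so this is possible and unique). Birkhoff map: $\Phi(u)=(\zeta_n(u))_{n\ge0}$ with $\zeta_n(u):=\sqrt{\gamma_n(u)}\,e^{i\arg\langle u\mid f_n\rangle}$, and $\zeta_n(u)=0$ when $\gamma_n(u)=0$ (which happens exactly when $\langle u\mid f_n\rangle=0$). Finite-gap potentials: $u\in L^2_+(\mathbb T)$ is a finite-gap potential if there is $m\ge1$ with $\gamma_n(u)=0$ for all $n\ge m$. Let $\mathcal B_N$ be the set of finite Blaschke products $\psi(x)=e^{i\theta}\prod_{k=1}^N\frac{e^{ix}-\overline{p_k}}{1-p_ke^{ix}}$, $\theta\in\mathbb R$, $|p_k|<1$ ($\mathcal B_0$ = unimodular constants). The spectral index of a finite-gap potential is $\mathcal N(u):=\min\{N\in\mathbb N_0:\exists\lambda\in\mathbb R,\ \exists\psi\in\mathcal B_N,\ L_uS^k\psi=(\lambda+k)S^k\psi\ \ \forall k\in\mathbb N_0\}$. For $N\ge1$, $\mathcal U_N:=\{u\text{ finite-gap potential}:\mathcal N(u)=N\}$ (equivalently $\gamma_N(u)>0$ and $\gamma_n(u)=0$ for all $n>N$); $\mathcal U_0:=\mathbb C^*=\mathbb C\setminus\{0\}$ (nonzero constant functions). $\Omega_N:=\{\zeta=(\zeta_0,\dots,\zeta_N)\in\mathbb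 C^{N+1}:\zeta_N\ne0\}$, identified with a subset of $\ell^2(\mathbb N_0)$ by extending sequences by zero. *)

(* Defs.v *)
From HB Require Import structures.
From mathcomp Require Import all_boot all_order all_algebra.
From mathcomp Require Import complex.
From mathcomp Require Import all_classical all_reals all_analysis.
Import Order.TTheory GRing.Theory Num.Theory.
Import numFieldNormedType.Exports.

Set Implicit Arguments.
Unset Strict Implicit.
Unset Printing Implicit Defensive.

Local Open Scope classical_set_scope.
Local Open Scope ring_scope.
Local Open Scope complex_scope.

(* The torus R/2piZ is represented by its fundamental domain [0, 2pi]: a
   function on it is a function R -> R[i] of which only the values on [0, 2pi]
   matter, and those only up to a Lebesgue-null set. *)

Section FunctionsOnTheCircle.
Variable R : realType.
Local Notation C := R[i].
Local Notation leb := (@lebesgue_measure R).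
Implicit Types (f g h u : R -> C).

Definition circle : set R := `[0, 2 * pi]%classic.

Definition expi (t : R) : C := cos t +i* sin t.

Definition sqnorm (z : C) : R := complex.Re z ^+ 2 + complex.Im z ^+ 2.

Definition circle_mean f : C :=
  ((2 * pi)^-1 * \int[leb]_(x in circle) complex.Re (f x)) +i*
  ((2 * pi)^-1 * \int[leb]_(x in circle) complex.Im (f x)).

Definition inner f g : C := circle_mean (fun x => f x * (g x)^*).

Definition fourier f (k : int) : C :=
  circle_mean (fun x => expi (- (k%:~R * x)) * f x).

Definition shift f : R -> C := fun x => expi x * f x.

Definition ae_equal f g : Prop := f = g %[ae leb in circle].

Definition square_integrable f : Prop :=
  [/\ measurable_fun circle (fun x => complex.Re (f x)),
      measurable_fun circle (fun x => complex.Im (f x)) &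
      (\int[leb]_(x in circle) (sqnorm (f x))%:E < +oo)%E].

Lemma square_integrable0 : square_integrable (cst 0).
Proof.
split; [exact: measurable_cst | exact: measurable_cst | ].
by rewrite integral0_eq ?ltry// => x _; rewrite /sqnorm /= expr0n addr0.
Qed.

Record L2fun := MkL2fun {
  L2fun_val : R -> C;
  L2fun_prop : square_integrable L2fun_val }.

HB.instance Definition _ := gen_eqMixin L2fun.
HB.instance Definition _ := gen_choiceMixin L2fun.

Definition L2eqv (f g : L2fun) : bool :=
  `[< ae_equal (L2fun_val f) (L2fun_val g) >].

Lemma L2eqv_equiv : equiv_class_of L2eqv.
Proof.
split=> [f|f g|g f h].
- by apply/asboolP; exact: ae_eq_refl.
- by apply/asboolP/asboolP; exact: ae_eq_sym.
- by move=> /asboolP fg /asboolP gh; apply/asboolP; exact: ae_eq_trans fg gh.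
Qed.

Canonical L2eqv_canonical := EquivRelPack L2eqv_equiv.

(* L^2(T; C), whose elements are classes modulo equality a.e. on [0, 2pi]. *)
Definition L2 : Type := {eq_quot L2eqv}%qT.
HB.instance Definition _ := Choice.on L2.
HB.instance Definition _ := EqQuotient.on L2.

Definition L2_fun (u : L2) : R -> C := L2fun_val (repr u).

Definition L2_zero : L2 := (\pi_(L2) (MkL2fun square_integrable0))%qT.

End FunctionsOnTheCircle.

Coercion L2_fun : L2 >-> Funclass.

Section LaxOperator.
Variable R : realType.
Local Notation C := R[i].
Implicit Types (f g h u : R -> C).

(* L^2_+ *)
Definition hardy f : Prop :=
  square_integrable f /\ forall k : int, k < 0 -> fourier f k = 0.

(* H^{1/2}_+; since f has no negative frequency, the H^{1/2} condition only
   involves k >= 0. *)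
Definition hardy_half f : Prop :=
  hardy f /\
  (\sum_(0 <= k <oo) (k%:R * sqnorm (fourier f k%:Z))%:E < +oo)%E.

(* The L^2 sum of the series of the nonnegative frequencies of f.  It is used
   for f = conj(u) g with u in L^2_+ and g in H^{1/2}_+, which is integrable but
   need not be in L^2; its nonnegative part is in L^2 nevertheless. *)
Definition szego f : L2 R :=
  xget (L2_zero R) [set h : L2 R | forall k : int,
    fourier h k = if 0 <= k then fourier f k else 0].

Definition complex_series (a : nat -> C) : C :=
  limn (series (fun k => complex.Re (a k))) +i*
  limn (series (fun k => complex.Im (a k))).

(* The sesquilinear form whose diagonal is
   sum_{k >= 0} k |f^(k)|^2 + || Pi (conj(u) f) ||^2. *)
Definition lax_form u f g : C :=
  complex_series (fun k =>
    k%:R * (fourier f k%:Z * (fourier g k%:Z)^*)) +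
  inner (szego (fun x => (u x)^* * f x)) (szego (fun x => (u x)^* * g x)).

(* lax u f h : f lies in the domain of L_u and L_u f = h, where L_u is the
   operator associated with lax_form u in the sense of the first representation
   theorem for closed forms. *)
Definition lax u f h : Prop :=
  [/\ hardy_half f, hardy h &
      forall g, hardy_half g -> lax_form u f g = inner h g].

Record eigenbasis u (lam : nat -> R) (f : nat -> L2 R) : Prop := {
  eigenvalue_lt : forall n, lam n < lam n.+1;
  eigenvalue_cvg : lam n @[n --> \oo] --> +oo;
  eigenvector_lax : forall n, lax u (f n) (fun x => (lam n)%:C * f n x);
  eigenvector_orthonormal : forall m n, inner (f m) (f n) = (m == n)%:R;
  eigenvector_total : forall g, hardy g ->
    (forall n, inner g (f n) = 0) -> ae_equal g (cst 0) }.

(* For complex z, 0 < z means that z is real and positive. *)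
Definition transport_gauge (f : nat -> L2 R) : Prop :=
  0 < inner (cst 1) (f 0%N) /\
  forall n, 0 < inner (shift (f n)) (f n.+1).

(* For u in L^2_+ there is exactly one sequence of eigenvalues and one gauged
   eigenbasis; the default values of xget are never used there. *)
Definition lambda u : nat -> R :=
  xget (cst 0) [set lam | exists f : nat -> L2 R, eigenbasis u lam f].

Definition eigenfun u : nat -> L2 R :=
  xget (cst (L2_zero R))
    [set f : nat -> L2 R | eigenbasis u (lambda u) f /\ transport_gauge f].

Definition gap u (n : nat) : R :=
  if n is m.+1 then lambda u n - lambda u m - 1 else lambda u 0%N.

(* exp (i arg z), with the value 0 at z = 0 *)
Definition phase (z : C) : C := z / `|z|.

Definition birkhoff u : nat -> C := fun n =>
  (Num.sqrt (gap u n))%:C * phase (inner u (eigenfun u n)).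

Definition finite_gap u : Prop :=
  hardy u /\ exists2 m, (1 <= m)%N & forall n, (m <= n)%N -> gap u n = 0.

Definition blaschke (N : nat) : set (R -> C) :=
  [set psi | exists theta : R, exists2 p : 'I_N -> C,
     (forall k, `|p k| < 1) &
     psi = fun x => expi theta *
       \prod_(k < N) ((expi x - (p k)^*) / (1 - p k * expi x))].

Definition shifted_blaschke_eigenvectors u (N : nat) : Prop :=
  exists lam : R, exists2 psi, blaschke N psi &
    forall k, lax u (iter k (@shift R) psi)
      (fun x => (lam + k%:R)%:C * iter k (@shift R) psi x).

Definition is_spectral_index u (N : nat) : Prop :=
  shifted_blaschke_eigenvectors u N /\
  forall M, shifted_blaschke_eigenvectors u M -> (N <= M)%N.

Definition calU (N : nat) : set (L2 R) :=
  if N is 0 then [set u | exists2 c : C, c != 0 & ae_equal u (cst c)]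
  else [set u | finite_gap u /\ is_spectral_index u N].

(* {z in C^{N+1} : z_N != 0}, its elements being extended by zero *)
Definition Omega (N : nat) : set (nat -> C) :=
  [set z | z N != 0 /\ forall n, (N < n)%N -> z n = 0].

End LaxOperator.

Arguments circle R : clear implicits.
Arguments calU R N : clear implicits.
Arguments Omega R N : clear implicits.

(* Main.v *)
(* A potential u of spectral index N is encoded by a unitary (N+1) x (N+1) matrix
   U_mp = <S f_(m-1) | f_p> (with S f_(-1) = 1) together with a_p = <u | f_p> and
   c_m = <S f_(m-1) | u>: the commutation rule L S = S L + S + <S . | u> u and L 1 = <1 | u> u say
   that (lam_p - mu_m) U_mp = c_m a_p, where mu_0 = 0 and mu_m = lam_(m-1) + 1, so that diag(lam)
   is a rank-one perturbation of diag(mu).  Lagrange interpolation determines |c_m| and |a_p| from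
   lam and mu, and the gauge U_mm > 0 determines the phases of c from those of a; hence the matrix
   data correspond exactly to the Birkhoff coordinates.  The data give back u: the equations
   f_p = sum_m conj(U_mp) S f_(m-1) fix the Fourier coefficients of the f_p by a linear recursion
   which is stable because mu_(m+1) > lam_m.  Conversely, if the S^k psi are eigenfunctions for a
   Blaschke product psi of degree N, then <S^(k+1) psi | u> = 0, so u lies in a model space of
   dimension N + 1, the remaining eigenfunctions span the orthogonal complement of the S^k psi and
   have the N smallest eigenvalues, and u is recovered from its matrix. *)

Require Import Defs.
From mathcomp Require Import all_boot all_order all_algebra.
From mathcomp Require Import complex.
From mathcomp Require Import all_classical all_reals all_analysis.
From mathcomp Require Import measurable_realfun.
From mathcomp Require Import ring lra.
Import Order.TTheory GRing.Theory Num.Theory.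
Import numFieldNormedType.Exports.

Set Implicit Arguments.
Unset Strict Implicit.
Unset Printing Implicit Defensive.

Local Open Scope classical_set_scope.
Local Open Scope complex_scope.
Local Open Scope ring_scope.

(** * Square-integrable functions on the circle *)

Section CircleMean.
Variable R : realType.
Local Notation C := R[i].
Local Notation leb := (@lebesgue_measure R).
Local Notation Re := complex.Re.
Local Notation Im := complex.Im.
Implicit Types (f g h u : R -> C) (k : int) (c : C).

(** [lambda], [eigenfun] and [szego] are chosen by [xget], so nothing can be computed about them
    directly: one exhibits an object with the defining property and, for the first two, proves it
    unique. For a potential of positive index the existence of an eigenbasis is extracted from the
    finite-gap condition itself, which the default value of [lambda] violates. The operator is given
    only through its form, and conj(u) f is in general only integrable. Both difficulties disappear
    for functions whose Fourier coefficients decay geometrically: there Pi, the derivative and L_u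
    are explicit convergent series. In one direction this decay comes from the spectral radius of
    the recursion, in the other from the fact that a Hardy function orthogonal to psi H^2 is a
    polynomial divided by the denominator of psi. The Birkhoff coordinates enter through gamma_n =
    |zeta_n|^2 = lam_n - mu_n: the moduli give lam and mu by summation, and only the phases of the
    nonzero coordinates remain free. Minimality of the index serves to show that the last gap is
    open. *)

Definition cfun_measurable f :=
  measurable_fun (circle R) (fun x => Re (f x)) /\
  measurable_fun (circle R) (fun x => Im (f x)).

Definition cintegrable f :=
  leb.-integrable (circle R) (EFin \o (fun x => Re (f x))) /\
  leb.-integrable (circle R) (EFin \o (fun x => Im (f x))).

Definition cj f : R -> C := fun x => (f x)^*.

Definition bounded_cfun f :=
  cfun_measurable f /\ exists M : R, forall x, `|Re (f x)| <= M /\ `|Im (f x)| <= M.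

Lemma measurable_circle : measurable (circle R : set (measurableTypeR R)).
Proof. exact: measurable_itv. Qed.
Hint Resolve measurable_circle : core.

Lemma cReD (a b : C) : Re (a + b) = Re a + Re b.
Proof. by case: a b => [? ?] []. Qed.
Lemma cImD (a b : C) : Im (a + b) = Im a + Im b.
Proof. by case: a b => [? ?] []. Qed.
Lemma cReM (a b : C) : Re (a * b) = Re a * Re b - Im a * Im b.
Proof. by case: a b => [? ?] []. Qed.
Lemma cImM (a b : C) : Im (a * b) = Re a * Im b + Im a * Re b.
Proof. by case: a b => [? ?] []. Qed.
Lemma cReJ (a : C) : Re a^* = Re a.
Proof. by case: a. Qed.
Lemma cImJ (a : C) : Im a^* = - Im a.
Proof. by case: a. Qed.
Lemma cplx_eq (a b : C) : Re a = Re b -> Im a = Im b -> a = b.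
Proof. by case: a b => [? ?] [? ?] /= -> ->. Qed.

Lemma cfun_measurableD f g : cfun_measurable f -> cfun_measurable g -> cfun_measurable (f + g).
Proof.
move=> [f1 f2] [g1 g2]; split.
  by under eq_fun do rewrite cReD; apply: measurable_funD.
by under eq_fun do rewrite cImD; apply: measurable_funD.
Qed.

Lemma cfun_measurableM f g : cfun_measurable f -> cfun_measurable g -> cfun_measurable (f * g).
Proof.
move=> [f1 f2] [g1 g2]; split.
  by under eq_fun do rewrite cReM; apply: measurable_funB; apply: measurable_funM.
by under eq_fun do rewrite cImM; apply: measurable_funD; apply: measurable_funM.
Qed.

Lemma cfun_measurable_cst c : cfun_measurable (cst c).
Proof. by split; exact: measurable_cst. Qed.

Lemma cfun_measurableJ f : cfun_measurable f -> cfun_measurable (cj f).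
Proof.
move=> [f1 f2]; split.
  by under eq_fun do rewrite cReJ.
by under eq_fun do rewrite cImJ; apply: measurable_funN.
Qed.

Lemma integrable_scale (r : R) (f : R -> R) : leb.-integrable (circle R) (EFin \o f) ->
  leb.-integrable (circle R) (EFin \o (fun x => r * f x)).
Proof. by move=> fi; have := integrableZl measurable_circle r fi. Qed.

Lemma integrable_add (f g : R -> R) : leb.-integrable (circle R) (EFin \o f) ->
  leb.-integrable (circle R) (EFin \o g) ->
  leb.-integrable (circle R) (EFin \o (fun x => f x + g x)).
Proof. by move=> fi gi; have := integrableD measurable_circle fi gi. Qed.

Lemma circle_meanD f g : cintegrable f -> cintegrable g ->
  circle_mean (f + g) = circle_mean f + circle_mean g.
Proof.
move=> [f1 f2] [g1 g2]; apply: cplx_eq; rewrite /= /circle_mean.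
  under eq_Rintegral do rewrite cReD.
  by rewrite RintegralD//= mulrDr.
under eq_Rintegral do rewrite cImD.
by rewrite RintegralD//= mulrDr.
Qed.

Lemma circle_meanZ c f : cintegrable f -> circle_mean (c *: f) = c * circle_mean f.
Proof.
move=> [f1 f2]; apply: cplx_eq; rewrite ?cReM ?cImM /= /circle_mean.
  under eq_Rintegral do rewrite cReM.
  rewrite RintegralB ?RintegralZl//; [ring|exact: integrable_scale..].
under eq_Rintegral do rewrite cImM.
rewrite RintegralD ?RintegralZl//; [ring|exact: integrable_scale..].
Qed.

Lemma circle_meanJ f : cintegrable f -> circle_mean (cj f) = (circle_mean f)^*.
Proof.
move=> [f1 f2]; rewrite /circle_mean /cj; apply: cplx_eq => /=.
  by under eq_Rintegral do rewrite cReJ.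
under eq_Rintegral do rewrite cImJ -mulN1r.
by rewrite RintegralZl//; ring.
Qed.

Lemma circle_mean_ae f g : cfun_measurable f -> cfun_measurable g ->
  ae_equal f g -> circle_mean f = circle_mean g.
Proof.
move=> [f1 f2] [g1 g2] fg; apply: cplx_eq; rewrite /= /circle_mean /Rintegral; congr (_ * fine _).
  apply: ae_eq_integral => //; try exact/measurable_EFinP.
  exact: (ae_eq_comp (fun z => (Re z)%:E) fg).
apply: ae_eq_integral => //; try exact/measurable_EFinP.
exact: (ae_eq_comp (fun z => (Im z)%:E) fg).
Qed.

Lemma sqi_integrable f : square_integrable f <->
  cfun_measurable f /\ leb.-integrable (circle R) (EFin \o (fun x => sqnorm (f x))).
Proof.
have sq0 z : 0 <= @sqnorm R z by rewrite /sqnorm addr_ge0// sqr_ge0.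
split=> [[f1 f2 f3]|[[f1 f2] /integrableP[_ f3]]]; split => //.
  apply/integrableP; split.
    by apply/measurable_EFinP; apply: measurable_funD; apply: measurable_funX.
  by under eq_integral do rewrite /= ger0_norm//.
by move: f3; under eq_integral do rewrite /= ger0_norm//.
Qed.

Lemma sqi_measurable f : square_integrable f -> cfun_measurable f.
Proof. by case. Qed.

Lemma bound_sqnorm (a b c d : R) :
  `|a * c - b * d| <= `|a ^+ 2 + b ^+ 2 + (c ^+ 2 + d ^+ 2)|.
Proof.
have h1 := sqr_ge0 (a + c); have h2 := sqr_ge0 (a - c).
have h3 := sqr_ge0 (b + d); have h4 := sqr_ge0 (b - d).
rewrite [X in _ <= X]ger0_norm ?addr_ge0 ?sqr_ge0// ler_norml; apply/andP; split; nra.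
Qed.

Lemma sqiM f g : square_integrable f -> square_integrable g -> cintegrable (f * g).
Proof.
move=> /sqi_integrable[mf fi] /sqi_integrable[mg gi].
have [mR mI] := cfun_measurableM mf mg.
have fg := integrable_add fi gi.
split; apply: le_integrable fg => //; try exact/measurable_EFinP.
  by move=> x _; rewrite lee_fin cReM; exact: bound_sqnorm.
move=> x _; rewrite lee_fin cImM.
have := bound_sqnorm (Re (f x)) (- Im (f x)) (Im (g x)) (Re (g x)).
by rewrite mulNr opprK sqrrN [Im (g x) ^+ 2 + _]addrC.
Qed.

Lemma sqiJ f : square_integrable f -> square_integrable (cj f).
Proof.
move=> /sqi_integrable[mf fi]; apply/sqi_integrable; split; first exact: cfun_measurableJ.
rewrite (_ : _ \o _ = EFin \o (fun x => sqnorm (f x)))//.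
by apply/funext => x; rewrite /= /sqnorm cReJ cImJ sqrrN.
Qed.

Lemma sqiD f g : square_integrable f -> square_integrable g -> square_integrable (f + g).
Proof.
move=> /sqi_integrable[mf fi] /sqi_integrable[mg gi].
have [mR mI] := cfun_measurableD mf mg.
apply/sqi_integrable; split => //.
have fg := integrable_scale 2 (integrable_add fi gi).
apply: le_integrable fg => //.
  by apply/measurable_EFinP; apply: measurable_funD; apply: measurable_funX.
move=> x _; rewrite lee_fin /sqnorm cReD cImD.
have [h1 h2] := (sqr_ge0 (Re (f x) - Re (g x)), sqr_ge0 (Im (f x) - Im (g x))).
have h3 := sqr_ge0 (Re (f x)); have h4 := sqr_ge0 (Im (f x)).
have h5 := sqr_ge0 (Re (g x)); have h6 := sqr_ge0 (Im (g x)).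
rewrite !ger0_norm ?addr_ge0 ?sqr_ge0//; nra.
Qed.

Lemma sqi_bounded_mul f g : bounded_cfun f -> square_integrable g -> square_integrable (f * g).
Proof.
move=> [mf [M fM]] /sqi_integrable[mg gi].
have [mR mI] := cfun_measurableM mf mg.
apply/sqi_integrable; split => //.
apply: le_integrable (integrable_scale (2 * M ^+ 2) gi) => //.
  by apply/measurable_EFinP; apply: measurable_funD; apply: measurable_funX.
move=> x _ /=; rewrite lee_fin.
have {fM}[f1 f2] := fM x.
have M0 : 0 <= M by apply: le_trans f1.
have e : sqnorm (f x * g x) = sqnorm (f x) * sqnorm (g x).
  by rewrite /sqnorm cReM cImM; ring.
have f0 : sqnorm (f x) <= 2 * M ^+ 2.
  have : Re (f x) ^+ 2 <= M ^+ 2 by rewrite -real_normK ?num_real// ler_sqr ?nnegrE.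
  have : Im (f x) ^+ 2 <= M ^+ 2 by rewrite -real_normK ?num_real// ler_sqr ?nnegrE.
  rewrite /sqnorm; lra.
have s0 z : 0 <= @sqnorm R z by rewrite /sqnorm addr_ge0// sqr_ge0.
rewrite !ger0_norm ?mulr_ge0 ?sqr_ge0// e ler_wpM2r//.
Qed.

Lemma bounded_cst c : bounded_cfun (cst c).
Proof.
split; first exact: cfun_measurable_cst.
by exists (Num.max `|Re c| `|Im c|) => x /=; rewrite !le_max !lexx orbT.
Qed.

Lemma boundedD f g : bounded_cfun f -> bounded_cfun g -> bounded_cfun (f + g).
Proof.
move=> [mf [M fM]] [mg [M' gM]]; split; first exact: cfun_measurableD.
exists (M + M') => x; have [f1 f2] := fM x; have [g1 g2] := gM x.
by rewrite cReD cImD; split; rewrite (le_trans (ler_normD _ _))// lerD.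
Qed.

Lemma boundedM f g : bounded_cfun f -> bounded_cfun g -> bounded_cfun (f * g).
Proof.
move=> [mf [M fM]] [mg [M' gM]]; split; first exact: cfun_measurableM.
exists (2 * (M * M')) => x; have [f1 f2] := fM x; have [g1 g2] := gM x.
have MM a b : `|a| <= M -> `|b| <= M' -> `|a * b| <= M * M'.
  by move=> ? ?; rewrite normrM ler_pM.
rewrite cReM cImM; split.
  by rewrite (le_trans (ler_normB _ _))// mulr_natl mulr2n lerD ?MM.
by rewrite (le_trans (ler_normD _ _))// mulr_natl mulr2n lerD ?MM.
Qed.

Lemma boundedJ f : bounded_cfun f -> bounded_cfun (cj f).
Proof.
move=> [mf [M fM]]; split; first exact: cfun_measurableJ.
by exists M => x; have [f1 f2] := fM x; rewrite cReJ cImJ normrN.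
Qed.

Lemma sqi_cst c : square_integrable (cst c).
Proof.
apply/sqi_integrable; split; first exact: cfun_measurable_cst.
apply: measurable_bounded_integrable => //.
- have e := @lebesgue_measure_itv R `[0, 2 * pi].
  by apply: (@eq_ind_r _ _ (fun z => z < +oo)%E _ _ e); case: ifP; rewrite ?ltry.
- by rewrite (_ : (fun=> _) = cst (sqnorm c)).
- exists `|sqnorm c|; split; first exact: num_real.
  by move=> M cM x _ /=; apply: ltW.
Qed.

Lemma sqi_bounded f : bounded_cfun f -> square_integrable f.
Proof. by move=> bf; have := sqi_bounded_mul bf (sqi_cst 1); rewrite mulr1. Qed.

Lemma sqiZ c f : square_integrable f -> square_integrable (c *: f).
Proof. by move=> sf; exact: (sqi_bounded_mul (bounded_cst c) sf). Qed.

Lemma sqiN f : square_integrable f -> square_integrable (- f).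
Proof. by move=> sf; rewrite -scaleN1r; exact: sqiZ. Qed.

Lemma sqiB f g : square_integrable f -> square_integrable g -> square_integrable (f - g).
Proof. by move=> sf sg; apply: sqiD => //; apply: sqiN. Qed.

Lemma sqi0 : square_integrable (0 : R -> C).
Proof. exact: sqi_cst. Qed.

Lemma sqi_sum (I : Type) (s : seq I) (P : pred I) (F : I -> R -> C) :
  (forall i, P i -> square_integrable (F i)) -> square_integrable (\sum_(i <- s | P i) F i).
Proof. by move=> sF; elim/big_ind : _ => //; [exact: sqi0|exact: sqiD]. Qed.

Lemma innerE f g : inner f g = circle_mean (f * cj g).
Proof. by []. Qed.

Lemma innerDl f g h : square_integrable f -> square_integrable g -> square_integrable h ->
  inner (f + g) h = inner f h + inner g h.
Proof.
by move=> sf sg sh; rewrite !innerE mulrDl circle_meanD//; apply: sqiM => //; exact: sqiJ.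
Qed.

Lemma innerZl c f g : square_integrable f -> square_integrable g ->
  inner (c *: f) g = c * inner f g.
Proof.
move=> sf sg; rewrite !innerE -circle_meanZ; last by apply: sqiM => //; exact: sqiJ.
by congr circle_mean; apply/funext => x; exact: esym (mulrA c (f x) _).
Qed.

Lemma inner_conj f g : square_integrable f -> square_integrable g ->
  inner g f = (inner f g)^*.
Proof.
move=> sf sg; rewrite !innerE -circle_meanJ; last by apply: sqiM => //; exact: sqiJ.
congr circle_mean; apply/funext => x.
rewrite (_ : (g * cj f) x = g x * (f x)^*)// (_ : cj (f * cj g) x = (f x * (g x)^*)^*)//.
by rewrite rmorphM /= conjCK mulrC.
Qed.

Lemma innerDr f g h : square_integrable f -> square_integrable g -> square_integrable h ->
  inner h (f + g) = inner h f + inner h g.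
Proof.
move=> sf sg sh; rewrite inner_conj//; last exact: sqiD.
by rewrite innerDl// (inner_conj sf sh) (inner_conj sg sh) rmorphD.
Qed.

Lemma innerZr c f g : square_integrable f -> square_integrable g ->
  inner g (c *: f) = c^* * inner g f.
Proof.
move=> sf sg; rewrite inner_conj//; last exact: sqiZ.
by rewrite innerZl// (inner_conj sf sg) rmorphM.
Qed.

Lemma inner0l g : inner 0 g = 0.
Proof.
rewrite innerE mul0r /circle_mean; apply: cplx_eq => /=; rewrite /Rintegral integral0 /= mulr0//.
Qed.

Lemma inner0r g : inner g 0 = 0.
Proof.
rewrite innerE (_ : cj 0 = 0); first by rewrite mulr0 -(inner0l 0) innerE mul0r.
by apply/funext => x; exact: conjC0.
Qed.

Lemma innerNl f g : square_integrable f -> square_integrable g -> inner (- f) g = - inner f g.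
Proof. by move=> sf sg; rewrite -scaleN1r innerZl// mulN1r. Qed.

Lemma innerNr f g : square_integrable f -> square_integrable g -> inner g (- f) = - inner g f.
Proof. by move=> sf sg; rewrite -scaleN1r innerZr// rmorphN1 mulN1r. Qed.

Lemma innerBl f g h : square_integrable f -> square_integrable g -> square_integrable h ->
  inner (f - g) h = inner f h - inner g h.
Proof. by move=> sf sg sh; rewrite innerDl// ?innerNl//; exact: sqiN. Qed.

Lemma innerBr f g h : square_integrable f -> square_integrable g -> square_integrable h ->
  inner h (f - g) = inner h f - inner h g.
Proof. by move=> sf sg sh; rewrite innerDr// ?innerNr//; exact: sqiN. Qed.

Lemma inner_suml (I : Type) (s : seq I) (P : pred I) (F : I -> R -> C) h :
  (forall i, P i -> square_integrable (F i)) -> square_integrable h ->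
  inner (\sum_(i <- s | P i) F i) h = \sum_(i <- s | P i) inner (F i) h.
Proof.
move=> sF sh; elim: s => [|i s IH]; first by rewrite !big_nil inner0l.
rewrite !big_cons; case: ifP => // Pi; rewrite innerDl// ?IH//; [exact: sF|exact: sqi_sum].
Qed.

Lemma inner_sumr (I : Type) (s : seq I) (P : pred I) (F : I -> R -> C) h :
  (forall i, P i -> square_integrable (F i)) -> square_integrable h ->
  inner h (\sum_(i <- s | P i) F i) = \sum_(i <- s | P i) inner h (F i).
Proof.
move=> sF sh; elim: s => [|i s IH]; first by rewrite !big_nil inner0r.
rewrite !big_cons; case: ifP => // Pi; rewrite innerDr// ?IH//; [exact: sF|exact: sqi_sum].
Qed.

Lemma ae_equal_refl f : ae_equal f f.
Proof. exact: ae_eq_refl. Qed.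

Lemma ae_equal_sym f g : ae_equal f g -> ae_equal g f.
Proof. exact: ae_eq_sym. Qed.

Lemma ae_equal_trans g f h : ae_equal f g -> ae_equal g h -> ae_equal f h.
Proof. exact: ae_eq_trans. Qed.

Lemma ae_equal_comp2 (op : C -> C -> C) f1 f2 g1 g2 : ae_equal f1 f2 -> ae_equal g1 g2 ->
  ae_equal (fun x => op (f1 x) (g1 x)) (fun x => op (f2 x) (g2 x)).
Proof.
move=> h1 h2; apply: (@ae_equal_trans (fun x => op (f2 x) (g1 x))).
  exact: (@ae_eq_comp2 _ _ _ leb (circle R) C C (fun x y => op y (g1 x)) f1 f2 h1).
exact: (@ae_eq_comp2 _ _ _ leb (circle R) C C (fun x y => op (f2 x) y) g1 g2 h2).
Qed.

Lemma ae_equalD f1 f2 g1 g2 : ae_equal f1 f2 -> ae_equal g1 g2 -> ae_equal (f1 + g1) (f2 + g2).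
Proof. by exact: (@ae_equal_comp2 (fun a b => a + b)). Qed.

Lemma ae_equalM f1 f2 g1 g2 : ae_equal f1 f2 -> ae_equal g1 g2 -> ae_equal (f1 * g1) (f2 * g2).
Proof. by exact: (@ae_equal_comp2 (fun a b => a * b)). Qed.

Lemma ae_equalZ c f g : ae_equal f g -> ae_equal (c *: f) (c *: g).
Proof. by apply: ae_equalM; exact: ae_equal_refl. Qed.

Lemma ae_equalJ f g : ae_equal f g -> ae_equal (cj f) (cj g).
Proof. by move=> fg; exact: (ae_eq_comp (fun z => z^*) fg). Qed.

Lemma inner_ae f1 f2 g1 g2 : square_integrable f1 -> square_integrable f2 ->
  square_integrable g1 -> square_integrable g2 ->
  ae_equal f1 f2 -> ae_equal g1 g2 -> inner f1 g1 = inner f2 g2.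
Proof.
move=> [? ? _] [? ? _] [? ? _] [? ? _] e1 e2; apply: circle_mean_ae.
- by apply: cfun_measurableM => //; exact: cfun_measurableJ.
- by apply: cfun_measurableM => //; exact: cfun_measurableJ.
- by apply: ae_equalM => //; exact: ae_equalJ.
Qed.

(** The integrands agree pointwise, so the identity also covers products such as [cj u * f] that are
    merely integrable. It is the means of moving [ek k], [u] and Blaschke factors across an inner
    product. *)
Lemma inner_bounded_mul b f g : inner (b * f) g = inner f (cj b * g).
Proof.
rewrite !innerE; congr circle_mean; apply/funext => x.
change (b x * f x * (g x)^* = f x * ((b x)^* * g x)^*).
by rewrite [X in f x * X](rmorphM Num.conj) /= conjCK; ring.
Qed.

End CircleMean.

(** * Exponentials and their orthonormality *)

Section Exponentials.
Variable R : realType.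
Local Notation C := R[i].
Local Notation leb := (@lebesgue_measure R).
Implicit Types (f g h u : R -> C) (k : int) (c : C).

Definition ek (k : int) : R -> C := fun x => expi (k%:~R * x).

Lemma expiD (a b : R) : expi (a + b) = expi a * expi b.
Proof. by apply: cplx_eq; rewrite ?cReM ?cImM /= ?cosD ?sinD //; ring. Qed.

Lemma expi0 : expi (0 : R) = 1.
Proof. by rewrite /expi cos0 sin0. Qed.

Lemma expiN (a : R) : expi (- a) = (expi a)^*.
Proof. by rewrite /expi cosN sinN. Qed.

Lemma expiK (a : R) : expi a * (expi a)^* = 1.
Proof. by rewrite -expiN -expiD subrr expi0. Qed.

Lemma ekD j k : ek (j + k) = ek j * ek k.
Proof. by apply/funext => x; rewrite /ek rmorphD mulrDl expiD. Qed.

Lemma ek0 : ek 0 = 1.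
Proof. by apply/funext => x; rewrite /ek mul0r expi0. Qed.

Lemma cj_ek k : cj (ek k) = ek (- k).
Proof. by apply/funext => x; rewrite /ek rmorphN mulNr expiN. Qed.

Lemma shiftE f : Defs.shift f = ek 1 * f.
Proof. by apply/funext => x; rewrite /Defs.shift -[x in expi x]mul1r. Qed.

Lemma cos_lin_continuous (m : R) : continuous (fun x : R => cos (m * x)).
Proof.
move=> x; apply: continuous_comp; last exact: continuous_cos.
by apply: continuousM; [exact: cvg_cst|exact: cvg_id].
Qed.

Lemma sin_lin_continuous (m : R) : continuous (fun x : R => sin (m * x)).
Proof.
move=> x; apply: continuous_comp; last exact: continuous_sin.
by apply: continuousM; [exact: cvg_cst|exact: cvg_id].
Qed.

Lemma ek_bounded k : bounded_cfun (ek k).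
Proof.
split.
  split; apply: measurable_funTS; apply: continuous_measurable_fun.
    exact: cos_lin_continuous.
  exact: sin_lin_continuous.
by exists 1 => x /=; rewrite !ler_norml cos_geN1 cos_le1 sin_geN1 sin_le1.
Qed.

Lemma ek_sqi k : square_integrable (ek k).
Proof. exact/sqi_bounded/ek_bounded. Qed.

Lemma fourierE f k : fourier f k = inner f (ek k).
Proof.
rewrite innerE cj_ek; congr circle_mean; apply/funext => x.
change (expi (- (k%:~R * x)) * f x = f x * expi ((- k)%:~R * x)).
by rewrite mulrC rmorphN mulNr.
Qed.

Lemma pi2_gt0 : 0 < 2 * pi :> R.
Proof. by rewrite mulr_gt0// pi_gt0. Qed.

Lemma Rintegral_derive (f F : R -> R) : continuous f -> 
  (forall x, is_derive x (1:R) F (f x)) -> F 0 = F (2 * pi) ->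
  (\int[leb]_(x in circle R) f x)%R = 0.
Proof.
move=> cf dF F0.
have cF : continuous F.
  by move=> x; apply/differentiable_continuous/derivable1_diffP; have := dF x; case.
rewrite /Rintegral /circle (@continuous_FTC2 _ f F) ?pi2_gt0//.
- by rewrite /= F0 subrr.
- exact: continuous_subspaceT.
- split; last 2 first.
  + apply: cvg_at_right_filter; exact: cF.
  + apply: cvg_at_left_filter; exact: cF.
  by move=> x _; have := dF x; case.
- by move=> x _; rewrite derive1E; apply: derive_val.
Qed.

Lemma circle_mean1 : circle_mean (1 : R -> C) = 1.
Proof.
apply: cplx_eq; rewrite /= /circle_mean.
  have e := @lebesgue_measure_itv R `[0, 2 * pi].
  rewrite Rintegral_cst; last exact: measurable_circle.
  rewrite mul1r.
  transitivity ((2 * pi)^-1 * fine (if (0%:E < (2 * pi : R)%:E)%E then ((2 * pi : R)%:E - 0%:E)%E else 0%E)).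
    by congr (_ * fine _).
  by rewrite lte_fin pi2_gt0 /= subr0 mulVf// gt_eqF// pi2_gt0.
by rewrite /Rintegral integral0 /= mulr0.
Qed.

Lemma cos_2pi_int k : cos (k%:~R * (2 * pi)) = 1 :> R.
Proof.
have H (n : nat) : cos (n%:R * (2 * pi)) = 1 :> R.
  elim: n => [|n IH]; first by rewrite mul0r cos0.
  by rewrite -natr1 mulrDl mul1r [in X in _ + X]mulr_natl cosD2pi.
case: k => n; first exact: H.
by rewrite NegzE rmorphN mulNr cosN; exact: H.
Qed.

Lemma sin_2pi_int k : sin (k%:~R * (2 * pi)) = 0 :> R.
Proof.
have := cos2Dsin2 (k%:~R * (2 * pi) : R); rewrite cos_2pi_int expr1n => /eqP.
by rewrite -subr_eq0 addrAC subrr add0r sqrf_eq0 => /eqP.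
Qed.

Lemma circle_mean_ek k : circle_mean (ek k) = (k == 0)%:R.
Proof.
have [->|k0] := eqVneq k 0; first by rewrite ek0 circle_mean1.
have k0' : k%:~R != 0 :> R by rewrite intr_eq0.
have dS x : is_derive x (1:R) (fun x => k%:~R^-1 * sin (k%:~R * x)) (cos (k%:~R * x)).
  by apply: is_derive_eq; rewrite /GRing.scale /=; field.
have dC x : is_derive x (1:R) (fun x => - k%:~R^-1 * cos (k%:~R * x)) (sin (k%:~R * x)).
  by apply: is_derive_eq; rewrite /GRing.scale /=; field.
apply: cplx_eq; rewrite /= /circle_mean.
  rewrite (Rintegral_derive (@cos_lin_continuous _) dS) ?mulr0//.
  by rewrite sin_2pi_int sin0.
rewrite (Rintegral_derive (@sin_lin_continuous _) dC) ?mulr0//.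
by rewrite cos_2pi_int cos0.
Qed.

Lemma inner_ek j k : inner (ek j) (ek k) = (j == k)%:R.
Proof. by rewrite innerE cj_ek -ekD circle_mean_ek subr_eq0. Qed.

End Exponentials.

(** * Uniqueness of Fourier coefficients *)

Section RealLimits.
Variable R : realType.

Lemma bernoulli_ineq (x : R) n : -1 <= x -> 1 + n%:R * x <= (1 + x) ^+ n.
Proof.
move=> x1; elim: n => [|n IH]; first by rewrite mul0r addr0 expr0.
rewrite exprSr; apply: (@le_trans _ _ ((1 + n%:R * x) * (1 + x))).
  have := sqr_ge0 x; have : 0 <= n%:R :> R by []. rewrite -natr1; nra.
by rewrite ler_wpM2r//; lra.
Qed.

(** With s the square root of r, k r^k = (k s^k) s^k, and Bernoulli's inequality applied to 1/s
    bounds k s^k by s / (1 - s). *)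
Lemma natr_mul_geometric (r : R) : 0 <= r < 1 ->
  exists C s : R, [/\ 0 <= C, 0 <= s < 1 & forall k : nat, k%:R * r ^+ k <= C * s ^+ k].
Proof.
move=> /andP[r0 r1].
have [->|rn0] := eqVneq r 0.
  exists 0, 0; split; rewrite ?lexx ?ltr01//.
  by move=> [|k]; rewrite ?mul0r// exprS mul0r mulr0.
have r0' : 0 < r by rewrite lt_neqAle eq_sym rn0.
set s := Num.sqrt r.
have s0 : 0 < s by rewrite sqrtr_gt0.
have s1 : s < 1 by rewrite -sqrtr1 ltr_sqrt.
have rs : r = s * s by rewrite -expr2 sqr_sqrtr.
exists (s / (1 - s)), s; split; rewrite ?s0 ?s1 ?(ltW s0)//.
  by rewrite divr_ge0 ?(ltW s0)// subr_ge0 ltW.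
move=> k; rewrite rs exprMn mulrA ler_pM2r ?exprn_gt0//.
have := @bernoulli_ineq (s^-1 - 1) k; rewrite [1 + (_ - 1)]addrC subrK => H.
have si0 : 0 <= s^-1 by rewrite invr_ge0 ltW.
have {}H : k%:R * (s^-1 - 1) <= s^-1 ^+ k.
  by apply: le_trans (H _); [rewrite lerDr|rewrite lerBrDr addrC subrr].
have e : s^-1 - 1 = (1 - s) / s by field; rewrite gt_eqF.
rewrite ler_pdivlMr ?subr_gt0//.
rewrite e in H.
have : k%:R * ((1 - s) / s) * (s * s ^+ k) <= s^-1 ^+ k * (s * s ^+ k).
  by rewrite ler_wpM2r// mulr_ge0 ?exprn_ge0 ?ltW.
rewrite exprVn => H2.
have -> : k%:R * s ^+ k * (1 - s) = k%:R * ((1 - s) / s) * (s * s ^+ k).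
  by field; rewrite gt_eqF.
apply: le_trans H2 _.
by rewrite mulrCA mulVf ?mulr1// expf_neq0// gt_eqF.
Qed.

(** Approximates the indicator of [1/2, 1] on [0, 1], as in the elementary proof of the
    Stone-Weierstrass theorem. The exponent n 2^n makes n (2y)^n the decisive quantity: it tends to
    0 for y < 1/2 and is at least n for y >= 1/2. *)
Definition step_poly (n : nat) (y : R) : R := 1 - (1 - y ^+ n) ^+ (n * 2 ^ n).

Lemma step_poly_itv n y : 0 <= y <= 1 -> 0 <= step_poly n y <= 1.
Proof.
move=> /andP[y0 y1]; rewrite /step_poly.
have z0 : 0 <= 1 - y ^+ n <= 1 by rewrite subr_ge0 exprn_ile1//= gerBl exprn_ge0.
have /andP[a b] := z0.
by rewrite subr_ge0 exprn_ile1//= gerBl exprn_ge0.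
Qed.

(** Both cases are Bernoulli's inequality. For y >= 1/2, (1 - y^n)(1 + y^n) <= 1 bounds the power by
    1 / (1 + n (2y)^n) <= 1 / (n + 1); for y < 1/2 the step is at most n (2y)^n. *)
Lemma cvg_step_poly y : 0 <= y <= 1 ->
  step_poly n y @[n --> \oo] --> (if 2^-1 <= y then 1 else 0 : R).
Proof.
move=> /andP[y0 y1].
have z0 n : 0 <= y ^+ n <= 1 by rewrite exprn_ge0//= exprn_ile1.
have [yh|yh] := leP 2^-1 y.
  rewrite -[X in _ --> X]subr0; apply: cvgB; first exact: cvg_cst.
  have lb n : 0 <= (1 - y ^+ n) ^+ (n * 2 ^ n) <= n.+1%:R^-1.
    have /andP[z1 z2] := z0 n.
    apply/andP; split; first by rewrite exprn_ge0// subr_ge0.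
    have H1 : (1 - y ^+ n) ^+ (n * 2 ^ n) * (1 + y ^+ n) ^+ (n * 2 ^ n) <= 1.
      by rewrite -exprMn exprn_ile1//; nra.
    have H2 : n.+1%:R <= (1 + y ^+ n) ^+ (n * 2 ^ n).
      apply: le_trans (bernoulli_ineq _ _); last by apply: le_trans z1; rewrite oppr_le0.
      rewrite -addn1 addrC natrD lerD2r natrM -mulrA ler_peMr//.
      by rewrite natrX -exprMn exprn_ege1//; lra.
    rewrite -div1r ler_pdivlMr//; apply: le_trans H1.
    by rewrite ler_wpM2l// exprn_ge0// subr_ge0.
  apply: squeeze_cvgr; [|exact: cvg_cst|exact: cvg_harmonic].
  exact: nearW.
have [|C [s [C0 s01 Hs]]] := @natr_mul_geometric (2 * y).
  by apply/andP; split; lra.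
have lb n : 0 <= step_poly n y <= C * s ^+ n.
  have /andP[-> _] := @step_poly_itv n y (introT andP (conj y0 y1)) => /=.
  apply: le_trans (Hs n); rewrite exprMn mulrA /step_poly lerBlDr.
  have /andP[z1 z2] := z0 n.
  have := @bernoulli_ineq (- y ^+ n) (n * 2 ^ n).
  rewrite natrM natrX mulrN lerN2 => /(_ z2); lra.
apply: squeeze_cvgr; [|exact: cvg_cst|].
  exact: nearW lb.
by apply: cvg_geometric; have /andP[? ?] := s01; rewrite ger0_norm.
Qed.

End RealLimits.

Section FourierUniqueness.
Variable R : realType.
Local Notation C := R[i].
Local Notation leb := (@lebesgue_measure R).
Local Notation Re := complex.Re.
Local Notation Im := complex.Im.
Implicit Types (f g h u t : R -> C) (k : int).

(** A trigonometric polynomial of degree 1 with values in [0, 1] that is at least 1/2 exactly on the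
    half-circle centred at [c]; composing [step_poly] with it gives trigonometric polynomials that
    tend to the indicator of that half-circle. *)
Definition cos_bump (c x : R) : R := (1 + cos (x - c)) / 2.

Lemma cos_bump_itv (c x : R) : 0 <= cos_bump c x <= 1.
Proof.
have := cos_le1 (x - c); have := cos_geN1 (x - c); rewrite /cos_bump => h1 h2.
by apply/andP; split; lra.
Qed.

Lemma cos_bump_ge (c x : R) : (2^-1 <= cos_bump c x) = (0 <= cos (x - c)).
Proof. by apply/idP/idP; rewrite /cos_bump; lra. Qed.

Definition real_step n (c c' x : R) := step_poly n (cos_bump c x) * step_poly n (cos_bump c' x).

Lemma real_step_itv n c c' x : 0 <= real_step n c c' x <= 1.
Proof.
have /andP[? ?] := step_poly_itv n (cos_bump_itv c x).
have /andP[? ?] := step_poly_itv n (cos_bump_itv c' x).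
by rewrite /real_step mulr_ge0// mulr_ile1.
Qed.

(* The half-circles [sin (x - a) >= 0] and [sin (b - x) >= 0] meet in the arc [a, b]. *)
Lemma cvg_real_step a b x : 0 < a -> a < b -> b < 2 * pi -> b - a < pi ->
  0 <= x <= 2 * pi ->
  real_step n (a + pi / 2) (b - pi / 2) x @[n --> \oo] --> ((if a <= x <= b then 1 else 0) : R).
Proof.
move=> a0 ab b2 bapi /andP[x0 x2].
have pi0 := pi_gt0 R.
have -> : (if a <= x <= b then 1 else 0 : R) =
    (if 2^-1 <= cos_bump (a + pi / 2) x then 1 else 0) *
    (if 2^-1 <= cos_bump (b - pi / 2) x then 1 else 0).
  rewrite !cos_bump_ge opprD addrA cosBpihalf opprB addrA addrAC cosDpihalf -sinN opprB.
  have [ax|xa] := leP a x; last first.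
    have [xpi|pix] := ltP (a - x) pi.
      have s1 : sin (x - a) < 0.
        by rewrite -opprB sinN oppr_lt0; apply: sin_gt0_pi; apply/andP; split; lra.
      by rewrite [X in (if X then _ else _) * _]leNgt s1 mul0r.
    have s1 : sin (b - x) < 0.
      have := @sin_gt0_pi R (b - x - pi).
      have := sinDpi (b - x - pi); rewrite subrK => ->.
      by move=> H; rewrite oppr_lt0; apply: H; apply/andP; split; lra.
    by rewrite [X in _ * (if X then _ else _)]leNgt s1 mulr0.
  have [xb|bx] := leP x b.
    have -> : 0 <= sin (x - a) by apply: sin_ge0_pi; apply/andP; split; lra.
    have -> : 0 <= sin (b - x) by apply: sin_ge0_pi; apply/andP; split; lra.
    by rewrite mulr1.
  have [xpi|pix] := leP (x - a) pi.
    have s1 : sin (b - x) < 0.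
      by rewrite -opprB sinN oppr_lt0; apply: sin_gt0_pi; apply/andP; split; lra.
    by rewrite [X in _ * (if X then _ else _)]leNgt s1 mulr0.
  have s1 : sin (x - a) < 0.
    have := @sin_gt0_pi R (x - a - pi).
    have := sinDpi (x - a - pi); rewrite subrK => ->.
    by move=> H; rewrite oppr_lt0; apply: H; apply/andP; split; lra.
  by rewrite [X in (if X then _ else _) * _]leNgt s1 mul0r.
have H d : step_poly n (cos_bump d x) @[n --> \oo] --> (if 2^-1 <= cos_bump d x then 1 else 0 : R).
  by apply: cvg_step_poly; exact: cos_bump_itv.
exact: (cvgM (H _) (H _)).
Qed.

Lemma continuous_cos_bump c : continuous (cos_bump c).
Proof.
move=> x; apply: cvgM; last exact: cvg_cst.
apply: cvgD; first exact: cvg_cst.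
apply: (@continuous_comp _ _ _ (fun y => y - c)); last exact: continuous_cos.
by apply: cvgB; [exact: cvg_id|exact: cvg_cst].
Qed.

Lemma measurable_real_step n c c' : measurable_fun (circle R) (real_step n c c').
Proof.
have H d : measurable_fun (circle R) (fun x => step_poly n (cos_bump d x)).
  apply: measurable_funB => //; apply: measurable_funX; apply: measurable_funB => //.
  apply: measurable_funX; apply: measurable_funTS; apply: continuous_measurable_fun.
  exact: continuous_cos_bump.
exact: measurable_funM.
Qed.

(** Dominated convergence, with |h| as dominating function, passes from trigonometric polynomials to
    indicators of arcs. *)
Lemma Rintegral_arc (h : R -> R) : leb.-integrable (circle R) (EFin \o h) ->
  (forall n c c', (\int[leb]_(x in circle R) (h x * real_step n c c' x))%R = 0) ->
  forall a b, 0 < a -> a < b -> b < 2 * pi -> b - a < pi ->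
  (\int[leb]_(x in circle R) (h x * (if a <= x <= b then 1 else 0)))%R = 0.
Proof.
move=> hi h0 a b a0 ab b2 bapi.
have mh : measurable_fun (circle R) h by have := measurable_int leb hi; move/measurable_EFinP.
pose F n x := (h x * real_step n (a + pi / 2) (b - pi / 2) x)%:E.
pose G x := (h x * (if a <= x <= b then 1 else 0))%:E.
have mF n : measurable_fun (circle R) (F n).
  by apply/measurable_EFinP/measurable_funM => //; exact: measurable_real_step.
have FG x : circle R x -> F n x @[n --> \oo] --> G x.
  move=> xc; apply: cvg_EFin; first exact: nearW.
  apply: cvgM; first exact: cvg_cst.
  by apply: cvg_real_step => //; move: xc; rewrite /circle /= in_itv /=.
have mG : measurable_fun (circle R) G.
  by apply: emeasurable_fun_cvg mF _ => x xc; exact: FG.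
have [] := @dominated_convergence _ _ R leb (circle R) (@measurable_circle R) F G
   (fun x => `|h x|%:E) mF mG.
- by apply: aeW => x; exact: FG.
- by have := integrable_abse hi.
- apply: aeW => x n _; rewrite lee_fin normrM ler_piMr//.
  by have /andP[? ?] := real_step_itv n (a + pi / 2) (b - pi / 2) x; rewrite ger0_norm.
move=> Gi _ cv.
have E n : (\int[leb]_(x in circle R) F n x)%E = 0%E.
  have Fi : leb.-integrable (circle R) (F n).
    apply: le_integrable hi; first exact: (@measurable_circle R).
      exact: mF.
    move=> x _; rewrite lee_fin normrM ler_piMr//.
    by have /andP[? ?] := real_step_itv n (a + pi / 2) (b - pi / 2) x; rewrite ger0_norm.
  have := h0 n (a + pi / 2) (b - pi / 2); rewrite /Rintegral => H.
  by rewrite -[LHS]fineK ?H//; apply: integrable_fin_num => //; exact: (@measurable_circle R).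
rewrite /Rintegral.
suff -> : (\int[leb]_(x in circle R) G x)%E = 0%E by [].
apply: cvg_unique cv _; first exact: ereal_hausdorff.
rewrite (_ : [sequence _]_n = cst 0%E); first exact: cvg_cst.
by apply/funext => n /=; exact: E.
Qed.

(** The primitive of [h], extended by 0, is locally constant on (0, 2 pi) because the integrals over
    short arcs vanish; by Lebesgue differentiation its derivative is [h] almost everywhere. *)
Lemma Rintegral_ae0 (h : R -> R) : leb.-integrable (circle R) (EFin \o h) ->
  (forall a b, 0 < a -> a < b -> b < 2 * pi -> b - a < pi ->
    (\int[leb]_(x in circle R) (h x * (if a <= x <= b then 1 else 0)))%R = 0) ->
  ae_eq leb (circle R) h (cst 0).
Proof.
move=> hi h0; set g := h \_ (circle R).
have gi : leb.-integrable setT (EFin \o g).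
  rewrite -restrict_EFin.
  by have [H _] := @integrable_mkcond _ _ _ leb (circle R) (EFin \o h) (@measurable_circle R); exact: H.
have giy y : leb.-integrable `]-oo, y] (EFin \o g).
  apply: integrableS gi => //; exact: measurable_itv.
have locg : locally_integrable setT g.
  by apply: open_integrable_locally => //; exact: openT.
pose F x := (\int[leb]_(t in `]-oo, x]) g t)%R.
have Farc (x y : R) : 0 < x -> x < y -> y < 2 * pi -> y - x < pi -> F y = F x.
  move=> x0 xy y2 yx; apply/eqP; rewrite -subr_eq0; apply/eqP; rewrite /F.
  rewrite Rintegral_itvB//; last by rewrite bnd_simp ltW.
  rewrite Rintegral_itv_obnd_cbnd; last first.
    by apply: integrableS gi => //; exact: measurable_itv.
  rewrite -(h0 x y)// Rintegral_mkcond [in RHS]Rintegral_mkcond.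
  congr (Rintegral _ _ _); apply/funext => t; rewrite !patchE /g patchE.
  rewrite !mem_setE in_itv /=.
  case: (boolP (x <= t <= y)) => [/andP[xt ty]|_]; last by rewrite mulr0 if_same.
  rewrite (_ : t \in `[0, 2 * pi]); first by rewrite mulr1.
  by rewrite in_itv /=; apply/andP; split; lra.
have F0 (x : R) : 0 < x -> x < 2 * pi -> derive1 F x = 0.
  move=> x0 x2; rewrite derive1E (@near_eq_derive _ _ _ F (cst (F x)))//; last first.
    have n1 : \forall y \near x, y \in `]0, 2 * pi[.
      by apply: near_in_itvoo; rewrite in_itv /= x0.
    have n2 : \forall y \near x, y \in `]x - pi, x + pi[.
      by apply: near_in_itvoo; rewrite in_itv /=; have ? := pi_gt0 R; apply/andP; split; lra.
    near=> y.
    have /andP[y0 y2] : 0 < y < 2 * pi by near: y; move: n1; apply: filterS => y; rewrite in_itv.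
    have /andP[y3 y4] : x - pi < y < x + pi by near: y; move: n2; apply: filterS => y; rewrite in_itv.
    have [yx|xy|->] := ltgtP y x; last by [].
      by rewrite /= (Farc y x)//; lra.
    by rewrite /= -(Farc x y)//; lra.
  by rewrite derive_cst.
have := FTC1Ny giy locg.
have n0 : {ae leb, forall x, x != 0}.
  exists [set 0]; split; [exact: measurable_set1|exact: lebesgue_measure_set1|].
  by move=> x /= /negP; rewrite negbK => /eqP.
have n2 : {ae leb, forall x, x != 2 * pi}.
  exists [set 2 * pi]; split; [exact: measurable_set1|exact: lebesgue_measure_set1|].
  by move=> x /= /negP; rewrite negbK => /eqP.
move: n0 n2; apply: filterS3; first exact: (ae_filter_ringOfSetsType leb).
move=> x x0 x2 [_ Fx] /= xc.
have /andP[x0' x2'] : 0 <= x <= 2 * pi by move: xc; rewrite /circle /= in_itv.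
have : derive1 F x = g x by [].
have x1 : 0 < x by rewrite lt_neqAle eq_sym x0.
have x3 : x < 2 * pi by rewrite lt_neqAle x2.
by rewrite F0// /g patchE mem_set.
Unshelve. all: by end_near. Qed.

Section Annihilator.
Variable f : R -> C.
Hypothesis sf : square_integrable f.

Let ann t := bounded_cfun t /\ forall k, circle_mean (f * t * ek k) = 0.

(** [ann t] says that all Fourier coefficients of f t vanish. The multipliers that preserve [ann]
    form an algebra containing the constants and the exponentials, hence every polynomial in
    [cos_bump]. *)
Let mult (s : R -> C) := bounded_cfun s /\ forall t, ann t -> ann (t * s).

Let sfM t k : bounded_cfun t -> cintegrable (f * t * ek k).
Proof.
move=> bt; rewrite -mulrA; apply: sqiM => //; apply: sqi_bounded.
by apply: boundedM => //; exact: ek_bounded.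
Qed.

Let multD s s' : mult s -> mult s' -> mult (s + s').
Proof.
move=> [bs ms] [bs' ms']; split; first exact: boundedD.
move=> t at_; have [b1 a1] := ms t at_; have [b2 a2] := ms' t at_.
split; first by rewrite mulrDr; exact: boundedD.
by move=> k; rewrite !mulrDr mulrDl circle_meanD ?a1 ?a2 ?addr0//; exact: sfM.
Qed.

Let multM s s' : mult s -> mult s' -> mult (s * s').
Proof.
move=> [bs ms] [bs' ms']; split; first exact: boundedM.
by move=> t at_; rewrite mulrA; exact/ms'/ms.
Qed.

Let mult_cst (c : C) : mult (cst c).
Proof.
split; first exact: bounded_cst.
move=> t [bt at_]; split; first by apply: boundedM => //; exact: bounded_cst.
move=> k; rewrite (_ : _ * _ = c *: (f * t * ek k)).
  by rewrite circle_meanZ ?at_ ?mulr0//; exact: sfM.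
by apply/funext => x; change (f x * (t x * c) * ek k x = c * (f x * t x * ek k x)); ring.
Qed.

Let mult_ek j : mult (ek j).
Proof.
split; first exact: ek_bounded.
move=> t [bt at_]; split; first by apply: boundedM => //; exact: ek_bounded.
by move=> k; rewrite mulrA -mulrA -ekD.
Qed.

Let multX s n : mult s -> mult (s ^+ n).
Proof.
move=> ms; elim: n => [|n IH]; first exact: (mult_cst 1).
by rewrite exprS; exact: multM.
Qed.

Let multB s : mult s -> mult (1 - s).
Proof.
move=> ms; rewrite -mulN1r; apply: multD; first exact: (mult_cst 1).
by apply: multM => //; exact: (mult_cst (-1)).
Qed.

Let mult_cos_bump (c : R) : mult (fun x => (cos_bump c x)%:C).
Proof.
rewrite (_ : (fun x => _) = cst (2^-1)%:C + cst ((4^-1)%:C * expi (- c)) * ek 1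
    + cst ((4^-1)%:C * expi c) * ek (-1)).
  apply: multD; first apply: multD; first exact: mult_cst.
    by apply: multM; [exact: mult_cst|exact: mult_ek].
  by apply: multM; [exact: mult_cst|exact: mult_ek].
apply/funext => x; apply: cplx_eq.
  change (cos_bump c x = Re ((2^-1)%:C + (4^-1)%:C * expi (- c) * expi (1%:~R * x) +
    (4^-1)%:C * expi c * expi ((-1)%:~R * x))).
  by rewrite !cReD !cReM !cImM /= /cos_bump mul1r mulN1r cosB !cosN !sinN; field.
change (0 = Im ((2^-1)%:C + (4^-1)%:C * expi (- c) * expi (1%:~R * x) +
    (4^-1)%:C * expi c * expi ((-1)%:~R * x))).
by rewrite !cImD !cImM !cReM /= mul1r mulN1r !cosN !sinN; field.
Qed.

Hypothesis f0 : forall k, fourier f k = 0.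

Let ann1 : ann 1.
Proof.
split; first exact: bounded_cst.
by move=> k; rewrite mulr1 -[k]opprK -cj_ek -innerE -fourierE f0.
Qed.

Lemma mean_step n (c c' : R) : circle_mean (f * (fun x => (real_step n c c' x)%:C)) = 0.
Proof.
have ms d : mult (fun x => (step_poly n (cos_bump d x))%:C).
  rewrite (_ : (fun=> _) = 1 - (1 - (fun x => (cos_bump d x)%:C) ^+ n) ^+ (n * 2 ^ n)).
    by apply/multB/multX/multB/multX/mult_cos_bump.
  apply/funext => x.
  have fX (s : R -> C) m : (s ^+ m) x = (s x) ^+ m.
    by elim: m => [|m IH]; rewrite ?expr0// !exprS -IH.
  rewrite /step_poly rmorphB rmorphXn rmorphB rmorphXn rmorph1.
  change (1 - (1 - (cos_bump d x)%:C ^+ n) ^+ (n * 2 ^ n) =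
    1 - ((1 - (fun x => (cos_bump d x)%:C) ^+ n) ^+ (n * 2 ^ n)) x).
  rewrite fX; congr (1 - _ ^+ _).
  by change (1 - (cos_bump d x)%:C ^+ n = 1 - ((fun x => (cos_bump d x)%:C) ^+ n) x); rewrite fX.
have [_ H] := multM (ms c) (ms c').
have [_ /(_ 0)] := H _ ann1.
rewrite ek0 mulr1 mul1r => <-; congr (circle_mean (_ * _)).
by apply/funext => x; rewrite /real_step rmorphM.
Qed.

End Annihilator.

Lemma fourier_unique f : square_integrable f -> (forall k, fourier f k = 0) -> ae_equal f 0.
Proof.
move=> sf f0.
have [fR fI] : cintegrable f by rewrite -[f]mulr1; apply: sqiM => //; exact: sqi_cst.
have mz n c c' := mean_step sf f0 n c c'.
have e n c c' x : Re ((f * (fun x => (real_step n c c' x)%:C)) x) = Re (f x) * real_step n c c' x.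
  by rewrite /GRing.mul /= cReM /= mulr0 subr0.
have e' n c c' x : Im ((f * (fun x => (real_step n c c' x)%:C)) x) = Im (f x) * real_step n c c' x.
  by rewrite /GRing.mul /= cImM /= mulr0 add0r.
have p0 : (2 * pi)^-1 != 0 :> R by rewrite invr_eq0 gt_eqF// pi2_gt0.
have hR : ae_eq leb (circle R) (fun x => Re (f x)) (cst 0).
  apply: Rintegral_ae0 => //; apply: Rintegral_arc => // n c c'.
  have := congr1 (@complex.Re R) (mz n c c'); rewrite /circle_mean /= => /eqP.
  rewrite mulf_eq0 (negbTE p0) /= => /eqP <-.
  by apply: eq_Rintegral => x _; rewrite e.
have hI : ae_eq leb (circle R) (fun x => Im (f x)) (cst 0).
  apply: Rintegral_ae0 => //; apply: Rintegral_arc => // n c c'.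
  have := congr1 (@complex.Im R) (mz n c c'); rewrite /circle_mean /= => /eqP.
  rewrite mulf_eq0 (negbTE p0) /= => /eqP <-.
  by apply: eq_Rintegral => x _; rewrite e'.
have ff := @ae_filter_ringOfSetsType _ _ R leb.
apply: (@filterS2 _ _ ff _ _ _ _ hR hI) => x h1 h2 xc; apply: cplx_eq.
  exact: h1.
exact: h2.
Qed.

Lemma fourier_inj f g : square_integrable f -> square_integrable g ->
  (forall k, fourier f k = fourier g k) -> ae_equal f g.
Proof.
move=> sf sg fg.
have : ae_equal (f - g) 0.
  apply: fourier_unique; first exact: sqiB.
  by move=> k; rewrite fourierE innerBl -?fourierE ?fg ?subrr//; exact: ek_sqi.
move=> h; have := ae_equalD h (ae_equal_refl g).
by rewrite subrK add0r.
Qed.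
End FourierUniqueness.

(** * Hardy functions with geometrically decaying coefficients *)

Section GeometricSeries.
Variable R : realType.
Local Notation C := R[i].
Local Notation Re := complex.Re.
Local Notation Im := complex.Im.

Lemma geometric_sum_le (r : R) n m : 0 <= r < 1 ->
  \sum_(n <= k < m) r ^+ k <= r ^+ n / (1 - r).
Proof.
move=> /andP[r0 r1]; rewrite ler_pdivlMr ?subr_gt0//.
have [mn|nm] := leqP m n; first by rewrite big_geq// mul0r exprn_ge0.
elim: m nm => // m IH nm.
rewrite big_nat_recr//= mulrDl.
have [e|nm'] := eqVneq n m; first by rewrite -e big_geq// mul0r add0r ler_piMr ?exprn_ge0// gerBl.
have {nm nm'} nm : (n < m)%N by rewrite ltn_neqAle nm'.
have IH1 : (\sum_(n <= i < m) r ^+ i) * (1 - r) = r ^+ n - r ^+ m.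
  elim: m nm {IH} => // m IH nm.
  rewrite big_nat_recr//= mulrDl.
  have [->|nm'] := eqVneq n m; first by rewrite big_geq// mul0r add0r exprS; ring.
  by rewrite IH ?ltn_neqAle ?nm'// exprS; ring.
have := exprn_ge0 m.+1 r0; rewrite IH1 exprSr; lra.
Qed.

Lemma geo_series (u : nat -> R) K r : 0 <= K -> 0 <= r < 1 ->
  (forall k, `|u k| <= K * r ^+ k) ->
  cvgn (series u) /\ forall n, `|limn (series u) - series u n| <= K * r ^+ n / (1 - r).
Proof.
move=> K0 /[dup] r01 /andP[r0 r1] uK.
have cu : cvgn (series u).
  apply: normed_cvg; apply: (@series_le_cvg _ _ (geometric K r)) => //.
  - by move=> k /=.
  - by move=> k; rewrite /= mulr_ge0// exprn_ge0.
  - by apply: is_cvg_geometric_series; rewrite ger0_norm.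
split => // n.
have cd : `|series u m - series u n| @[m --> \oo] --> `|limn (series u) - series u n|.
  by apply: cvg_norm; apply: cvgB => //; exact: cvg_cst.
apply: (cvgr_to_le cd); near=> m.
have nm : (n <= m)%N by near: m; exact: nbhs_infty_ge.
rewrite sub_series_geq//; apply: le_trans (ler_norm_sum _ _ _) _.
apply: (@le_trans _ _ (\sum_(n <= k < m) K * r ^+ k)).
  by apply: ler_sum_nat.
by rewrite -mulr_sumr -mulrA ler_wpM2l// geometric_sum_le.
Unshelve. all: by end_near. Qed.

Lemma geo_small_eq0 (x K r : R) n0 : 0 <= r < 1 ->
  (forall n, (n0 <= n)%N -> `|x| <= K * r ^+ n) -> x = 0.
Proof.
move=> /andP[r0 r1] H; apply/eqP; rewrite -normr_le0.
have c : K * r ^+ n @[n --> \oo] --> (0 : R).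
  by apply: cvg_geometric; rewrite ger0_norm.
apply: (cvgr_to_ge c); near=> n; apply: H; near: n; exact: nbhs_infty_ge.
Unshelve. all: by end_near. Qed.

Lemma Re_norm_le (z : C) : `|Re z| <= Re `|z|.
Proof. by have := normc_ge_Re z; rewrite lecE /= => /andP[_]. Qed.

Lemma Im_norm_le (z : C) : `|Im z| <= Re `|z|.
Proof.
have -> : Im z = - Re (z * 'i%C) by rewrite ReiNIm opprK.
rewrite normrN (le_trans (Re_norm_le _))// normrM.
have -> : `|'i%C : C| = 1 by rewrite complexiE normCi.
by rewrite mulr1.
Qed.

Lemma Re_geo (K r : C) n : 0 <= r -> 0 <= K -> Re (K * r ^+ n) = Re K * Re r ^+ n.
Proof.
move=> r0 K0.
have -> : K = (Re K)%:C by rewrite RRe_real// ger0_real.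
have -> : r = (Re r)%:C by rewrite RRe_real// ger0_real.
by rewrite -rmorphXn -rmorphM.
Qed.

Lemma Re_le (a b : C) : a <= b -> Re a <= Re b.
Proof. by rewrite lecE => /andP[]. Qed.

(** The constants are complex since [|a k|] is; positivity in the order of [C] makes them real. *)
Definition geo (a : nat -> C) :=
  exists K r : C, [/\ 0 <= K, 0 <= r < 1 & forall k, `|a k| <= K * r ^+ k].

(** The unimodular [w] will be the value of an exponential at a point of the circle, so that the
    bounds are uniform in that point. *)
Lemma geoR (a : nat -> C) : geo a ->
  exists K r : R, [/\ 0 <= K, 0 <= r < 1 & forall k (w : C), `|w| = 1 ->
    `|Re (a k * w)| <= K * r ^+ k /\ `|Im (a k * w)| <= K * r ^+ k].
Proof.
move=> [K [r [K0 /andP[r0 r1] H]]]; exists (Re K), (Re r); split.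
- exact: Re_le K0.
- apply/andP; split; first exact: Re_le r0.
  by move: r1; rewrite ltcE => /andP[].
move=> k w w1; have e : `|a k * w| <= K * r ^+ k by rewrite normrM w1 mulr1.
have := Re_le e; rewrite Re_geo// => h; split; apply: le_trans h.
  exact: Re_norm_le.
exact: Im_norm_le.
Qed.

Lemma geoD a b : geo a -> geo b -> geo (fun k => a k + b k).
Proof.
move=> [K [r [K0 /andP[r0 r1] H]]] [K' [r' [K0' /andP[r0' r1'] H']]].
have [m [m0 m1 rm rm']] : exists m : C, [/\ 0 <= m, m < 1, r <= m & r' <= m].
  have := ger0_real r0; move/(real_leP (ger0_real r0')) => [h|h].
    by exists r; split.
  by exists r'; split => //; exact: ltW.
exists (K + K'), m; split; first exact: addr_ge0.
  by rewrite m0.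
move=> k; rewrite (le_trans (ler_normD _ _))// mulrDl lerD//.
  by rewrite (le_trans (H k))// ler_wpM2l// lerXn2r ?nnegrE.
by rewrite (le_trans (H' k))// ler_wpM2l// lerXn2r ?nnegrE.
Qed.

Lemma geoZ c a : geo a -> geo (fun k => c * a k).
Proof.
move=> [K [r [K0 r01 H]]]; exists (`|c| * K), r; split => //; first by rewrite mulr_ge0.
by move=> k; rewrite normrM -mulrA ler_wpM2l.
Qed.

Lemma eq_geo a b : a =1 b -> geo a -> geo b.
Proof. by move=> ab [K [r [K0 r01 H]]]; exists K, r; split => // k; rewrite -ab. Qed.

Lemma geo_natmul a : geo a -> geo (fun k => k%:R * a k).
Proof.
move=> [K [r [K0 /andP[r0 r1] H]]].
have [|K' [r' [K0' /andP[r0' r1'] H']]] := @natr_mul_geometric R (Re r).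
  apply/andP; split; first exact: Re_le r0.
  by move: r1; rewrite ltcE => /andP[].
exists (K * K'%:C), r'%:C; split.
- by rewrite mulr_ge0// lecR.
- by rewrite lecR ltcR r0'.
move=> k; rewrite normrM normr_nat (le_trans (ler_wpM2l _ (H k)))//.
rewrite mulrCA -mulrA ler_wpM2l//.
have -> : r = (Re r)%:C by rewrite RRe_real// ger0_real.
have := H' k; rewrite -lecR !rmorphM !rmorphXn /= rmorph_nat; apply.
Qed.

Lemma geo_cst0 : geo (fun=> 0).
Proof. by exists 0, 0; split; rewrite ?lexx ?ltr01// => k; rewrite normr0 mul0r. Qed.

Lemma geo_finite (a : nat -> C) n : (forall k, (n <= k)%N -> a k = 0) -> geo a.
Proof.
move=> an; exists (\sum_(k < n) `|a k| * 2 ^+ k), 2^-1; split.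
- by apply: sumr_ge0 => i _; rewrite mulr_ge0// exprn_ge0.
- by rewrite invr_ge0 ler0n /= invf_lt1 ?ltr0n// ltr1n.
move=> k; rewrite exprVn -ler_pdivrMr ?invr_gt0 ?exprn_gt0 ?ltr0n// invrK.
have [kn|nk] := ltnP k n.
  rewrite (bigD1 (Ordinal kn))//= lerDl; apply: sumr_ge0 => i _.
  by rewrite mulr_ge0// exprn_ge0.
rewrite an// normr0 mul0r; apply: sumr_ge0 => i _.
by rewrite mulr_ge0// exprn_ge0.
Qed.

(* If [a' = rho a + b] with [b] geometric, so is [a]: take a ratio larger than both. *)
Lemma geo_recursion (a b : nat -> C) (rho : C) : `|rho| < 1 -> geo b ->
  (forall k, a k.+1 = rho * a k + b k) -> geo a.
Proof.
move=> rho1 [K [r [K0 /andP[r0 r1] H]]] ab.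
have [s [s0 s1 rs rhos]] : exists s : C, [/\ 0 < s, s < 1, r <= s & `|rho| < s].
  have [h1|h1] := real_leP (ger0_real r0) (normr_real rho).
    exists ((`|rho| + 1) / 2).
    have t0 : `|rho| < (`|rho| + 1) / 2 by rewrite ltr_pdivlMr ?ltr0n// mulr_natr mulr2n ltrD2l.
    have t1 : (`|rho| + 1) / 2 < 1 by rewrite ltr_pdivrMr ?ltr0n// mul1r -[2]/(1 + 1) ltrD2r.
    by split; [exact: (le_lt_trans (normr_ge0 rho) t0)|exact: t1|exact: (ltW (le_lt_trans h1 t0))|].
  exists ((r + 1) / 2).
  have t0 : r < (r + 1) / 2 by rewrite ltr_pdivlMr ?ltr0n// mulr_natr mulr2n ltrD2l.
  have t1 : (r + 1) / 2 < 1 by rewrite ltr_pdivrMr ?ltr0n// mul1r -[2]/(1 + 1) ltrD2r.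
  by split; [exact: (le_lt_trans r0 t0)|exact: t1|exact: ltW|exact: (lt_trans h1 t0)].
exists (`|a 0%N| + K / (s - `|rho|)), s; split.
- by rewrite addr_ge0// divr_ge0// subr_ge0 ltW.
- by rewrite s1 ltW.
have sr : 0 < s - `|rho| by rewrite subr_gt0.
elim=> [|k IH]; first by rewrite expr0 mulr1 lerDl divr_ge0// ltW.
rewrite ab (le_trans (ler_normD _ _))// normrM.
have h1 : `|b k| <= K * s ^+ k.
  by rewrite (le_trans (H k))// ler_wpM2l// lerXn2r ?nnegrE// ltW.
apply: le_trans (lerD (ler_wpM2l (normr_ge0 rho) IH) h1) _.
have -> : K * s ^+ k = (s - `|rho|) * (K / (s - `|rho|)) * s ^+ k.
  by rewrite mulrCA divff ?mulr1// gt_eqF.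
rewrite -subr_ge0 exprS; set B := K / _; set A := `|a 0%N|.
have -> : (A + B) * (s * s ^+ k) - (`|rho| * ((A + B) * s ^+ k) + (s - `|rho|) * B * s ^+ k) =
  (s - `|rho|) * (A * s ^+ k) by ring.
by rewrite mulr_ge0 ?(ltW sr)// mulr_ge0 ?normr_ge0// exprn_ge0// ltW.
Qed.

End GeometricSeries.

(** * Functions given by geometrically convergent Fourier series *)

Section Synthesis.
Variable R : realType.
Local Notation C := R[i].
Local Notation leb := (@lebesgue_measure R).
Local Notation Re := complex.Re.
Local Notation Im := complex.Im.
Implicit Types (f g h u : R -> C) (a b : nat -> C).

Definition synth a : R -> C := fun x => complex_series (fun k => a k * ek k%:Z x).

Definition trig_sum a n : R -> C := \sum_(k < n) a k *: ek k%:Z.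

Lemma Re_sum (I : Type) (s : seq I) (P : pred I) (F : I -> C) :
  Re (\sum_(i <- s | P i) F i) = \sum_(i <- s | P i) Re (F i).
Proof. exact: (big_morph _ (@cReD R)). Qed.

Lemma Im_sum (I : Type) (s : seq I) (P : pred I) (F : I -> C) :
  Im (\sum_(i <- s | P i) F i) = \sum_(i <- s | P i) Im (F i).
Proof. exact: (big_morph _ (@cImD R)). Qed.

Lemma norm_ek k x : `|@ek R k x| = 1.
Proof.
apply/eqP; rewrite -(@pexpr_eq1 _ _ 2)//; apply/eqP.
by rewrite sqr_normc; exact: expiK.
Qed.

Lemma trig_sumE a n x : trig_sum a n x = \sum_(k < n) a k * ek k%:Z x.
Proof. by rewrite /trig_sum fct_sumE. Qed.

Lemma trig_sum_bounded a n : bounded_cfun (trig_sum a n).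
Proof.
rewrite /trig_sum; elim/big_ind : _ => [|f g|k _]; first exact: bounded_cst.
  exact: boundedD.
by apply: boundedM; [exact: bounded_cst|exact: ek_bounded].
Qed.

Lemma trig_sum_sqi a n : square_integrable (trig_sum a n).
Proof. exact/sqi_bounded/trig_sum_bounded. Qed.

(** The bound is uniform in [x], so boundedness, measurability and the inner products of [synth a]
    are inherited from its partial sums. *)
Lemma synth_approx a : geo a -> exists K r : R, [/\ 0 <= K, 0 <= r < 1 &
  forall n x, `|Re (synth a x - trig_sum a n x)| <= K * r ^+ n /\
              `|Im (synth a x - trig_sum a n x)| <= K * r ^+ n].
Proof.
move=> /geoR[K [r [K0 /[dup] r01 /andP[r0 r1] H]]].
exists (K / (1 - r)), r; split => //.
  by rewrite divr_ge0// subr_ge0 ltW.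
move=> n x.
have [_ h1] := @geo_series R (fun k => Re (a k * ek k%:Z x)) K r K0 r01 (fun k => (H k _ (norm_ek _ _)).1).
have [_ h2] := @geo_series R (fun k => Im (a k * ek k%:Z x)) K r K0 r01 (fun k => (H k _ (norm_ek _ _)).2).
rewrite mulrAC trig_sumE; split.
  by have := h1 n; rewrite /series /= big_mkord -Re_sum; case: (\sum_(i < n) _).
by have := h2 n; rewrite /series /= big_mkord -Im_sum; case: (\sum_(i < n) _).
Qed.

Lemma synth_bounded a : geo a -> bounded_cfun (synth a).
Proof.
move=> ga; have [K [r [K0 /andP[r0 r1] H]]] := synth_approx ga.
move: (synth a) H => G H.
have cv : K * r ^+ n @[n --> \oo] --> (0 : R).
  by apply: cvg_geometric; rewrite ger0_norm.
have tz x : trig_sum a 0 x = 0 by rewrite trig_sumE big_ord0.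
split; last first.
  by exists K => x; have := H 0%N x; rewrite tz subr0 expr0 mulr1.
have bR n : measurable_fun (circle R) (fun x => Re (trig_sum a n x)) by have [[]] := trig_sum_bounded a n.
have bI n : measurable_fun (circle R) (fun x => Im (trig_sum a n x)) by have [[]] := trig_sum_bounded a n.
have sub (z w : C) : Re (z - w) = Re z - Re w /\ Im (z - w) = Im z - Im w.
  by case: z w => [? ?] [].
split.
  apply: (measurable_fun_cvg bR) => x _.
  apply/cvgrPdist_le => /= e e0.
  have /cvgrPdist_le /(_ e e0) := cv; apply: filterS => n; rewrite sub0r normrN.
  rewrite ger0_norm ?mulr_ge0 ?exprn_ge0// => h.
  by rewrite -(sub _ _).1 (le_trans (H n x).1).
apply: (measurable_fun_cvg bI) => x _.
apply/cvgrPdist_le => /= e e0.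
have /cvgrPdist_le /(_ e e0) := cv; apply: filterS => n; rewrite sub0r normrN.
rewrite ger0_norm ?mulr_ge0 ?exprn_ge0// => h.
by rewrite -(sub _ _).2 (le_trans (H n x).2).
Qed.

Lemma synth_sqi a : geo a -> square_integrable (synth a).
Proof. by move=> ?; exact/sqi_bounded/synth_bounded. Qed.

(** An L^1 norm, with |Re| + |Im| in place of the modulus because integrals are taken on real and
    imaginary parts separately. *)
Definition mean_abs g : R := (2 * pi)^-1 * (\int[leb]_(x in circle R) (`|Re (g x)| + `|Im (g x)|))%R.

Lemma sqi_cintegrable g : square_integrable g -> cintegrable g.
Proof. by move=> sg; rewrite -[g]mulr1; apply: sqiM => //; exact: sqi_cst. Qed.

Lemma mean_abs_integrable g : square_integrable g ->
  leb.-integrable (circle R) (EFin \o (fun x => `|Re (g x)| + `|Im (g x)|)).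
Proof.
move=> sg; have [h1 h2] := sqi_cintegrable sg.
by apply: integrable_add; [have := integrable_abse h1|have := integrable_abse h2].
Qed.

Lemma mean_abs_ge0 g : 0 <= mean_abs g.
Proof.
apply: mulr_ge0; first by rewrite invr_ge0 ltW// pi2_gt0.
by apply: Rintegral_ge0 => x _; rewrite addr_ge0.
Qed.

Lemma mean_abs_ek g l : square_integrable g -> mean_abs (g * ek l) <= 2 * mean_abs g.
Proof.
move=> sg; rewrite /mean_abs mulrCA ler_wpM2l ?invr_ge0 ?(ltW (pi2_gt0 R))//.
have gl : square_integrable (g * ek l).
  by rewrite mulrC; apply: sqi_bounded_mul => //; exact: ek_bounded.
rewrite -RintegralZl; [|exact: (@measurable_circle R)|exact: mean_abs_integrable].
apply: (@le_Rintegral _ _ _ leb (circle R) _ _ (@measurable_circle R)).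
- exact: mean_abs_integrable.
- by apply: integrable_scale; exact: mean_abs_integrable.
move=> x _.
change (`|Re (g x * ek l x)| + `|Im (g x * ek l x)| <= 2 * (`|Re (g x)| + `|Im (g x)|)).
have c1 : `|Re (@ek R l x)| <= 1 by rewrite /ek /= ler_norml cos_geN1 cos_le1.
have s1 : `|Im (@ek R l x)| <= 1 by rewrite /ek /= ler_norml sin_geN1 sin_le1.
have M (p q : R) : `|q| <= 1 -> `|p * q| <= `|p| by move=> q1; rewrite normrM ler_piMr.
rewrite cReM cImM mulr_natl mulr2n lerD//.
  by rewrite (le_trans (ler_normB _ _))// lerD ?M.
by rewrite (le_trans (ler_normD _ _))// lerD ?M.
Qed.

Lemma inner_small f g (e : R) : square_integrable f -> square_integrable g ->
  (forall x, `|Re (f x)| <= e /\ `|Im (f x)| <= e) ->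
  `|Re (inner f g)| <= e * mean_abs g /\ `|Im (inner f g)| <= e * mean_abs g.
Proof.
move=> sf sg fe.
have [i1 i2] := sqiM sf (sqiJ sg).
have B (h : R -> R) : leb.-integrable (circle R) (EFin \o h) ->
    (forall x, `|h x| <= e * (`|Re (g x)| + `|Im (g x)|)) ->
    `|(2 * pi)^-1 * (\int[leb]_(x in circle R) h x)%R| <= e * mean_abs g.
  move=> hi he; rewrite /mean_abs mulrCA normrM ger0_norm; last by rewrite invr_ge0 ltW// pi2_gt0.
  rewrite ler_wpM2l ?invr_ge0 ?(ltW (pi2_gt0 R))//.
  rewrite -RintegralZl; [|exact: (@measurable_circle R)|exact: mean_abs_integrable].
  apply: le_trans (le_normr_Rintegral (@measurable_circle R) hi) _.
  apply: (@le_Rintegral _ _ _ leb (circle R) _ _ (@measurable_circle R)) => //.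
    by have := integrable_abse hi.
  by apply: integrable_scale; exact: mean_abs_integrable.
have M (p q : R) : `|q| <= e -> `|q * p| <= e * `|p| by move=> q1; rewrite normrM ler_wpM2r.
split; apply: B => // x; have [f1 f2] := fe x.
  change (`|Re (f x * (g x)^*)| <= e * (`|Re (g x)| + `|Im (g x)|)).
  rewrite cReM cReJ cImJ mulrN opprK mulrDr (le_trans (ler_normD _ _))//.
  by rewrite lerD ?M.
change (`|Im (f x * (g x)^*)| <= e * (`|Re (g x)| + `|Im (g x)|)).
rewrite cImM cReJ cImJ mulrN mulrDr (le_trans (ler_normD _ _))// normrN addrC.
by rewrite lerD ?M.
Qed.

Lemma inner_trig_sum a n g : square_integrable g ->
  inner (trig_sum a n) g = \sum_(k < n) a k * (fourier g k%:Z)^*.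
Proof.
move=> sg; rewrite /trig_sum inner_suml//; last by move=> i _; apply: sqiZ; exact: ek_sqi.
apply: eq_bigr => i _; rewrite innerZl//; last exact: ek_sqi.
by rewrite fourierE -inner_conj//; exact: ek_sqi.
Qed.

(** [K] and [r] do not depend on [g]: the error is controlled by the L^1 norm of [g] alone, which
    [geo_inner_shift] applies to functions [g] that vary with the truncation index. *)
Lemma inner_synth_approx a : geo a -> exists K r : R, [/\ 0 <= K, 0 <= r < 1 &
  forall g n, square_integrable g ->
    `|Re (inner (synth a) g - \sum_(k < n) a k * (fourier g k%:Z)^*)| <= K * r ^+ n * mean_abs g /\
    `|Im (inner (synth a) g - \sum_(k < n) a k * (fourier g k%:Z)^*)| <= K * r ^+ n * mean_abs g].
Proof.
move=> ga; have [K [r [K0 r01 H]]] := synth_approx ga.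
exists K, r; split => // g n sg.
rewrite -inner_trig_sum// -innerBl//; [|exact: synth_sqi|exact: trig_sum_sqi].
apply: inner_small => //; last exact: H.
by apply: sqiB; [exact: synth_sqi|exact: trig_sum_sqi].
Qed.

Lemma inner_synth0 a g : geo a -> square_integrable g ->
  (forall k : nat, a k * (fourier g k%:Z)^* = 0) -> inner (synth a) g = 0.
Proof.
move=> ga sg z; have [K [r [K0 r01 H]]] := inner_synth_approx ga.
apply: cplx_eq; apply: (@geo_small_eq0 _ _ (K * mean_abs g) r 0) => // n _; have := H g n sg.
  by rewrite big1 ?subr0// => -[h _]; rewrite mulrAC.
by rewrite big1 ?subr0// => -[_ h]; rewrite mulrAC.
Qed.

Lemma complex_series_geo (z : nat -> C) (w : C) (K r : R) : 0 <= K -> 0 <= r < 1 ->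
  (forall n, `|Re (w - \sum_(k < n) z k)| <= K * r ^+ n /\
             `|Im (w - \sum_(k < n) z k)| <= K * r ^+ n) -> complex_series z = w.
Proof.
move=> K0 /andP[r0 r1] H.
have nn n : 0 <= K * r ^+ n by rewrite mulr_ge0// exprn_ge0.
have cv : K * r ^+ n @[n --> \oo] --> (0 : R) by apply: cvg_geometric; rewrite ger0_norm.
have sub (x y : C) : Re (x - y) = Re x - Re y /\ Im (x - y) = Im x - Im y.
  by case: x y => [? ?] [].
apply: cplx_eq; rewrite /complex_series /=; apply: cvg_lim => //.
  apply/cvgrPdist_le => /= e e0.
  have /cvgrPdist_le /(_ e e0) := cv; apply: filterS => n; rewrite sub0r normrN.
  rewrite (ger0_norm (nn _)) => h.
  by rewrite /series /= big_mkord -Re_sum -(sub _ _).1 (le_trans (H n).1).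
apply/cvgrPdist_le => /= e e0.
have /cvgrPdist_le /(_ e e0) := cv; apply: filterS => n; rewrite sub0r normrN.
rewrite (ger0_norm (nn _)) => h.
by rewrite /series /= big_mkord -Im_sum -(sub _ _).2 (le_trans (H n).2).
Qed.

Lemma inner_synth a g : geo a -> square_integrable g ->
  complex_series (fun k => a k * (fourier g k%:Z)^*) = inner (synth a) g.
Proof.
move=> ga sg; have [K [r [K0 r01 H]]] := inner_synth_approx ga.
apply: (@complex_series_geo _ _ (K * mean_abs g) r) => //.
  by apply: mulr_ge0 => //; exact: mean_abs_ge0.
by move=> n; have := H g n sg; rewrite [K * mean_abs g * _]mulrAC.
Qed.

Lemma inner_synth_conj a g : geo a -> square_integrable g ->
  complex_series (fun k => fourier g k%:Z * (a k)^*) = (inner (synth a) g)^*.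
Proof.
move=> ga sg; have [K [r [K0 r01 H]]] := inner_synth_approx ga.
apply: (@complex_series_geo _ _ (K * mean_abs g) r) => //.
  by apply: mulr_ge0 => //; exact: mean_abs_ge0.
move=> n; have := H g n sg; rewrite [K * mean_abs g * _]mulrAC.
have -> : \sum_(k < n) fourier g k%:Z * (a k)^* = (\sum_(k < n) a k * (fourier g k%:Z)^*)^*.
  by rewrite rmorph_sum; apply: eq_bigr => i _; rewrite rmorphM /= conjCK mulrC.
by rewrite -rmorphB /= cReJ cImJ normrN.
Qed.

Lemma fourier_ek (j k : int) : fourier (@ek R j) k = (j == k)%:R.
Proof. by rewrite fourierE inner_ek. Qed.

Lemma fourier_synth a : geo a -> forall k : nat, fourier (synth a) k%:Z = a k.
Proof.
move=> ga k; have [K [r [K0 r01 H]]] := inner_synth_approx ga.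
have sub (z w : C) : Re (z - w) = Re z - Re w /\ Im (z - w) = Im z - Im w.
  by case: z w => [? ?] [].
rewrite fourierE; apply/eqP; rewrite -subr_eq0; apply/eqP.
have E n : (k < n)%N -> \sum_(i < n) a i * (fourier (@ek R k%:Z) i%:Z)^* = a k.
  move=> kn; rewrite (bigD1 (Ordinal kn))//= fourier_ek eqxx conjC1 mulr1 big1 ?addr0// => i ik.
  rewrite fourier_ek eqz_nat; case: eqP => [e|_]; last by rewrite conjC0 mulr0.
  by move: ik; rewrite -val_eqE /= e eqxx.
apply: cplx_eq; apply: (@geo_small_eq0 _ _ (K * mean_abs (@ek R k%:Z)) r k.+1) => // n kn;
  by have [h1 h2] := H _ n (ek_sqi R k%:Z); rewrite mulrAC -(E n kn).
Qed.

Lemma fourier_synth_neg a (k : int) : geo a -> k < 0 -> fourier (synth a) k = 0.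
Proof.
move=> ga k0; rewrite fourierE; apply: inner_synth0 => //; first exact: ek_sqi.
move=> j; rewrite fourier_ek; case: eqP => [e|_]; last by rewrite conjC0 mulr0.
by move: k0; rewrite e.
Qed.

Lemma hardy_synth a : geo a -> hardy (synth a).
Proof. by move=> ga; split; [exact: synth_sqi|move=> k; exact: fourier_synth_neg]. Qed.

End Synthesis.

(** * Hardy functions with geometric decay, and the Szego projection *)

Section HardySpace.
Variable R : realType.
Local Notation C := R[i].
Local Notation Re := complex.Re.
Local Notation Im := complex.Im.
Implicit Types (f g h u q d : R -> C) (a b : nat -> C).

(** In classical terms, functions that extend analytically to a disc of radius larger than 1. Being
    [smooth] constrains a function only up to a null set; [nice] adds actual boundedness, so that
    products with L^2 functions stay in L^2. *)
Definition smooth f := hardy f /\ geo (fun k => fourier f k%:Z).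

Definition nice f := smooth f /\ bounded_cfun f.

Lemma hardy_sqi f : hardy f -> square_integrable f. Proof. by case. Qed.
Lemma smooth_hardy f : smooth f -> hardy f. Proof. by case. Qed.
Lemma smooth_sqi f : smooth f -> square_integrable f. Proof. by case=> /hardy_sqi. Qed.

Lemma nice_synth a : geo a -> nice (synth a).
Proof.
move=> ga; split; last exact: synth_bounded.
split; first exact: hardy_synth.
by apply: (eq_geo _ ga) => k; rewrite fourier_synth.
Qed.

Lemma hardy_inj f g : hardy f -> hardy g ->
  (forall k : nat, fourier f k%:Z = fourier g k%:Z) -> ae_equal f g.
Proof.
move=> [sf nf] [sg ng] fg; apply: fourier_inj => // -[k|k]; first exact: fg.
by rewrite nf// ng.
Qed.

Lemma smooth_ae f : smooth f -> ae_equal f (synth (fun k => fourier f k%:Z)).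
Proof.
move=> [hf gf]; apply: hardy_inj => //; first exact: hardy_synth.
by move=> k; rewrite fourier_synth.
Qed.

Lemma inner_smoothE f g : smooth f -> square_integrable g ->
  inner f g = inner (synth (fun k => fourier f k%:Z)) g.
Proof.
move=> sf sg; apply: inner_ae => //; last exact: ae_equal_refl.
- exact: smooth_sqi.
- by apply: synth_sqi; case: sf.
- exact: smooth_ae.
Qed.

Lemma inner_smooth f g : smooth f -> square_integrable g ->
  complex_series (fun k => fourier f k%:Z * (fourier g k%:Z)^*) = inner f g.
Proof. by move=> sf sg; rewrite inner_synth -?inner_smoothE//; case: sf. Qed.

Lemma inner_smooth0 f g : smooth f -> square_integrable g ->
  (forall k : nat, fourier f k%:Z * (fourier g k%:Z)^* = 0) -> inner f g = 0.
Proof. by move=> sf sg h; rewrite inner_smoothE//; apply: inner_synth0 => //; case: sf. Qed.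

Lemma fourierD f g k : square_integrable f -> square_integrable g ->
  fourier (f + g) k = fourier f k + fourier g k.
Proof. by move=> sf sg; rewrite !fourierE innerDl//; exact: ek_sqi. Qed.

Lemma fourierB f g k : square_integrable f -> square_integrable g ->
  fourier (f - g) k = fourier f k - fourier g k.
Proof. by move=> sf sg; rewrite !fourierE innerBl//; exact: ek_sqi. Qed.

Lemma fourierZ c f k : square_integrable f -> fourier (c *: f) k = c * fourier f k.
Proof. by move=> sf; rewrite !fourierE innerZl//; exact: ek_sqi. Qed.

Lemma fourier_sum (I : Type) (s : seq I) (P : pred I) (F : I -> R -> C) k :
  (forall i, P i -> square_integrable (F i)) ->
  fourier (\sum_(i <- s | P i) F i) k = \sum_(i <- s | P i) fourier (F i) k.
Proof.
move=> sF; rewrite fourierE inner_suml//; last exact: ek_sqi.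
by apply: eq_bigr => i _; rewrite fourierE.
Qed.

Lemma fourierJ f k : square_integrable f -> fourier (cj f) k = (fourier f (- k))^*.
Proof.
move=> sf; rewrite !fourierE -inner_conj//; last exact: ek_sqi.
rewrite !innerE cj_ek; congr circle_mean.
by rewrite mulrC.
Qed.

Lemma fourier_ekM j f k : fourier (ek j * f) k = fourier f (k - j).
Proof. by rewrite !fourierE inner_bounded_mul cj_ek -ekD addrC. Qed.

Lemma fourier_ae f g k : square_integrable f -> square_integrable g -> ae_equal f g ->
  fourier f k = fourier g k.
Proof.
move=> sf sg fg; rewrite !fourierE; apply: inner_ae => //; try exact: ek_sqi.
exact: ae_equal_refl.
Qed.

Lemma ek_mul_sqi j f : square_integrable f -> square_integrable (ek j * f).
Proof. by apply: sqi_bounded_mul; exact: ek_bounded. Qed.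

Lemma hardyD f g : hardy f -> hardy g -> hardy (f + g).
Proof.
move=> [sf f0] [sg g0]; split; first exact: sqiD.
by move=> k k0; rewrite fourierD// f0// g0// addr0.
Qed.

Lemma hardyZ c f : hardy f -> hardy (c *: f).
Proof.
move=> [sf f0]; split; first exact: sqiZ.
by move=> k k0; rewrite fourierZ// f0// mulr0.
Qed.

Lemma hardyB f g : hardy f -> hardy g -> hardy (f - g).
Proof. by move=> hf hg; rewrite -scaleN1r; apply: hardyD => //; exact: hardyZ. Qed.

Lemma hardy0 : hardy (0 : R -> C).
Proof. by split=> [|k _]; [exact: sqi0|rewrite fourierE inner0l]. Qed.

Lemma hardy_sum (I : Type) (s : seq I) (P : pred I) (F : I -> R -> C) :
  (forall i, P i -> hardy (F i)) -> hardy (\sum_(i <- s | P i) F i).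
Proof. by move=> hF; elim/big_ind : _ => //; [exact: hardy0|exact: hardyD]. Qed.

Lemma hardy_shift f : hardy f -> hardy (ek 1 * f).
Proof.
move=> [sf f0]; split; first exact: ek_mul_sqi.
by move=> k k0; rewrite fourier_ekM f0// (lt_trans _ k0)// gtrDl.
Qed.

Lemma hardy_ek (k : nat) : hardy (@ek R k%:Z).
Proof.
split=> [|j j0]; first exact: ek_sqi.
by rewrite fourier_ek; case: eqP j0 => // <-.
Qed.

Lemma smoothD f g : smooth f -> smooth g -> smooth (f + g).
Proof.
move=> [hf gf] [hg gg]; split; first exact: hardyD.
by apply: (eq_geo _ (geoD gf gg)) => k; rewrite fourierD//; exact: hardy_sqi.
Qed.

Lemma smoothZ c f : smooth f -> smooth (c *: f).
Proof.
move=> [hf gf]; split; first exact: hardyZ.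
by apply: (eq_geo _ (geoZ c gf)) => k; rewrite fourierZ//; exact: hardy_sqi.
Qed.

Lemma smooth_ek (k : nat) : smooth (@ek R k%:Z).
Proof.
split; first exact: hardy_ek.
apply: (@geo_finite _ _ k.+1) => j kj; rewrite fourier_ek eqz_nat.
by case: eqP kj => // ->; rewrite ltnn.
Qed.

Lemma smooth_sum (I : Type) (s : seq I) (P : pred I) (F : I -> R -> C) :
  (forall i, P i -> smooth (F i)) -> smooth (\sum_(i <- s | P i) F i).
Proof.
move=> hF; elim/big_ind : _ => //; last exact: smoothD.
by rewrite -(scale0r (@ek R 0)); apply: smoothZ; exact: smooth_ek.
Qed.

Lemma smooth_shift f : smooth f -> smooth (ek 1 * f).
Proof.
move=> [hf gf]; split; first exact: hardy_shift.
apply: (@geo_recursion _ _ (fun k => fourier f k%:Z) 0); rewrite ?normr0 ?ltr01//.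
by move=> k; rewrite mul0r add0r fourier_ekM -addn1 PoszD addrK.
Qed.

Lemma smooth_ae_trans f g : smooth f -> square_integrable g -> ae_equal f g -> smooth g.
Proof.
move=> [[sf f0] gf] sg fg; split; first split => //.
  by move=> k k0; rewrite -(fourier_ae _ sf sg fg) f0.
by apply: (eq_geo _ gf) => k; rewrite (fourier_ae _ sf sg fg).
Qed.

Lemma hardy_ae_trans f g : hardy f -> square_integrable g -> ae_equal f g -> hardy g.
Proof.
move=> [sf f0] sg fg; split => // k k0.
by rewrite -(fourier_ae _ sf sg fg) f0.
Qed.

Lemma norm_le_ReIm (z : C) : `|z| <= (`|Re z| + `|Im z|)%:C.
Proof.
rewrite {1}(complexE z) (le_trans (ler_normD _ _))// rmorphD /= lerD//.
  by rewrite normc_def /= expr0n addr0 sqrtr_sqr.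
rewrite normrM complexiE normCi mul1r.
by rewrite normc_def /= expr0n addr0 sqrtr_sqr.
Qed.

(** Since [g] has no negative frequencies, those of [g * ek l] start at [l]; the partial sum of
    order [l] in [inner_synth_approx] is therefore zero and only its error, of size r^l, remains. *)
Lemma geo_inner_shift f g : smooth f -> hardy g -> geo (fun l : nat => inner f (g * ek l%:Z)).
Proof.
move=> sf [sg g0]; have [K [r [K0 /andP[r0 r1] H]]] := inner_synth_approx sf.2.
exists (4 * (K * mean_abs g))%:C, r%:C; split.
- by rewrite lecR; apply: mulr_ge0 => //; apply: mulr_ge0 => //; exact: mean_abs_ge0.
- by rewrite lecR ltcR r0.
move=> l; have sgl : square_integrable (g * ek l%:Z) by rewrite mulrC; exact: ek_mul_sqi.
rewrite inner_smoothE//; apply: le_trans (norm_le_ReIm _) _.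
have := H _ l sgl; rewrite big1 ?subr0; last first.
  move=> i _; rewrite mulrC mulrC [g * _]mulrC fourier_ekM g0 ?conjC0 ?mulr0//.
  by rewrite subr_lt0 ltz_nat.
move=> [h1 h2]; rewrite -rmorphXn -rmorphM lecR.
have m := mean_abs_ek l%:Z sg; have m0 := mean_abs_ge0 (g * ek l%:Z).
have kr : 0 <= K * r ^+ l by rewrite mulr_ge0// exprn_ge0.
apply: le_trans (lerD h1 h2) _.
have -> : 4 * (K * mean_abs g) * r ^+ l = K * r ^+ l * (2 * mean_abs g) + K * r ^+ l * (2 * mean_abs g).
  by ring.
by apply: lerD; rewrite ler_wpM2l.
Qed.

Lemma cjK f : cj (cj f) = f.
Proof. by apply/funext => x; rewrite /cj conjCK. Qed.

Lemma cjM f g : cj (f * g) = cj f * cj g.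
Proof. by apply/funext => x; exact: rmorphM. Qed.

Lemma fourier_cjM u g k : fourier (cj u * g) k = inner g (u * ek k).
Proof. by rewrite fourierE inner_bounded_mul cjK. Qed.

(** Here [u] is only in L^2 and the decay comes from [f]: the coefficient of conj(u) f at k >= 0 is
    the product of [f] with [u * ek k]. *)
Lemma pos_part_smooth u f : hardy u -> smooth f ->
  exists h, nice h /\ forall k : nat, fourier h k%:Z = fourier (cj u * f) k%:Z.
Proof.
move=> hu sf; have ga := geo_inner_shift sf hu.
exists (synth (fun l : nat => inner f (u * ek l%:Z))); split; first exact: nice_synth.
by move=> k; rewrite fourier_synth// fourier_cjM.
Qed.

(* The negative frequencies of [conj u * g] decay geometrically, so that they can be
   subtracted from [conj u * g] without leaving L^2. *)
Lemma pos_part_nice u g : nice u -> hardy g -> exists h, square_integrable h /\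
  forall k : int, fourier h k = if 0 <= k then fourier (cj u * g) k else 0.
Proof.
move=> [su bu] hg; have ga := geo_inner_shift su hg.
pose a (l : nat) := inner u (g * ek l%:Z) * (l != 0%N)%:R.
have {}ga : geo a.
  have [K [r [K0 r01 H]]] := ga; exists K, r; split => // k.
  rewrite /a normrM; apply: le_trans (H k); rewrite ler_piMr//.
  by rewrite normr_nat; case: eqP.
have su' : square_integrable (cj u * g).
  by apply: sqi_bounded_mul; [exact: boundedJ|exact: hardy_sqi].
have ss := synth_sqi ga.
exists (cj u * g - cj (synth a)); split; first by apply: sqiB => //; exact: sqiJ.
move=> k; rewrite fourierB ?fourierJ//; last exact: sqiJ.
case: k => [k|k] /=.
  case: k => [|k]; last by rewrite fourier_synth_neg// conjC0 subr0.
  by rewrite oppr0 (@fourier_synth _ a ga 0) /a mulr0 conjC0 subr0.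
rewrite NegzE opprK fourier_synth// /a mulr1 fourier_cjM.
have sgk : square_integrable (g * ek (Posz k.+1)).
  by rewrite mulrC; exact/ek_mul_sqi/hardy_sqi.
rewrite -(inner_conj (smooth_sqi su) sgk).
apply/eqP; rewrite subr_eq0; apply/eqP; rewrite !innerE cjM cj_ek opprK; congr circle_mean.
by ring.
Qed.

Lemma L2_of h : square_integrable h -> exists H : L2 R, ae_equal H h.
Proof.
move=> sh; pose x := MkL2fun sh.
exists (\pi_(L2 R) x)%qT.
have : (repr (\pi_(L2 R) x)%qT = x %[mod L2 R])%qT by rewrite reprK.
by move/eqmodP => /asboolP.
Qed.

Lemma L2_sqi (H : L2 R) : square_integrable H.
Proof. exact: L2fun_prop. Qed.

Lemma L2_eq (F G : L2 R) : ae_equal F G -> F = G.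
Proof.
move=> FG; rewrite -[F]reprK -[G]reprK; apply/eqmodP; exact/asboolP.
Qed.

(** [xget] returns its default only when the set is empty, so one candidate suffices. *)
Lemma szegoP f : (exists h, square_integrable h /\
    forall k : int, fourier h k = if 0 <= k then fourier f k else 0) ->
  forall k : int, fourier (szego f) k = if 0 <= k then fourier f k else 0.
Proof.
move=> [h [sh hf]]; have [H Hh] := L2_of sh.
rewrite /szego; case: xgetP => [y -> //|/(_ H) []] k.
by rewrite (fourier_ae _ _ _ Hh)//; exact: L2_sqi.
Qed.

Lemma szego_nice u g : nice u -> hardy g ->
  forall k : int, fourier (szego (cj u * g)) k = if 0 <= k then fourier (cj u * g) k else 0.
Proof. by move=> nu hg; apply: szegoP; exact: pos_part_nice. Qed.

Lemma szego_smooth u f : hardy u -> smooth f ->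
  forall k : int, fourier (szego (cj u * f)) k = if 0 <= k then fourier (cj u * f) k else 0.
Proof.
move=> hu sf; apply: szegoP; have [h [[[[sh h0] _] _] hk]] := pos_part_smooth hu sf.
exists h; split => // -[k|k]; first exact: hk.
by rewrite h0.
Qed.

End HardySpace.

(** * The Lax operator and its eigenbasis *)

Section LaxOperator.
Opaque fourier inner circle_mean.
Variable R : realType.
Local Notation C := R[i].
Implicit Types (f g h u q d : R -> C) (a b : nat -> C).

Lemma hardy_half_smooth f : smooth f -> hardy_half f.
Proof.
move=> [hf gf]; split => //.
have [K [r [K0 /andP[r0 r1] H]]] := geoR gf.
have [|K' [s [K0' /andP[s0 s1] Hs]]] := @natr_mul_geometric R r; first by rewrite r0.
have M k : k%:R * sqnorm (fourier f k%:Z) <= 2 * K ^+ 2 * K' * s ^+ k.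
  have [] := H k 1 (normr1 _); rewrite mulr1 => h1 h2.
  have sq (x : R) : `|x| <= K * r ^+ k -> x ^+ 2 <= K ^+ 2 * r ^+ k.
    move=> hx; rewrite -real_normK ?num_real//.
    apply: (@le_trans _ _ ((K * r ^+ k) ^+ 2)).
      by rewrite lerXn2r// nnegrE// (le_trans _ hx).
    rewrite exprMn ler_wpM2l ?sqr_ge0// expr2 ler_piMr ?exprn_ge0// exprn_ile1// ltW//.
  have := sq _ h1; have := sq _ h2; rewrite /sqnorm => e2 e1.
  have k0 : 0 <= k%:R :> R by [].
  apply: (@le_trans _ _ (k%:R * (2 * K ^+ 2 * r ^+ k))).
    by rewrite ler_wpM2l//; lra.
  have := ler_wpM2l (_ : 0 <= 2 * K ^+ 2) (Hs k); rewrite mulr_ge0 ?sqr_ge0//.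
  by move=> /(_ isT); rewrite !mulrA [_ * k%:R]mulrC !mulrA; lra.
have nn k : 0 <= k%:R * sqnorm (fourier f k%:Z).
  by rewrite mulr_ge0// /sqnorm addr_ge0// sqr_ge0.
set G := 2 * K ^+ 2 * K'.
have G0 : 0 <= G by rewrite mulr_ge0// mulr_ge0 ?sqr_ge0.
apply: (@le_lt_trans _ _ (G / (1 - s))%:E); last by rewrite ltry.
apply: lime_le.
  by apply: is_cvg_nneseries => k _ _; rewrite lee_fin.
apply: nearW => n; rewrite sumEFin lee_fin.
apply: (@le_trans _ _ (\sum_(0 <= k < n) G * s ^+ k)).
  by apply: ler_sum => k _; exact: M.
rewrite -mulr_sumr ler_wpM2l//.
by have := @geometric_sum_le R s 0 n; rewrite expr0 div1r s0 s1; apply.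
Qed.

Lemma szego_eq f g : (forall k, fourier f k = fourier g k) -> szego f = szego g.
Proof.
move=> fg; rewrite /szego; congr xget; apply/seteqP; split=> h /= H k.
  by rewrite H fg.
by rewrite H -fg.
Qed.

Lemma measurable_cjM u f : square_integrable u -> square_integrable f ->
  cfun_measurable (cj u * f).
Proof.
by move=> su sf; apply: cfun_measurableM; [exact/cfun_measurableJ/sqi_measurable|exact: sqi_measurable].
Qed.

Lemma szego_ae u u' f f' : square_integrable u -> square_integrable u' ->
  square_integrable f -> square_integrable f' -> ae_equal u u' -> ae_equal f f' ->
  szego (cj u * f) = szego (cj u' * f').
Proof.
move=> su su' sf sf' uu ff; apply: szego_eq => k.
rewrite !fourierE !innerE; apply: circle_mean_ae.
- by apply: cfun_measurableM; [exact: measurable_cjM|rewrite cj_ek; exact/sqi_measurable/ek_sqi].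
- by apply: cfun_measurableM; [exact: measurable_cjM|rewrite cj_ek; exact/sqi_measurable/ek_sqi].
- apply: ae_equalM; last exact: ae_equal_refl.
  by apply: ae_equalM => //; exact: ae_equalJ.
Qed.

Lemma lax_formE u f g : lax_form u f g =
  complex_series (fun k => k%:R * (fourier f k%:Z * (fourier g k%:Z)^*)) +
  inner (szego (cj u * f)) (szego (cj u * g)).
Proof. by []. Qed.
Opaque lax_form.

Lemma lax_form_ae u u' f f' g : square_integrable u -> square_integrable u' ->
  square_integrable f -> square_integrable f' -> square_integrable g ->
  ae_equal u u' -> ae_equal f f' -> lax_form u f g = lax_form u' f' g.
Proof.
move=> su su' sf sf' sg uu ff; rewrite !lax_formE.
rewrite (szego_ae su su' sf sf' uu ff) (szego_ae su su' sg sg uu (ae_equal_refl _)).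
have -> : fourier f = fourier f' by apply/funext => k; exact: fourier_ae sf sf' ff.
by [].
Qed.

Lemma lax_ae u u' f f' h h' : square_integrable u -> square_integrable u' ->
  square_integrable f' -> square_integrable h' ->
  ae_equal u u' -> ae_equal f f' -> ae_equal h h' -> lax u f h -> lax u' f' h'.
Proof.
move=> su su' sf' sh' uu ff hh [[hf ff2] hh2 H].
have sf := hardy_sqi hf.
split.
- split; first exact: hardy_ae_trans ff.
  have <- : fourier f = fourier f' by apply/funext => k; exact: fourier_ae sf sf' ff.
  exact: ff2.
- exact: hardy_ae_trans hh.
- move=> g hg; have sg := hardy_sqi hg.1.
  rewrite -(lax_form_ae su su' sf sf' sg uu ff) H//.
  by apply: inner_ae => //; [exact: hardy_sqi|exact: ae_equal_refl].
Qed.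

Lemma lax_unique u f h h' : lax u f h -> lax u f h' -> ae_equal h h'.
Proof.
move=> [_ hh H] [_ hh' H']; apply: hardy_inj => // k.
have hk := hardy_half_smooth (smooth_ek R k).
by rewrite !fourierE -H// H'.
Qed.

(** The form is Hermitian. The derivative terms are compared through the series with coefficients k
    f^(k), which converges by the decay of [f] alone, so [g] may be an eigenfunction about which
    only membership in the domain is known. *)
Lemma lax_sym u f g h h' : smooth f -> lax u f h -> lax u g h' -> inner h g = inner f h'.
Proof.
move=> sf [hf hh H] [hg hh' H'].
have sg := hardy_sqi hg.1; have ssf := smooth_sqi sf.
rewrite -H// (inner_conj (hardy_sqi hh') ssf) -H'// !lax_formE rmorphD /=.
have gd := geo_natmul sf.2.
rewrite -(inner_conj (L2_sqi (szego (cj u * g))) (L2_sqi (szego (cj u * f)))); congr (_ + _).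
transitivity (complex_series (fun k => (k%:R * fourier f k%:Z) * (fourier g k%:Z)^*)).
  by congr complex_series; apply/funext => k; rewrite mulrA.
transitivity ((complex_series (fun k => fourier g k%:Z * (k%:R * fourier f k%:Z)^*))^*); last first.
  congr (_^*); congr complex_series; apply/funext => k.
  by rewrite rmorphM /= conjC_nat mulrCA.
by rewrite inner_synth// inner_synth_conj// conjCK.
Qed.

(** -i d/dx, Pi(conj(u) f) and L_u as explicit functions, to be used when [u] is nice and [f]
    smooth; [lax] itself is only a relation. The product in [lax_op] already lies in the Hardy
    space, by [nice_mul_hardy]. *)
Definition diff_op f : R -> C := synth (fun k => k%:R * fourier f k%:Z).
Definition toeplitz_conj u f : R -> C := synth (fun l : nat => inner f (u * ek l%:Z)).
Definition lax_op u f : R -> C := diff_op f + u * toeplitz_conj u f.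

Lemma diff_op_nice f : smooth f -> nice (diff_op f).
Proof. by move=> sf; apply/nice_synth/geo_natmul; case: sf. Qed.

Lemma fourier_diff_op f (k : nat) : smooth f -> fourier (diff_op f) k%:Z = k%:R * fourier f k%:Z.
Proof. by move=> sf; rewrite fourier_synth//; apply: geo_natmul; case: sf. Qed.

Lemma toeplitz_nice u f : hardy u -> smooth f -> nice (toeplitz_conj u f).
Proof. by move=> hu sf; apply/nice_synth/geo_inner_shift. Qed.

Lemma fourier_toeplitz u f (k : nat) : hardy u -> smooth f ->
  fourier (toeplitz_conj u f) k%:Z = inner f (u * ek k%:Z).
Proof. by move=> hu sf; rewrite fourier_synth//; exact: geo_inner_shift. Qed.

(** Moving [u] to the other side, the coefficient at k < 0 pairs [q] with conj(u) e^{ikx}, whose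
    coefficients at j >= 0 are conjugates of those of [u] at k - j < 0. *)
Lemma nice_mul_hardy u q : nice u -> smooth q -> hardy (u * q).
Proof.
move=> [su bu] sq; split; first by apply: sqi_bounded_mul => //; exact: smooth_sqi.
move=> k k0; rewrite fourierE inner_bounded_mul.
apply: inner_smooth0 => //; first by apply: sqi_bounded_mul; [exact: boundedJ|exact: ek_sqi].
move=> j; rewrite fourier_cjM.
have -> : inner (@ek R k) (u * ek j%:Z) = inner (ek (k - j%:Z)) u.
  by rewrite !innerE cjM cj_ek ekD; congr circle_mean; ring.
rewrite inner_conj; [|exact: smooth_sqi|exact: ek_sqi].
rewrite -fourierE (su.1.2) ?conjC0 ?mulr0//.
by rewrite (le_lt_trans _ k0)// gerBl.
Qed.

Lemma lax_op_hardy u f : nice u -> smooth f -> hardy (lax_op u f).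
Proof.
move=> nu sf; apply: hardyD; first by have [[]] := diff_op_nice sf.
by apply: nice_mul_hardy => //; have [] := toeplitz_nice nu.1.1 sf.
Qed.

(** Testing against [g] in the form domain splits into a derivative part and a Toeplitz part; in the
    latter conj(u) g may be replaced by its Szego projection because [toeplitz_conj u f] has only
    nonnegative frequencies. *)
Lemma lax_lax_op u f : nice u -> smooth f -> lax u f (lax_op u f).
Proof.
move=> nu sf; split; [exact: hardy_half_smooth|exact: lax_op_hardy|].
move=> g [hg _]; have sg := hardy_sqi hg; have hu := nu.1.1.
have [nq nd] := (toeplitz_nice hu sf, diff_op_nice sf).
rewrite lax_formE /lax_op innerDl//; last 2 first.
- exact: smooth_sqi nd.1.
- exact/hardy_sqi/nice_mul_hardy/(nq.1).
congr (_ + _).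
  rewrite -inner_smooth//; last exact: nd.1.
  by congr complex_series; apply/funext => k; rewrite fourier_diff_op// mulrA.
rewrite inner_bounded_mul.
have sug : square_integrable (cj u * g) by apply: sqi_bounded_mul => //; exact/boundedJ/(nu.2).
transitivity (inner (toeplitz_conj u f) (szego (cj u * g))).
  apply: inner_ae; try exact: L2_sqi; [exact: smooth_sqi nq.1| |exact: ae_equal_refl].
  apply: fourier_inj; [exact: L2_sqi|exact: smooth_sqi nq.1|].
  move=> k; rewrite szego_nice//; last exact: smooth_hardy.
  case: k => k; first by rewrite /= fourier_toeplitz// fourier_cjM.
  by rewrite /= (nq.1.1.2).
apply/eqP; rewrite -subr_eq0 -innerBr//; [|exact: L2_sqi|exact: smooth_sqi nq.1].
apply/eqP; apply: inner_smooth0; first exact: nq.1.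
  by apply: sqiB => //; exact: L2_sqi.
move=> k; rewrite fourierB//; last exact: L2_sqi.
by rewrite szego_nice//= subrr conjC0 mulr0.
Qed.

Lemma fourier_lax_op u f (k : nat) : nice u -> smooth f ->
  fourier (lax_op u f) k%:Z = k%:R * fourier f k%:Z + inner (toeplitz_conj u f) (cj u * ek k%:Z).
Proof.
move=> nu sf; have [nq nd] := (toeplitz_nice nu.1.1 sf, diff_op_nice sf).
rewrite /lax_op fourierD ?fourier_diff_op//.
- by rewrite [fourier (u * _) _]fourierE inner_bounded_mul.
- exact: smooth_sqi nd.1.
- exact/hardy_sqi/nice_mul_hardy/(nq.1).
Qed.

Opaque lax_op diff_op toeplitz_conj.

Lemma cj_ek_sqi u (k : int) : nice u -> square_integrable (cj u * ek k).
Proof. by move=> nu; apply: sqi_bounded_mul; [exact/boundedJ/(nu.2)|exact: ek_sqi]. Qed.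

Lemma mul_ek_sqi g k : square_integrable g -> square_integrable (g * ek k).
Proof. by rewrite mulrC; exact: ek_mul_sqi. Qed.

Lemma lax_opD u f g : nice u -> smooth f -> smooth g ->
  ae_equal (lax_op u (f + g)) (lax_op u f + lax_op u g).
Proof.
move=> nu sf sg; have sfg := smoothD sf sg; have hu := nu.1.1; have su := hardy_sqi hu.
have [[nf ng] nfg] := (toeplitz_nice hu sf, toeplitz_nice hu sg, toeplitz_nice hu sfg).
have [[hf hg] hfg] := (lax_op_hardy nu sf, lax_op_hardy nu sg, lax_op_hardy nu sfg).
apply: (hardy_inj hfg (hardyD hf hg)) => k.
rewrite (fourierD _ (hardy_sqi hf) (hardy_sqi hg)).
rewrite [LHS](fourier_lax_op k nu sfg) [X in _ = X + _](fourier_lax_op k nu sf).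
rewrite [X in _ = _ + X](fourier_lax_op k nu sg) addrACA -mulrDr.
rewrite -[X in _ = _ * X + _](fourierD _ (smooth_sqi sf) (smooth_sqi sg)); congr (_ + _).
rewrite -innerDl; [|exact: smooth_sqi nf.1|exact: smooth_sqi ng.1|exact: cj_ek_sqi].
have sD := smoothD nf.1 ng.1.
apply: inner_ae; [exact: smooth_sqi nfg.1|exact: smooth_sqi sD|exact: cj_ek_sqi|exact: cj_ek_sqi| |exact: ae_equal_refl].
apply: (hardy_inj (smooth_hardy nfg.1) (smooth_hardy sD)) => j; rewrite (fourierD _ (smooth_sqi nf.1) (smooth_sqi ng.1)).
rewrite [LHS](fourier_toeplitz j hu sfg) [X in _ = X + _](fourier_toeplitz j hu sf).
rewrite [X in _ = _ + X](fourier_toeplitz j hu sg).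
exact: (innerDl (smooth_sqi sf) (smooth_sqi sg) (mul_ek_sqi _ su)).
Qed.

Lemma lax_opZ u c f : nice u -> smooth f -> ae_equal (lax_op u (c *: f)) (c *: lax_op u f).
Proof.
move=> nu sf; have scf := smoothZ c sf; have hu := nu.1.1; have su := hardy_sqi hu.
have [nf ncf] := (toeplitz_nice hu sf, toeplitz_nice hu scf).
have [hf hcf] := (lax_op_hardy nu sf, lax_op_hardy nu scf).
apply: (hardy_inj hcf (hardyZ c hf)) => k; rewrite (fourierZ _ _ (hardy_sqi hf)).
rewrite [LHS](fourier_lax_op k nu scf) [X in _ = _ * X](fourier_lax_op k nu sf).
rewrite mulrDr mulrCA -[X in _ = _ * X + _](fourierZ _ _ (smooth_sqi sf)); congr (_ + _).
rewrite -innerZl; [|exact: smooth_sqi nf.1|exact: cj_ek_sqi].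
have sD := smoothZ c nf.1.
apply: inner_ae; [exact: smooth_sqi ncf.1|exact: smooth_sqi sD|exact: cj_ek_sqi|exact: cj_ek_sqi| |exact: ae_equal_refl].
apply: (hardy_inj (smooth_hardy ncf.1) (smooth_hardy sD)) => j; rewrite fourierZ; last exact: smooth_sqi nf.1.
rewrite [LHS](fourier_toeplitz j hu scf) [X in _ = _ * X](fourier_toeplitz j hu sf).
exact: (innerZl _ (smooth_sqi sf) (mul_ek_sqi _ su)).
Qed.

Lemma lax_op_ae u f g : nice u -> smooth f -> smooth g -> ae_equal f g ->
  ae_equal (lax_op u f) (lax_op u g).
Proof.
move=> nu sf sg fg; have su := hardy_sqi nu.1.1.
apply: (@lax_unique u g); last exact: lax_lax_op.
apply: (lax_ae su su _ _ (ae_equal_refl _) fg (ae_equal_refl _) (lax_lax_op nu sf)).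
  exact: smooth_sqi.
exact/hardy_sqi/lax_op_hardy.
Qed.

(* The commutator identity [L S = S L + S + <S., u> u]. *)
Lemma lax_op_shift u f : nice u -> smooth f ->
  ae_equal (lax_op u (ek 1 * f)) (ek 1 * lax_op u f + ek 1 * f + inner (ek 1 * f) u *: u).
Proof.
move=> nu sf; have sSf := smooth_shift sf; have hu := nu.1.1; have su := hardy_sqi hu.
have [nf nSf] := (toeplitz_nice hu sf, toeplitz_nice hu sSf).
have hS : hardy (ek 1 * lax_op u f) by apply: hardy_shift; exact: lax_op_hardy.
have h1 : hardy (ek 1 * lax_op u f + ek 1 * f) by apply: hardyD => //; exact: smooth_hardy.
have h2 : hardy (inner (ek 1 * f) u *: u) by apply: hardyZ.
apply: (hardy_inj (lax_op_hardy nu sSf) (hardyD h1 h2)) => k; rewrite (fourierD _ (hardy_sqi h1) (hardy_sqi h2)).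
rewrite (fourierD _ (hardy_sqi hS) (smooth_sqi sSf)) (fourierZ _ _ su).
set c := inner (ek 1 * f) u.
(* Commuting S with Pi loses only the frequency -1 of conj(u) f, which S moves to 0: this constant
   is the origin of the rank-one term. *)
have E : ae_equal (toeplitz_conj u (ek 1 * f)) (ek 1 * toeplitz_conj u f + c *: ek 0).
  have hr : hardy (ek 1 * toeplitz_conj u f + c *: ek 0).
    apply: hardyD; first exact/hardy_shift/(smooth_hardy nf.1).
    by apply: hardyZ; exact: (hardy_ek R 0).
  apply: (hardy_inj (smooth_hardy nSf.1) hr) => j; rewrite fourierD; last 2 first.
  - exact/ek_mul_sqi/smooth_sqi/(nf.1).
  - exact/sqiZ/ek_sqi.
  rewrite fourierZ ?fourier_ek; last exact: ek_sqi.
  rewrite fourier_toeplitz// fourier_ekM.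
  case: j => [|j].
    rewrite mulr1 (nf.1.1.2)// add0r /c; congr inner.
    by rewrite ek0 mulr1.
  rewrite mulr0 addr0 -addn1 PoszD addrK fourier_toeplitz//.
  rewrite inner_bounded_mul cj_ek; congr inner; rewrite mulrCA -ekD; congr (_ * ek _).
  by rewrite addrC addrK.
rewrite fourier_lax_op//.
have sr : square_integrable (ek 1 * toeplitz_conj u f + c *: ek 0).
  by apply: sqiD; [exact/ek_mul_sqi/smooth_sqi/(nf.1)|exact/sqiZ/ek_sqi].
rewrite (inner_ae (smooth_sqi nSf.1) sr (cj_ek_sqi k nu) (cj_ek_sqi k nu) E (ae_equal_refl _)).
rewrite innerDl; [|exact/ek_mul_sqi/smooth_sqi/(nf.1)|exact/sqiZ/ek_sqi|exact: cj_ek_sqi].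
rewrite innerZl; [|exact: ek_sqi|exact: cj_ek_sqi].
have -> : inner (@ek R 0) (cj u * ek k%:Z) = fourier u k%:Z.
  by rewrite -inner_bounded_mul ek0 mulr1 fourierE.
rewrite addrA; congr (_ + _).
rewrite !fourier_ekM inner_bounded_mul cj_ek.
case: k => [|k].
  rewrite mul0r add0r (lax_op_hardy nu sf).2// (smooth_hardy sf).2// addr0.
  rewrite mulrCA -ekD addr0 -inner_bounded_mul -fourierE.
  by rewrite (nice_mul_hardy nu nf.1).2.
have -> : k.+1%:Z - 1 = k%:Z by rewrite -addn1 PoszD addrK.
rewrite fourier_lax_op// mulrCA -ekD.
have -> : -1 + k.+1%:Z = k%:Z by rewrite -addn1 PoszD addrC addrK.
by rewrite -natr1; ring.
Qed.

(** conj(u) has no positive frequencies, so its projection is the constant [inner 1 u]. *)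
Lemma lax_op1 u : nice u -> ae_equal (lax_op u 1) (inner 1 u *: u).
Proof.
move=> nu; have s1 : smooth (1 : R -> C) by rewrite -ek0; exact: (smooth_ek R 0).
have hu := nu.1.1; have su := hardy_sqi hu.
have n1 := toeplitz_nice hu s1.
apply: (hardy_inj (lax_op_hardy nu s1) (hardyZ _ hu)) => k; rewrite fourierZ// fourier_lax_op//.
have E : ae_equal (toeplitz_conj u 1) (inner 1 u *: ek 0).
  apply: (hardy_inj (smooth_hardy n1.1) (hardyZ _ (hardy_ek R 0))) => j; rewrite fourierZ ?fourier_ek; last exact: ek_sqi.
  rewrite fourier_toeplitz//; case: j => [|j]; first by rewrite mulr1 ek0 mulr1.
  have suk := mul_ek_sqi (Posz j.+1) su.
  rewrite mulr0 (inner_conj suk (smooth_sqi s1)) [u * _]mulrC -[X in inner _ X]ek0.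
  by rewrite -fourierE fourier_ekM (hu.2) ?conjC0.
have sr : square_integrable (inner 1 u *: @ek R 0) by exact/sqiZ/ek_sqi.
rewrite (inner_ae (smooth_sqi n1.1) sr (cj_ek_sqi k nu) (cj_ek_sqi k nu) E (ae_equal_refl _)).
rewrite innerZl; [|exact: ek_sqi|exact: cj_ek_sqi].
rewrite -inner_bounded_mul ek0 mulr1 -fourierE -ek0 fourier_ek.
by case: k => [|k]; rewrite ?mul0r ?mulr0 add0r.
Qed.

End LaxOperator.

(** * Uniqueness of the spectrum and of the gauged eigenbasis *)

Section EigenbasisUniqueness.
Variable R : realType.
Local Notation C := R[i].
Opaque fourier inner circle_mean lax_form.
Implicit Types (f g h u : R -> C) (lam : nat -> R).

Lemma eigen_orthogonal u f g (a b : R) : smooth f -> lax u f (a%:C *: f) ->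
  lax u g (b%:C *: g) -> a != b -> inner f g = 0.
Proof.
move=> sf lf lg ab; have [[/hardy_sqi sg _] _ _] := lg; have := lax_sym sf lf lg.
rewrite (innerZl _ (smooth_sqi sf) sg) (innerZr _ sg (smooth_sqi sf)) => /eqP.
have -> : (b%:C)^* = b%:C by apply: conjc_real.
rewrite -subr_eq0 -mulrBl mulf_eq0 -rmorphB /= => /orP[|/eqP//].
by rewrite (eq_complex _ 0) /= subr_eq0 (negbTE ab).
Qed.

Lemma inner_self_ae0 f : square_integrable f -> ae_equal f (cst 0) -> inner f f = 0.
Proof.
move=> sf f0; rewrite -(inner0r f); apply: inner_ae => //; first exact: sqi0.
exact: ae_equal_refl.
Qed.

Lemma increasing_enum_eq lam lam' : (forall n, lam n < lam n.+1) ->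
  (forall n, lam' n < lam' n.+1) -> (forall n, exists m, lam n = lam' m) ->
  (forall n, exists m, lam' n = lam m) -> lam = lam'.
Proof.
move=> l1 l2 h1 h2.
have mono l : (forall n, l n < l n.+1) -> forall i j, (i < j)%N -> l i < l j :> R.
  move=> hl i j; elim: j => // j IH; rewrite ltnS leq_eqVlt => /predU1P[->//|/IH h].
  exact: lt_trans h (hl j).
apply/funext => n; elim/ltn_ind: n => n IH.
have [k ek] := h1 n; have [j ej] := h2 n.
have nk : (n <= k)%N.
  rewrite leqNgt; apply/negP => kn; have := mono _ l1 _ _ kn.
  by rewrite ek (IH k)// ltxx.
have nj : (n <= j)%N.
  rewrite leqNgt; apply/negP => jn; have := mono _ l2 _ _ jn.
  by rewrite ej (IH j)// ltxx.
apply/eqP; rewrite eq_le; apply/andP; split.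
  move: nj; rewrite leq_eqVlt => /predU1P[e|/(mono _ l1)]; first by rewrite ej -e.
  by rewrite -ej => /ltW.
move: nk; rewrite leq_eqVlt => /predU1P[e|/(mono _ l2)]; first by rewrite ek -e.
by rewrite -ek => /ltW.
Qed.

(** An eigenfunction with a new eigenvalue would be orthogonal to the whole basis, hence zero by
    totality. *)
Lemma eigenbasis_eigenvalue u lam (f : nat -> L2 R) g (a : R) : eigenbasis u lam f ->
  smooth g -> lax u g (a%:C *: g) -> inner g g != 0 -> exists n, a = lam n.
Proof.
move=> [_ _ lf _ tot] sg lg; have [//|na] := pselect (exists n, a = lam n).
case/eqP; apply: inner_self_ae0; first exact: smooth_sqi.
apply: tot; first exact: smooth_hardy.
by move=> n; apply: (eigen_orthogonal sg lg (lf n)); apply/eqP => e; apply: na; exists n.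
Qed.

Section Smooth.
Variables (u : R -> C) (lam : nat -> R) (f : nat -> L2 R).
Hypotheses (bf : eigenbasis u lam f) (sf : forall n, smooth (f n)).

(** Same argument as [eigenbasis_eigenvalue], with the regularity demanded by [lax_sym] supplied by
    the basis instead of [g]. *)
Lemma smooth_eigenvalue g (a : R) : lax u g (a%:C *: g) -> inner g g != 0 -> exists n, a = lam n.
Proof.
case: bf => _ _ lf _ tot lg; have [//|na] := pselect (exists n, a = lam n).
have [[hg _] _ _] := lg; have sg := hardy_sqi hg.
case/eqP; apply: inner_self_ae0 => //.
apply: tot => // n; rewrite (inner_conj (L2_sqi (f n)) sg).
rewrite (eigen_orthogonal (sf n) (lf n) lg) ?conjC0// eq_sym.
by apply/eqP => e; apply: na; exists n.
Qed.

Lemma eigenbasis_lambda lam' (f' : nat -> L2 R) : eigenbasis u lam' f' -> lam' = lam.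
Proof.
move=> bf'; have [l1 _ lf onf tf] := bf; have [l1' _ lf' onf' tf'] := bf'.
apply: increasing_enum_eq => // n.
  by apply: (smooth_eigenvalue (lf' n)); rewrite onf' eqxx oner_eq0.
by apply: (eigenbasis_eigenvalue bf' (sf n) (lf n)); rewrite onf eqxx oner_eq0.
Qed.

Lemma lambda_eq : lambda u = lam.
Proof.
rewrite /lambda; case: xgetP => [l -> [f' bf']|/(_ lam) []]; last by exists f.
exact: eigenbasis_lambda bf'.
Qed.

Lemma lt_lam i j : (i < j)%N -> lam i < lam j.
Proof.
have hl := eigenvalue_lt bf.
elim: j => // j IH; rewrite ltnS leq_eqVlt => /predU1P[->//|/IH h].
exact: lt_trans h (hl j).
Qed.

Lemma lam_inj i j : lam i = lam j -> i = j.
Proof. by move=> e; have [/lt_lam|/lt_lam|//] := ltngtP i j; rewrite e ltxx. Qed.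

Lemma eigenfun_proportional n g : lax u g ((lam n)%:C *: g) ->
  ae_equal g (inner g (f n) *: (f n : R -> C)).
Proof.
case: bf => _ _ lf onf tot lg.
have [[hg _] _ _] := lg; have sg := hardy_sqi hg; have sn := L2_sqi (f n).
have hf m : hardy (f m) by exact: smooth_hardy.
set c := inner g (f n).
have : ae_equal (g - c *: (f n : R -> C)) (cst 0).
  apply: tot; first by apply: hardyB => //; exact: hardyZ.
  move=> m; rewrite (innerBl sg (sqiZ c sn) (L2_sqi (f m))) (innerZl c sn (L2_sqi (f m))).
  rewrite onf; have [e|nm] := eqVneq n m; first by rewrite mulr1 /c e subrr.
  rewrite mulr0 subr0 (inner_conj (L2_sqi (f m)) sg).
  rewrite (eigen_orthogonal (sf m) (lf m) lg) ?conjC0//.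
  by apply: contra_neq nm => /lam_inj.
move=> h; have := ae_equalD h (ae_equal_refl (c *: (f n : R -> C))).
by rewrite subrK (_ : cst 0 = 0)// add0r.
Qed.

Lemma unimodular_positive (c z : C) : `|c| = 1 -> 0 < z -> 0 < c^* * z -> c = 1.
Proof.
move=> c1 z0; rewrite pmulr_lgt0// => c0.
have : c = c^* by rewrite -[LHS]conjCK; apply/CrealP; exact: gtr0_real.
by rewrite -(gtr0_norm c0) norm_conjC c1.
Qed.

Hypothesis gf : transport_gauge f.

(** The spectrum is simple, so [f' n] is a unimodular multiple of [f n]; the gauge condition linking
    [n] and [n.+1] involves [f' n], already identified, and forces the next factor to be 1. *)
Lemma eigenbasis_gauge (f' : nat -> L2 R) : eigenbasis u lam f' -> transport_gauge f' -> f' = f.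
Proof.
move=> bf' [g0 gS]; have [f0 fS] := gf.
have [_ _ lf onf _] := bf; have [_ _ lf' onf' _] := bf'.
have p n := eigenfun_proportional (lf' n).
have sq n := L2_sqi (f n); have sq' n := L2_sqi (f' n).
have sc n : square_integrable (inner (f' n) (f n) *: (f n : R -> C)) by exact: sqiZ.
have c1 n : `|inner (f' n) (f n)| = 1.
  have := onf' n n; rewrite eqxx (inner_ae (sq' n) (sc n) (sq' n) (sc n) (p n) (p n)).
  rewrite (innerZl _ (sq n) (sc n)) (innerZr _ (sq n) (sq n)) onf eqxx mulr1 -sqr_normc => /eqP.
  by rewrite sqrp_eq1// => /eqP.
have one g n : square_integrable g -> 0 < inner g (f n) -> 0 < inner g (f' n) -> f' n = f n.
  move=> sg h1 h2; apply: L2_eq; apply: (ae_equal_trans (p n)).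
  rewrite (_ : inner (f' n) (f n) = 1) ?scale1r; first exact: ae_equal_refl.
  apply: (unimodular_positive (c1 n) h1).
  by rewrite -(innerZr _ (sq n) sg) -(inner_ae sg sg (sq' n) (sc n) (ae_equal_refl _) (p n)).
apply/funext; elim=> [|n IH].
  by apply: (one _ _ _ f0 g0); exact: sqi_cst.
have := gS n; rewrite IH => h; apply: (one _ _ _ (fS n) h).
by rewrite shiftE; exact: ek_mul_sqi.
Qed.

Lemma eigenfun_eq : eigenfun u = f.
Proof.
rewrite /eigenfun lambda_eq; case: xgetP => [f' -> [bf' gf']|/(_ f) []]; last by split.
exact: eigenbasis_gauge.
Qed.

End Smooth.

(** The way by which the choices in [lambda] and [eigenfun] become known: it suffices to display
    smooth functions [phi n], not classes, with the spectral properties. *)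
Lemma spectral_data u lam (phi : nat -> R -> C) : square_integrable u ->
  (forall n, smooth (phi n)) -> (forall n, lam n < lam n.+1) ->
  lam n @[n --> \oo] --> +oo ->
  (forall n, lax u (phi n) ((lam n)%:C *: phi n)) ->
  (forall m n, inner (phi m) (phi n) = (m == n)%:R) ->
  (forall g, hardy g -> (forall n, inner g (phi n) = 0) -> ae_equal g (cst 0)) ->
  0 < inner 1 (phi 0%N) -> (forall n, 0 < inner (ek 1 * phi n) (phi n.+1)) ->
  exists f : nat -> L2 R, [/\ eigenbasis u lam f, forall n, ae_equal (f n) (phi n),
    lambda u = lam & forall n, inner u (eigenfun u n) = inner u (phi n)].
Proof.
move=> su sp linc linf lp op tp g0 gS.
have sq n := smooth_sqi (sp n).
have /choice[F FP] : forall n, exists H : L2 R, ae_equal H (phi n) by move=> n; exact: L2_of.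
have sqF n := L2_sqi (F n).
have PF n := ae_equal_sym (FP n).
have bF : eigenbasis u lam F.
  split => //.
  - move=> n; apply: (lax_ae su su (sqF n) _ (ae_equal_refl _) (PF n) _ (lp n)).
      exact: sqiZ.
    by apply: ae_equalZ.
  - by move=> m n; rewrite (inner_ae (sqF m) (sq m) (sqF n) (sq n) (FP m) (FP n)).
  - move=> g hg gF; apply: tp => // n.
    by rewrite (inner_ae (hardy_sqi hg) (hardy_sqi hg) (sq n) (sqF n) (ae_equal_refl _) (PF n)).
have sF n : smooth (F n) by apply: (smooth_ae_trans (sp n)).
have gF : transport_gauge F.
  have s1 : square_integrable (1 : R -> C) by exact: sqi_cst.
  split; first by rewrite (inner_ae s1 s1 (sqF _) (sq _) (ae_equal_refl _) (FP _)).
  move=> n; rewrite shiftE.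
  rewrite (inner_ae (ek_mul_sqi 1 (sqF n)) (ek_mul_sqi 1 (sq n)) (sqF _) (sq _) _ (FP _))//.
  by apply: ae_equalM; [exact: ae_equal_refl|].
exists F; split => //; first exact: lambda_eq bF sF.
move=> n; rewrite (eigenfun_eq bF sF gF).
exact: (inner_ae su su (sqF n) (sq n) (ae_equal_refl _) (FP n)).
Qed.

End EigenbasisUniqueness.

(** * The finite-dimensional spectral data *)

Section GapData.
Variable R : realType.
Local Notation C := R[i].
Variables (N : nat) (lam mu : nat -> R).
Hypotheses (mu_lam : forall m, mu m <= lam m) (lam_mu : forall m, lam m < mu m.+1).
Local Notation I := 'I_N.+1.
Implicit Types (U : I -> I -> C) (a c : I -> C) (m p q : I).

(* [U m p] is meant to be <S f_(m-1) | f_p> (with S f_(-1) = 1), [a p] to be <u | f_p> and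
   [c m] to be <S f_(m-1) | u>. *)
Record gap_data U a c : Prop := {
  gap_columns : forall p q, \sum_m (U m p)^* * U m q = (p == q)%:R;
  gap_commutator : forall m p, (lam p - mu m)%:C * U m p = c m * a p;
  gap_expansion : forall p, a p = \sum_m (c m)^* * U m p;
  gap_gauge : forall m, 0 < U m m }.

(** A left inverse of a square matrix is a right inverse. *)
Lemma unitary_rows U : (forall p q, \sum_m (U m p)^* * U m q = (p == q)%:R) ->
  forall m m', \sum_p U m p * (U m' p)^* = (m == m')%:R.
Proof.
move=> H m m'.
pose A : 'M[C]_N.+1 := \matrix_(i, j) U i j.
pose B : 'M[C]_N.+1 := \matrix_(i, j) (U j i)^*.
have : B *m A = 1%:M.
  apply/matrixP => p q; rewrite !mxE -H; apply: eq_bigr => j _.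
  by rewrite !mxE.
move/mulmx1C => /matrixP /(_ m m'); rewrite !mxE => <-.
by apply: eq_bigr => j _; rewrite !mxE.
Qed.

Lemma lt_lam_mu i j : (i < j)%N -> lam i < mu j.
Proof.
elim: j => // j IH; rewrite ltnS leq_eqVlt => /predU1P[->//|/IH h].
by apply: lt_trans h (le_lt_trans (mu_lam j) (lam_mu j)).
Qed.

Lemma lt_mu_lam i j : (i < j)%N -> mu i < lam j.
Proof.
move=> ij; apply: le_lt_trans (mu_lam i) (lt_le_trans (lt_lam_mu ij) (mu_lam j)).
Qed.

Lemma lt_mu i j : (i < j)%N -> mu i < mu j.
Proof. by move=> ij; exact: le_lt_trans (mu_lam i) (lt_lam_mu ij). Qed.

Lemma lt_lam' i j : (i < j)%N -> lam i < lam j.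
Proof. by move=> ij; exact: lt_le_trans (lt_lam_mu ij) (mu_lam j). Qed.

(** By interlacing, mu 0 <= lam 0 < mu 1 <= lam 1 < ..., an eigenvalue [lam i] can meet [mu j] only
    on the diagonal. *)
Lemma lam_sub_mu_neq0 i j : i != j -> lam i - mu j != 0.
Proof.
rewrite neq_ltn => /orP[/lt_lam_mu|/lt_mu_lam] h; rewrite subr_eq0.
  by rewrite lt_eqF.
by rewrite gt_eqF.
Qed.

Lemma mu_sub_neq0 i j : i != j -> mu i - mu j != 0.
Proof.
rewrite neq_ltn => /orP[/lt_mu|/lt_mu] h; rewrite subr_eq0.
  by rewrite lt_eqF.
by rewrite gt_eqF.
Qed.

Lemma lam_inj' i j : lam i = lam j -> i = j.
Proof. by move=> e; have [/lt_lam'|/lt_lam'|//] := ltngtP i j; rewrite e ltxx. Qed.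

Lemma real_complex_eq0 (x : R) : (x%:C == 0) = (x == 0).
Proof. by rewrite -(inj_eq (@complexI R)). Qed.

(** Numerator of sum_m y_m / (X - mu_m) over the common denominator. *)
Definition residue_poly (y : I -> R) : {poly R} :=
  \sum_m y m *: \prod_(q | q != m) ('X - (mu q)%:P).

Lemma residue_poly_size y : (size (residue_poly y) <= N.+1)%N.
Proof.
apply: (leq_trans (size_sum _ _ _)); apply/bigmax_leqP => m _.
apply: (leq_trans (size_scale_leq _ _)).
rewrite -big_filter size_prod_XsubC size_filter -sum1_count.
by rewrite (eq_bigl (mem (predC1 m)))// sum1_card cardC1 card_ord.
Qed.

Lemma residue_poly_lam y p : (residue_poly y).[lam p] =
  \sum_m y m * \prod_(q | q != m) (lam p - mu q).
Proof.
rewrite /residue_poly horner_sum; apply: eq_bigr => m _.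
rewrite hornerZ horner_prod; congr (_ * _); apply: eq_bigr => q _.
by rewrite hornerXsubC.
Qed.

Lemma residue_poly_mu y m : (residue_poly y).[mu m] =
  y m * \prod_(q | q != m) (mu m - mu q).
Proof.
rewrite /residue_poly horner_sum (bigD1 m)//= [X in _ + X]big1 ?addr0.
  by rewrite hornerZ horner_prod; congr (_ * _); apply: eq_bigr => q _; rewrite hornerXsubC.
move=> q qm; rewrite hornerZ horner_prod (bigD1 m)/=; last by rewrite eq_sym.
by rewrite hornerXsubC subrr mul0r mulr0.
Qed.

Lemma poly_eq_lam (P Q : {poly R}) : (size P <= N.+1)%N -> (size Q <= N.+1)%N ->
  (forall p : I, P.[lam p] = Q.[lam p]) -> P = Q.
Proof.
move=> sP sQ PQ; apply/eqP; rewrite -subr_eq0; apply/eqP.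
apply: (@roots_geq_poly_eq0 _ _ [seq lam (p : I) | p <- enum I]).
- apply/allP => x /mapP[p _ ->]; rewrite /root hornerD hornerN PQ subrr//.
- by rewrite map_inj_uniq ?enum_uniq// => p q /lam_inj' /val_inj.
- rewrite size_map -cardE card_ord.
  by rewrite (leq_trans (size_polyD _ _))// size_polyN geq_max sP.
Qed.

Lemma residue_unique y y' : (forall p, (residue_poly y).[lam p] = (residue_poly y').[lam p]) ->
  y =1 y'.
Proof.
move=> H m; have e := poly_eq_lam (residue_poly_size y) (residue_poly_size y') H.
have := residue_poly_mu y m; rewrite e residue_poly_mu => /mulIf -> //.
apply/prodf_neq0 => q qm; apply: mu_sub_neq0.
by apply: contra_neq qm => /val_inj.
Qed.

(** The residue at mu_m of 1 - prod_q (X - lam_q) / (X - mu_q); it turns out to be |c_m|^2. *)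
Definition residue m : R :=
  (lam m - mu m) * \prod_(q | q != m) ((lam q - mu m) / (mu q - mu m)).

(** By interlacing, lam_q and mu_q lie on the same side of mu_m when q and m differ. *)
Lemma residue_ge0 m : 0 <= residue m.
Proof.
apply: mulr_ge0; first by rewrite subr_ge0.
apply: prodr_ge0 => q qm.
have : (q : nat) != m by apply: contra_neq qm => /val_inj.
rewrite neq_ltn => /orP[h|h].
  have h1 := lt_lam_mu h; have h2 := lt_mu h.
  by rewrite -mulrNN -invrN divr_ge0// oppr_ge0 subr_le0 ltW.
have h1 := lt_mu_lam h; have h2 := lt_mu h.
by rewrite divr_ge0// subr_ge0 ltW.
Qed.

Lemma residue_eq0 m : (residue m == 0) = (lam m == mu m).
Proof.
rewrite /residue mulf_eq0 subr_eq0 orbC.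
rewrite (_ : (\prod_(q | _) _ == 0) = false)//; apply/negbTE/prodf_neq0 => q qm.
have qm' : (q : nat) != m by apply: contra_neq qm => /val_inj.
by rewrite mulf_eq0 negb_or lam_sub_mu_neq0//= invr_eq0 mu_sub_neq0.
Qed.

(* Lagrange interpolation of [prod (X - mu) - prod (X - lam)] at the points [mu]. *)
Lemma residue_interpolation p :
  (residue_poly residue).[lam p] = \prod_(q : I) (lam p - mu q).
Proof.
pose G : {poly R} := \prod_(q : I) ('X - (mu q)%:P) - \prod_(q : I) ('X - (lam q)%:P).
have sG : (size G <= N.+1)%N.
  have monP (f : I -> R) : \prod_(q : I) ('X - (f q)%:P) \is monic.
    by apply: monic_prod => q _; exact: monicXsubC.
  have sP (f : I -> R) : size (\prod_(q : I) ('X - (f q)%:P)) = N.+2.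
    by rewrite size_prod_XsubC -sum1_size (eq_bigl (mem I))// sum1_card card_ord.
  apply/leq_sizeP => j; rewrite leq_eqVlt => /predU1P[<-|hj].
    rewrite coefB; have := monicP (monP (fun q => mu q)); have := monicP (monP (fun q => lam q)).
    by rewrite !lead_coefE !sP /= => -> ->; rewrite subrr.
  by rewrite coefB !nth_default ?sP// subrr.
have Gmu m : G.[mu m] = residue m * \prod_(q | q != m) (mu m - mu q).
  rewrite /G hornerD hornerN !horner_prod (bigD1 m)//= hornerXsubC subrr mul0r sub0r.
  rewrite (bigD1 m)//= hornerXsubC -mulNr opprB /residue -mulrA; congr (_ * _).
  rewrite -big_split/=; apply: eq_bigr => q qm; rewrite hornerXsubC.
  have qm' : (q : nat) != m by apply: contra_neq qm => /val_inj.
  have d := mu_sub_neq0 qm'.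
  by rewrite -[mu m - mu q]opprB mulrN divfK// opprB.
have -> : residue_poly residue = G.
  apply/eqP; rewrite -subr_eq0; apply/eqP.
  apply: (@roots_geq_poly_eq0 _ _ [seq mu (p : I) | p <- enum I]).
  - apply/allP => x /mapP[m _ ->]; rewrite /root hornerD hornerN Gmu residue_poly_mu subrr//.
  - rewrite map_inj_uniq ?enum_uniq// => i j e; apply/val_inj.
    by have [/lt_mu|/lt_mu|//] := ltngtP i j; rewrite e ltxx.
  - rewrite size_map -cardE card_ord (leq_trans (size_polyD _ _))//.
    by rewrite size_polyN geq_max residue_poly_size.
rewrite /G hornerD hornerN !horner_prod [X in _ - X](bigD1 p)//= hornerXsubC subrr mul0r subr0.
by apply: eq_bigr => q _; rewrite hornerXsubC.
Qed.

(** The secular equation of the rank-one perturbation: the rational function 1 - prod (X - lam) / (X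
    - mu), which is the sum of its polar parts, equals 1 at an eigenvalue that is not a pole. *)
Lemma residue_sum p : lam p != mu p -> \sum_m residue m / (lam p - mu m) = 1.
Proof.
move=> np.
have d q : lam p - mu q != 0.
  have [e|h] := eqVneq p q; first by rewrite -e subr_eq0.
  by apply: lam_sub_mu_neq0; apply: contra_neq h => /val_inj.
have P0 : \prod_(q : I) (lam p - mu q) != 0 by apply/prodf_neq0.
apply: (mulIf P0); rewrite mul1r -[RHS]residue_interpolation residue_poly_lam mulr_suml.
apply: eq_bigr => m _; by rewrite [X in _ / _ * X](bigD1 m)//= mulrA divfK.
Qed.

Opaque residue.

Section Given.
Variables (U : I -> I -> C) (a c : I -> C).
Hypothesis D : gap_data U a c.

Let LM m p : (lam p - mu m)%:C * U m p = c m * a p.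
Proof. by move: m p; exact: gap_commutator D. Qed.

Let d0 m p : p != m -> (lam p - mu m)%:C != 0.
Proof.
by move=> pm; rewrite real_complex_eq0 lam_sub_mu_neq0.
Qed.

Let Uform m p : lam p - mu m != 0 -> U m p = c m * a p / (lam p - mu m)%:C.
Proof.
move=> h; have h' : (lam p - mu m)%:C != 0 :> C by rewrite real_complex_eq0.
by rewrite -LM mulrAC divff ?mul1r.
Qed.

Let Uoff m p : p != m -> U m p = c m * a p / (lam p - mu m)%:C.
Proof. by move=> pm; rewrite -LM mulrAC divff ?mul1r// d0. Qed.

Lemma gap_expansion_row m : c m = \sum_p (a p)^* * U m p.
Proof.
have rows := unitary_rows (gap_columns D).
rewrite (eq_bigr (fun p => \sum_q c q * (U m p * (U q p)^*))); last first.
  move=> p _; rewrite (gap_expansion D) rmorph_sum mulr_suml; apply: eq_bigr => q _.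
  by rewrite rmorphM /= conjCK -mulrA; congr (_ * _); rewrite mulrC.
rewrite exchange_big /= (bigD1 m)//= -mulr_sumr rows eqxx mulr1 big1 ?addr0// => q qm.
by rewrite -mulr_sumr rows eq_sym (negbTE qm) mulr0.
Qed.

(** The commutator gives c_m a_m = 0. If one factor vanishes, its row or column of [U] vanishes off
    the diagonal, and its own expansion along that row or column has a single term, the conjugate of
    the other factor times U_mm, which must then be 0. *)
Lemma gap_degenerate m : lam m = mu m -> a m = 0 /\ c m = 0.
Proof.
move=> e; have U0 : U m m != 0 by rewrite gt_eqF// (gap_gauge D).
have : c m * a m = 0 by rewrite -LM e subrr mul0r.
move/eqP; rewrite mulf_eq0 => /orP[/eqP c0|/eqP a0]; split => //.
  have := gap_expansion_row m; rewrite c0 (bigD1 m)//= big1 ?addr0.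
    by move/esym/eqP; rewrite mulf_eq0 (negbTE U0) orbF conjC_eq0 => /eqP.
  by move=> p pm; rewrite Uoff// c0 !mul0r mulr0.
have := gap_expansion D m; rewrite a0 (bigD1 m)//= big1 ?addr0.
  by move/esym/eqP; rewrite mulf_eq0 (negbTE U0) orbF conjC_eq0 => /eqP.
by move=> p pm; rewrite Uoff; [rewrite a0 mulr0 mul0r mulr0|rewrite eq_sym].
Qed.

(** This is where the gauge acts: the phase of [c m] must be opposite to that of [a m]. *)
Lemma gap_nondegenerate m : lam m != mu m -> 0 < c m * a m.
Proof.
move=> e; rewrite -LM mulr_gt0 ?(gap_gauge D)// ltcR.
by rewrite subr_gt0 lt_neqAle eq_sym e mu_lam.
Qed.

(** Substituting U_mp = c_m a_p / (lam_p - mu_m) in the expansion of a_p and dividing by a_p gives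
    the secular equation with |c_m|^2 as residues; at a degenerate [p] both polynomials vanish.
    Agreement at the N + 1 points lam_p determines the residues. *)
Lemma gap_normsq m : sqnorm (c m) = residue m.
Proof.
move: m; apply: (@residue_unique (fun m => sqnorm (c m))) => p.
rewrite residue_interpolation residue_poly_lam.
have [e|ne] := eqVneq (lam p) (mu p).
  rewrite [RHS](bigD1 p)//= e subrr mul0r big1// => m _.
  have [->|mp] := eqVneq m p.
    by rewrite (gap_degenerate e).2 /sqnorm /= expr0n addr0 mul0r.
  rewrite (bigD1 p)/=; last by rewrite eq_sym.
  by rewrite subrr mul0r mulr0.
have d q : lam p - mu q != 0.
  have [e|h] := eqVneq p q; first by rewrite -e subr_eq0.
  by apply: lam_sub_mu_neq0; apply: contra_neq h => /val_inj.
have ap : a p != 0 by have := gap_nondegenerate ne; apply: contraTneq => ->; rewrite mulr0 ltxx.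
have S : \sum_m sqnorm (c m) / (lam p - mu m) = 1.
  apply: (@complexI R); rewrite rmorph_sum /= rmorph1; apply: (mulIf ap).
  rewrite mul1r [RHS](gap_expansion D) mulr_suml; apply: eq_bigr => m _.
  rewrite rmorphM /= fmorphV /=.
  rewrite Uform//.
  have -> : (sqnorm (c m))%:C = (c m)^* * c m by rewrite mulrC -normCK -add_Re2_Im2.
  by rewrite !mulrA [LHS]mulrAC.
have P0 : \prod_(q : I) (lam p - mu q) != 0 by apply/prodf_neq0.
rewrite -[RHS]mul1r -S mulr_suml; apply: eq_bigr => m _.
by rewrite [X in _ / _ * X](bigD1 m)//= mulrA divfK.
Qed.

(** Normalisation of column [p] of [U], which determines |a_p|. *)
Lemma gap_col_norm p : lam p != mu p ->
  sqnorm (a p) * \sum_m residue m / (lam p - mu m) ^+ 2 = 1.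
Proof.
move=> ne.
have d q : lam p - mu q != 0.
  have [e|h] := eqVneq p q; first by rewrite -e subr_eq0.
  by apply: lam_sub_mu_neq0; apply: contra_neq h => /val_inj.
apply: (@complexI R); rewrite rmorph1 rmorphM rmorph_sum /= mulr_sumr.
have := gap_columns D p p; rewrite eqxx mulr1n => <-; apply: eq_bigr => m _.
rewrite Uform//.
rewrite -gap_normsq.
have E z : (sqnorm z)%:C = z * z^* :> C by rewrite -normCK -add_Re2_Im2.
rewrite rmorphM fmorphV rmorphXn /= !E !rmorphM /= fmorphV /= (_ : _%:C^* = (lam p - mu m)%:C).
  by field; rewrite -rmorphB /= real_complex_eq0.
exact: conjc_real.
Qed.

Lemma gap_U_degenerate m p : lam m = mu m -> U m p = (m == p)%:R /\ U p m = (m == p)%:R.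
Proof.
move=> e; have [a0 c0] := gap_degenerate e.
have [<-|mp] := eqVneq m p; last first.
  have pm : p != m by rewrite eq_sym.
  by rewrite (Uoff pm) (Uoff mp) a0 c0 mulr0 !mul0r.
suff -> : U m m = 1 by [].
have := gap_columns D m m; rewrite eqxx (bigD1 m)//= big1 ?addr0.
  move=> /eqP; rewrite mulrC -normCK (gtr0_norm (gap_gauge D m)) sqrp_eq1 ?ltW ?(gap_gauge D)//.
  by move/eqP.
by move=> q qm; rewrite [U q m]Uoff; [rewrite a0 mulr0 mul0r mulr0|rewrite eq_sym].
Qed.

End Given.

Lemma pos_phase (z w : C) : 0 < z * w -> z = `|z| * (phase w)^*.
Proof.
move=> h; have w0 : w != 0 by apply: contraTneq h => ->; rewrite mulr0 ltxx.
have nw : `|w| != 0 by rewrite normr_eq0.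
have e : `|z| * `|w| = z * w by rewrite -normrM gtr0_norm.
apply: (mulIf w0); rewrite -e /phase rmorphM /= fmorphV /= (_ : `|w|^* = `|w|); last first.
  by apply/CrealP; exact: normr_real.
rewrite -!mulrA; congr (_ * _).
by rewrite mulrCA [w^* * w]mulrC -normCK expr2 mulKf.
Qed.

Lemma phase_norm (z : C) : z = `|z| * phase z.
Proof.
have [->|z0] := eqVneq z 0; first by rewrite normr0 mul0r.
by rewrite /phase mulrCA divff ?mulr1// normr_eq0.
Qed.

Lemma norm_sqnorm (z : C) : `|z| = (Num.sqrt (sqnorm z))%:C.
Proof. by rewrite normc_def. Qed.

(** The moduli of [c] and [a] are functions of [lam] and [mu], the phases of [c] follow from those
    of [a], and the commutator then gives [U] except at degenerate diagonal entries, where unitarity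
    and the gauge give 1. *)
Lemma gap_data_unique U a c U' a' c' : gap_data U a c -> gap_data U' a' c' ->
  (forall m, lam m != mu m -> phase (a m) = phase (a' m)) ->
  (forall m p, U m p = U' m p) /\ a =1 a'.
Proof.
move=> D D' ph.
have ec m : c m = c' m.
  have [e|ne] := eqVneq (lam m) (mu m).
    by rewrite (gap_degenerate D e).2 (gap_degenerate D' e).2.
  rewrite (pos_phase (gap_nondegenerate D ne)) (pos_phase (gap_nondegenerate D' ne)).
  by rewrite !norm_sqnorm (gap_normsq D) (gap_normsq D') ph.
have ea p : a p = a' p.
  have [e|ne] := eqVneq (lam p) (mu p).
    by rewrite (gap_degenerate D e).1 (gap_degenerate D' e).1.
  rewrite [LHS]phase_norm [RHS]phase_norm ph// !norm_sqnorm; congr ((Num.sqrt _)%:C * _).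
  have h := gap_col_norm D ne; have h' := gap_col_norm D' ne.
  have s0 : \sum_m residue m / (lam p - mu m) ^+ 2 != 0.
    by apply: contra_eq_neq h => ->; rewrite mulr0 eq_sym oner_eq0.
  by apply: (mulIf s0); rewrite h h'.
split=> // m p.
have [d|d] := eqVneq (lam p - mu m) 0; last first.
  have d' : (lam p - mu m)%:C != 0 by rewrite real_complex_eq0.
  by apply: (mulfI d'); rewrite (gap_commutator D) (gap_commutator D') ec ea.
have e : p = m.
  apply/eqP; apply: contra_eqT d => pm; apply: lam_sub_mu_neq0.
  by apply: contra_neq pm => /val_inj.
have e' : lam p = mu p by move/eqP: d; rewrite subr_eq0 -e => /eqP.
by rewrite (gap_U_degenerate D m e').2 (gap_U_degenerate D' m e').2.
Qed.

Lemma gap_data_exists (w : I -> C) : (forall m, lam m != mu m -> `|w m| = 1) ->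
  exists U a c, gap_data U a c /\ forall m, lam m != mu m -> phase (a m) = w m.
Proof.
move=> w1.
pose c m : C := (Num.sqrt (residue m))%:C * (w m)^*.
(* The squared norm of the column c_m / (lam_p - mu_m), so that dividing by its root normalises
   column [p] of [U]. *)
pose nrm p : R := \sum_m residue m / (lam p - mu m) ^+ 2.
pose a p : C := if lam p == mu p then 0 else w p / (Num.sqrt (nrm p))%:C.
(* At a degenerate [p] the column is that of the identity; row [p] agrees with it because [c p] is
   0. *)
pose U m p : C := if lam p == mu p then (m == p)%:R else c m * a p / (lam p - mu m)%:C.
have d p q : lam p != mu p -> lam p - mu q != 0.
  move=> ne; have [e|h] := eqVneq p q; first by rewrite -e subr_eq0.
  by apply: lam_sub_mu_neq0; apply: contra_neq h => /val_inj.
have c0 m : lam m = mu m -> c m = 0.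
  by move=> e; rewrite /c (_ : residue m = 0) ?sqrtr0 ?mul0r//; apply/eqP; rewrite residue_eq0 e.
have cc m : (c m)^* * c m = (residue m)%:C.
  have [e|ne] := eqVneq (lam m) (mu m).
    rewrite c0// mulr0 (_ : residue m = 0)//; apply/eqP; rewrite residue_eq0 e//.
  rewrite mulrC -normCK /c normrM norm_conjC w1// mulr1 norm_sqnorm /sqnorm /= expr0n addr0.
  by rewrite sqrtr_sqr ger0_norm ?sqrtr_ge0// -rmorphXn sqr_sqrtr// residue_ge0.
have rp p : lam p != mu p -> 0 < residue p.
  by move=> ne; rewrite lt_neqAle residue_ge0 eq_sym residue_eq0 ne.
have np p : lam p != mu p -> 0 < nrm p.
  move=> ne; rewrite /nrm (bigD1 p)//= ltr_pwDl//.
    by rewrite divr_gt0 ?rp// exprn_even_gt0//= d.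
  by apply: sumr_ge0 => q _; rewrite divr_ge0 ?residue_ge0// sqr_ge0.
have aa p : lam p != mu p -> (a p)^* * a p * (nrm p)%:C = 1.
  move=> ne.
  rewrite [X in X * _]mulrC -normCK /a (negbTE ne) normrM normfV w1// mul1r norm_sqnorm.
  rewrite /sqnorm /= expr0n addr0 sqrtr_sqr ger0_norm ?sqrtr_ge0// exprVn -rmorphXn.
  by rewrite sqr_sqrtr ?(ltW (np _ ne))// mulVf// real_complex_eq0 gt_eqF// np.
have conjr (x : R) : (x%:C)^* = x%:C :> C by exact: conjc_real.
exists U, a, c; split; first split.
- move=> p q; rewrite /U.
  have [ep|np'] := eqVneq (lam p) (mu p).
    rewrite (bigD1 p)//= big1 ?addr0; last by move=> m /negbTE ->; rewrite conjC0 mul0r.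
    rewrite eqxx conjC1 mul1r; case: eqVneq => // nq.
    rewrite (c0 _ ep) !mul0r; case: eqVneq => // epq.
    by move: nq; rewrite -epq ep eqxx.
  have [eq|nq] := eqVneq (lam q) (mu q).
    rewrite (bigD1 q)//= big1 ?addr0; last by move=> m /negbTE ->; rewrite mulr0.
    rewrite eqxx mulr1 (c0 _ eq) !mul0r conjC0; case: eqVneq => // epq.
    by move: np'; rewrite epq eq eqxx.
  have T m : (c m * a p / (lam p - mu m)%:C)^* * (c m * a q / (lam q - mu m)%:C) =
      (a p)^* * a q * (residue m / ((lam p - mu m) * (lam q - mu m)))%:C.
    have e1 x : (c m * a p / x%:C)^* = (c m)^* * (a p)^* / x%:C.
      by rewrite rmorphM /= fmorphV /= rmorphM /= conjr.
    have e2 x y : (residue m / (x * y))%:C = (c m)^* * c m / (x%:C * y%:C).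
      by rewrite cc fmorph_div; congr (_ / _); exact: rmorphM.
    by rewrite e1 e2 invfM; ring.
  under eq_bigr do rewrite T; rewrite -mulr_sumr -rmorph_sum /=.
  have [<-|pq] := eqVneq p q.
    have -> : \sum_m residue m / ((lam p - mu m) * (lam p - mu m)) = nrm p.
      by rewrite /nrm; apply: eq_bigr => m _; rewrite expr2.
    by rewrite aa.
  have lpq : lam q - lam p != 0 by rewrite subr_eq0; apply: contra_neq pq => /lam_inj' /val_inj.
  suff -> : \sum_m residue m / ((lam p - mu m) * (lam q - mu m)) = 0 by rewrite mulr0.
  (* Partial fractions: the two secular sums are both 1, so distinct columns are orthogonal. *)
  rewrite (eq_bigr (fun m => (residue m / (lam p - mu m) - residue m / (lam q - mu m)) / (lam q - lam p))).
    by rewrite -mulr_suml sumrB !residue_sum// subrr mul0r.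
  by move=> m _; field; rewrite lpq !d.
- move=> m p; rewrite /U; have [e|ne] := eqVneq (lam p) (mu p).
    rewrite /a e eqxx mulr0; have [->|] := eqVneq m p; last by rewrite mulr0.
    by rewrite subrr mul0r.
  by rewrite mulrC divfK// real_complex_eq0 d.
- move=> p; rewrite /U; have [e|ne] := eqVneq (lam p) (mu p).
    rewrite (bigD1 p)//= eqxx mulr1 big1 ?addr0; last by move=> m /negbTE ->; rewrite mulr0.
    by rewrite c0// conjC0 /a e eqxx.
  transitivity (a p * (\sum_m residue m / (lam p - mu m))%:C); first by rewrite residue_sum// mulr1.
  rewrite rmorph_sum mulr_sumr /=; apply: eq_bigr => m _.
  by rewrite rmorphM /= -cc fmorphV /=; ring.
- move=> m; rewrite /U; have [e|ne] := eqVneq (lam m) (mu m); first by rewrite eqxx ltr01.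
  have -> : c m * a m = (Num.sqrt (residue m) / Num.sqrt (nrm m))%:C.
    have ww : (w m)^* * w m = 1 by rewrite mulrC -normCK w1// expr1n.
    rewrite /c /a (negbTE ne) mulrA -[_ * w m]mulrA ww mulr1.
    by rewrite -fmorphV -rmorphM.
  rewrite divr_gt0// ltcR; last by rewrite subr_gt0 lt_neqAle eq_sym ne mu_lam.
  by rewrite divr_gt0 ?sqrtr_gt0 ?rp ?np.
move=> m ne; rewrite /phase /a (negbTE ne) normrM normfV w1// mul1r norm_sqnorm.
rewrite /sqnorm /= expr0n addr0 sqrtr_sqr ger0_norm ?sqrtr_ge0// invrK divfK//.
by rewrite real_complex_eq0 gt_eqF// sqrtr_gt0 np.
Qed.

End GapData.

(** * Finite Blaschke products and their model spaces *)

Section Blaschke.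
Variable R : realType.
Local Notation C := R[i].
Opaque fourier inner circle_mean lax_form.
Implicit Types (f g h u : R -> C) (c : C).

Lemma iter_shift k f : iter k (@Defs.shift R) f = ek k%:Z * f.
Proof.
elim: k => [|k IH]; first by rewrite ek0 mul1r.
by rewrite iterS IH shiftE mulrA -ekD.
Qed.

Lemma nice_sqi f : nice f -> square_integrable f.
Proof. by case=> /smooth_sqi. Qed.

Lemma niceD f g : nice f -> nice g -> nice (f + g).
Proof. by move=> [? ?] [? ?]; split; [exact: smoothD|exact: boundedD]. Qed.

Lemma niceZ c f : nice f -> nice (c *: f).
Proof.
by move=> [? ?]; split; [exact: smoothZ|apply: (boundedM (bounded_cst c))].
Qed.

Lemma nice_shift f : nice f -> nice (ek 1 * f).
Proof. by move=> [? ?]; split; [exact: smooth_shift|apply: boundedM => //; exact: ek_bounded]. Qed.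

Lemma nice_ek (k : nat) : nice (@ek R k%:Z).
Proof. by split; [exact: smooth_ek|exact: ek_bounded]. Qed.

Lemma nice1 : nice (1 : R -> C).
Proof. by rewrite -ek0; exact: (nice_ek 0). Qed.

Lemma nice_ekM (k : nat) f : nice f -> nice (ek k%:Z * f).
Proof.
move=> nf; elim: k => [|k IH]; first by rewrite ek0 mul1r.
by rewrite -addn1 PoszD addrC ekD -mulrA; exact: nice_shift.
Qed.

Lemma nice_sum (I : Type) (s : seq I) (P : pred I) (F : I -> R -> C) :
  (forall i, P i -> nice (F i)) -> nice (\sum_(i <- s | P i) F i).
Proof.
move=> hF; elim/big_ind : _ => //; last exact: niceD.
by rewrite -(scale0r (@ek R 0)); apply: niceZ; exact: (nice_ek 0).
Qed.

(** 1 / (1 - p e^{ix}) as a power series, so that its niceness is immediate; the closed form is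
    [inv_factorE]. *)
Definition inv_factor (p : C) : R -> C := synth (fun k => p ^+ k).

Lemma geo_pow (p : C) : `|p| < 1 -> geo (fun k => p ^+ k).
Proof.
by move=> p1; exists 1, `|p|; split; rewrite ?ler01 ?normr_ge0// => k; rewrite normrX mul1r.
Qed.

(** Used as a limiting argument: a quantity independent of n that can be rewritten, for each n, as
    the n-th term of a geometrically decaying sequence is zero. *)
Lemma geo_cst_eq0 (z : C) : geo (fun=> z) -> z = 0.
Proof.
move=> /geoR[K [r [K0 r01 H]]].
apply: cplx_eq; apply: (@geo_small_eq0 _ _ K r 0) => // n _; have [] := H n 1 (normr1 _);
  by rewrite mulr1.
Qed.

Lemma geo_remainder a x : geo a -> geo (fun n => synth a x - trig_sum a n x : C).
Proof.
move=> /synth_approx[K [r [K0 /andP[r0 r1] H]]].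
exists (2 * K)%:C, r%:C; split.
- by rewrite ler0c mulr_ge0.
- by rewrite ler0c r0 ltcR.
move=> n; apply: le_trans (norm_le_ReIm _) _; rewrite -rmorphXn -rmorphM lecR.
by have [h1 h2] := H n x; rewrite -mulrA mulr_natl mulr2n lerD.
Qed.

(** The identity holds at every point, as required by [blaschke], which is an equality of functions
    and not of classes. *)
Lemma inv_factorE (p : C) : `|p| < 1 -> (1 - p *: ek 1) * inv_factor p = 1.
Proof.
move=> p1; apply/funext => x.
set z := @ek R 1 x; have z1 : `|z| = 1 by exact: norm_ek.
change ((1 - p * z) * inv_factor p x = 1).
apply/eqP; rewrite -subr_eq0; apply/eqP; apply: geo_cst_eq0.
have g1 := geoZ (1 - p * z) (geo_remainder x (geo_pow p1)).
have g2 : geo (fun n => - (p * z) ^+ n).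
  exists 1, `|p|; split; rewrite ?ler01 ?normr_ge0// => k.
  by rewrite normrN normrX normrM z1 mulr1 mul1r.
apply: (eq_geo _ (geoD g1 g2)) => n.
rewrite trig_sumE /inv_factor.
have -> : \sum_(k < n) p ^+ k * ek k%:Z x = \sum_(k < n) (p * z) ^+ k.
  apply: eq_bigr => k _; rewrite exprMn; congr (_ * _).
  rewrite /z; elim: (k : nat) => [|j IH]; first by rewrite ek0.
  by rewrite exprS -IH -addn1 PoszD addrC ekD.
have := subrX1 (p * z) n; set S := \sum_(k < n) _ => e.
have {}e : (1 - p * z) * S = 1 - (p * z) ^+ n by rewrite -opprB mulNr -e opprB.
by rewrite mulrBr e; ring.
Qed.

Lemma inv_factor_nice (p : C) : `|p| < 1 -> nice (inv_factor p).
Proof. by move=> p1; apply/nice_synth/geo_pow. Qed.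

Lemma fourier_sub_scale (p : C) g k : square_integrable g ->
  fourier ((1 - p *: ek 1) * g) k = fourier g k - p * fourier g (k - 1).
Proof.
move=> sg; have -> : (1 - p *: ek 1) * g = g - p *: (ek 1 * g).
  apply/funext => x; change ((1 - p * ek 1 x) * g x = g x - p * (ek 1 x * g x)); ring.
have s1 := ek_mul_sqi 1 sg.
by rewrite (fourierB _ sg (sqiZ p s1)) (fourierZ _ _ s1) fourier_ekM.
Qed.

(** The coefficients h_k of the quotient of [g] by 1 - p e^{ix} satisfy h_{k+1} = p h_k + g_{k+1}, a
    stable recursion. *)
Lemma inv_factor_mul_nice (p : C) g : `|p| < 1 -> nice g -> nice (inv_factor p * g).
Proof.
move=> p1 ng; have ni := inv_factor_nice p1.
have hh : hardy (inv_factor p * g) by apply: nice_mul_hardy => //; case: ng.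
split; last by apply: boundedM; [case: ni|case: ng].
split => //.
have [[hg gg] _] := ng.
have gg1 : geo (fun k => fourier g k.+1%:Z).
  have [K [r [K0 /andP[r0 r1] H]]] := gg.
  exists K, r; split; rewrite ?r0// => k.
  apply: le_trans (H k.+1) _; rewrite exprS mulrCA ler_piMl ?(ltW r1)//.
  by rewrite mulr_ge0// exprn_ge0.
apply: (geo_recursion p1 gg1) => k.
have := fourier_sub_scale p k.+1%:Z (hardy_sqi hh).
have e : (1 - p *: ek 1) * (inv_factor p * g) = g by rewrite mulrA inv_factorE// mul1r.
have ek : k.+1%:Z - 1 = k%:Z by rewrite -addn1 PoszD addrK.
rewrite ek e => ->.
by rewrite addrC subrK.
Qed.

Lemma sub_scale_nice (p : C) g : nice g -> nice ((1 - p *: ek 1) * g).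
Proof.
move=> ng; have -> : (1 - p *: ek 1) * g = g + (- p) *: (ek 1 * g).
  apply/funext => x; change ((1 - p * ek 1 x) * g x = g x + - p * (ek 1 x * g x)); ring.
by apply: niceD => //; apply: niceZ; exact: nice_shift.
Qed.

Lemma shift_sub_nice c g : nice g -> nice ((ek 1 - cst c) * g).
Proof.
move=> ng; have -> : (ek 1 - cst c) * g = ek 1 * g + (- c) *: g.
  apply/funext => x; change ((ek 1 x - c) * g x = ek 1 x * g x + - c * g x); ring.
by apply: niceD; [exact: nice_shift|exact: niceZ].
Qed.

Section Product.
Variables (N : nat) (p : 'I_N -> C).
Hypothesis p1 : forall k, `|p k| < 1.

Definition bl_den : R -> C := \prod_(k < N) (1 - p k *: ek 1).
Definition bl_num : R -> C := \prod_(k < N) (ek 1 - cst (p k)^*).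
Definition bl_iden : R -> C := \prod_(k < N) inv_factor (p k).
Definition bl_psi : R -> C := bl_num * bl_iden.

Lemma bl_den_iden : bl_den * bl_iden = 1.
Proof.
by rewrite /bl_den /bl_iden -big_split /= big1// => k _; rewrite inv_factorE.
Qed.

(** On the circle the numerator is the reversed polynomial of the denominator, as e^{ix} - conj(p) =
    e^{ix} conj(1 - p e^{ix}); unimodularity and the description of the model space rest on this. *)
Lemma bl_numE : bl_num = ek N%:Z * cj bl_den.
Proof.
rewrite /bl_num /bl_den.
have -> : cj (\prod_(k < N) (1 - p k *: ek 1)) = \prod_(k < N) cj (1 - p k *: ek 1).
  apply: (big_morph _ (@cjM R)); apply/funext => x; exact: conjC1.
have -> : @ek R N%:Z = \prod_(k < N) ek 1.
  rewrite prodr_const card_ord; elim: N => [|n IH]; first by rewrite ek0.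
  by rewrite exprS -IH -addn1 PoszD addrC ekD.
rewrite -big_split /=; apply: eq_bigr => k _; apply/funext => x.
change (ek 1 x - (p k)^* = ek 1 x * (1 - p k * ek 1 x)^*).
rewrite rmorphB rmorph1 rmorphM /= mulrBr mulr1; congr (_ - _).
rewrite mulrCA; have -> : ek 1 x * (ek 1 x)^* = 1 by exact: expiK.
by rewrite mulr1.
Qed.

Lemma prod_den_nice (s : seq 'I_N) g : nice g -> nice (\prod_(k <- s) (1 - p k *: ek 1) * g).
Proof.
move=> ng; elim: s => [|k s IH]; first by rewrite big_nil mul1r.
by rewrite big_cons -mulrA; exact: sub_scale_nice.
Qed.

Lemma bl_num_nice g : nice g -> nice (bl_num * g).
Proof.
move=> ng; rewrite /bl_num; elim: (index_enum _) => [|k s IH]; first by rewrite big_nil mul1r.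
by rewrite big_cons -mulrA; exact: shift_sub_nice.
Qed.

Lemma bl_iden_mul_nice g : nice g -> nice (bl_iden * g).
Proof.
move=> ng; rewrite /bl_iden; elim: (index_enum _) => [|k s IH]; first by rewrite big_nil mul1r.
by rewrite big_cons -mulrA; exact: inv_factor_mul_nice.
Qed.

Lemma bl_iden_nice : nice bl_iden.
Proof. by have := bl_iden_mul_nice nice1; rewrite mulr1. Qed.

Lemma bl_psi_nice : nice bl_psi.
Proof. exact: bl_num_nice bl_iden_nice. Qed.

Lemma bl_psi_unimodular : bl_psi * cj bl_psi = 1.
Proof.
have e := bl_den_iden; have e' := congr1 (@cj R) e.
have cj1 : cj 1 = 1 :> (R -> C) by apply/funext => x; exact: conjC1.
rewrite cjM cj1 in e'.
rewrite /bl_psi cjM bl_numE cjM cjK cj_ek.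
transitivity (ek N%:Z * ek (- N%:Z) * (bl_den * bl_iden) * (cj bl_den * cj bl_iden)); first by ring.
by rewrite e e' -ekD subrr ek0 !mulr1.
Qed.

Lemma bl_psiE theta : expi theta *: bl_psi = fun x => expi theta *
  \prod_(k < N) ((expi x - (p k)^*) / (1 - p k * expi x)).
Proof.
apply/funext => x.
change (expi theta * (bl_num x * bl_iden x) =
  expi theta * \prod_(k < N) ((expi x - (p k)^*) / (1 - p k * expi x))).
congr (_ * _); rewrite /bl_num /bl_iden !fct_prodE -big_split /=; apply: eq_bigr => k _.
have ex : @ek R 1 x = expi x by rewrite /ek mul1r.
congr (_ * _); first by rewrite -ex.
have := congr1 (fun f => f x) (inv_factorE (p1 k)).
change ((1 - p k * ek 1 x) * inv_factor (p k) x = 1 -> inv_factor (p k) x = (1 - p k * expi x)^-1).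
rewrite ex => e; have d0 : 1 - p k * expi x != 0.
  by apply: contra_eq_neq e => ->; rewrite mul0r eq_sym oner_eq0.
by apply: (mulfI d0); rewrite e divff.
Qed.

Lemma blaschke_bl_psi theta : blaschke N (expi theta *: bl_psi).
Proof. by exists theta, p => //; exact: bl_psiE. Qed.

Lemma inner_bl_psi_self : inner bl_psi bl_psi = 1.
Proof. by rewrite innerE bl_psi_unimodular circle_mean1. Qed.

End Product.

Lemma blaschkeP N (psi : R -> C) : blaschke N psi -> exists theta, exists2 p : 'I_N -> C,
  (forall k, `|p k| < 1) & psi = expi theta *: bl_psi p.
Proof.
move=> [theta [p p1 e]]; exists theta; exists p => //.
by rewrite e bl_psiE.
Qed.

End Blaschke.

(** * Model spaces of finite Blaschke products *)

Section ModelSpace.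
Variable R : realType.
Local Notation C := R[i].
Opaque fourier inner circle_mean lax_form.
Variables (N : nat) (p : 'I_N -> C).
Hypothesis p1 : forall k, `|p k| < 1.
Implicit Types (f g h u : R -> C).

(* Orthogonality to [bl_psi H^2]. *)
Definition in_model f := forall k : nat, inner f (ek k%:Z * bl_psi p) = 0.

Lemma hardy_sub_scale c g : hardy g -> hardy ((1 - c *: ek 1) * g).
Proof.
move=> hg; have -> : (1 - c *: ek 1) * g = g + (- c) *: (ek 1 * g).
  by apply/funext => x; change ((1 - c * ek 1 x) * g x = g x + - c * (ek 1 x * g x)); ring.
by apply: hardyD => //; apply: hardyZ; exact: hardy_shift.
Qed.

Lemma hardy_den_mul f : hardy f -> hardy (bl_den p * f).
Proof.
move=> hf; rewrite /bl_den; elim: (index_enum _) => [|k s IH]; first by rewrite big_nil mul1r.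
by rewrite big_cons -mulrA; exact: hardy_sub_scale.
Qed.

(** The denominator is a polynomial in e^{ix}, so multiplying by its factors stays within psi H^2;
    partial products carry the induction. *)
Lemma in_model_den f (s : seq 'I_N) (i : nat) : hardy f -> in_model f ->
  inner f (ek i%:Z * (\prod_(k <- s) (1 - p k *: ek 1) * bl_psi p)) = 0.
Proof.
move=> hf mf; have sf := hardy_sqi hf; elim: s i => [|k s IH] i; first by rewrite big_nil mul1r.
rewrite big_cons; pose h := \prod_(k <- s) (1 - p k *: ek 1) * bl_psi p.
have nh : nice h by apply: prod_den_nice; exact: bl_psi_nice.
have -> : ek i%:Z * ((1 - p k *: ek 1) * (\prod_(j <- s) (1 - p j *: ek 1)) * bl_psi p) =
    ek i%:Z * h + (- p k) *: (ek i.+1%:Z * h).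
  have -> : @ek R i.+1%:Z = ek i%:Z * ek 1 by rewrite -ekD -addn1 PoszD.
  rewrite -[in LHS]mulrA -/h; apply/funext => x.
  change (ek i%:Z x * ((1 - p k * ek 1 x) * h x) = ek i%:Z x * h x + - p k * (ek i%:Z x * ek 1 x * h x)).
  by ring.
have s1 := nice_sqi (nice_ekM i nh); have s2 := nice_sqi (nice_ekM i.+1 nh).
by rewrite (innerDr s1 (sqiZ _ s2) sf) (innerZr _ s2 sf) !IH mulr0 addr0.
Qed.

(** For j >= N, conj(den) e^{ijx} = e^{i(j-N)x} num = e^{i(j-N)x} den psi is orthogonal to [f].
    Hence den f is a polynomial of degree less than N, and the model space consists of such
    polynomials divided by den. *)
Lemma fourier_den_model f (j : nat) : hardy f -> in_model f -> (N <= j)%N ->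
  fourier (bl_den p * f) j%:Z = 0.
Proof.
move=> hf mf Nj; rewrite fourierE inner_bounded_mul -(subnK Nj) PoszD ekD.
have -> : cj (bl_den p) * (ek (j - N)%:Z * ek N%:Z) = ek (j - N)%:Z * (bl_den p * bl_psi p).
  rewrite mulrCA [cj _ * _]mulrC -(bl_numE p) /bl_psi; congr (_ * _).
  by rewrite mulrCA bl_den_iden ?mulr1.
exact: in_model_den.
Qed.

Lemma iden_den f : bl_iden p * (bl_den p * f) = f.
Proof. by rewrite mulrA [bl_iden p * _]mulrC bl_den_iden ?mul1r. Qed.

Lemma sum_delta n (b : nat -> C) (j : nat) :
  \sum_(i < n) b i * ((i : nat) == j)%:R = if (j < n)%N then b j else 0.
Proof.
have [jN|Nj] := ltnP j n.
  rewrite (bigD1 (Ordinal jN))//= eqxx mulr1 big1 ?addr0// => i ij.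
  by rewrite (_ : (i : nat) == j = false) ?mulr0//; apply: contraNF ij => /eqP e; apply/eqP/val_inj.
rewrite big1// => i _; case: eqP => [e|_]; last by rewrite mulr0.
by move: (ltn_ord i); rewrite e ltnNge Nj.
Qed.

Lemma model_ae f : hardy f -> in_model f ->
  ae_equal f (bl_iden p * trig_sum (fun j => fourier (bl_den p * f) j%:Z) N).
Proof.
move=> hf mf; have hd := hardy_den_mul hf; set a := fun j : nat => _.
have ga : geo (fun j => if (j < N)%N then a j else 0).
  by apply: (@geo_finite _ _ N) => j Nj; rewrite ltnNge Nj.
have : ae_equal (bl_den p * f) (trig_sum a N).
  have ht : hardy (trig_sum a N).
    by apply: hardy_sum => i _; apply: hardyZ; exact: hardy_ek.
  apply: (hardy_inj hd ht) => j.
  rewrite /trig_sum fourier_sum; last by move=> i _; apply: sqiZ; exact: ek_sqi.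
  rewrite (eq_bigr (fun i : 'I_N => a i * ((i : nat) == j)%:R)); last first.
    by move=> i _; rewrite fourierZ ?fourier_ek ?eqz_nat//; exact: ek_sqi.
  rewrite sum_delta; case: ltnP => // Nj; exact: fourier_den_model.
move=> h; have := ae_equalM (ae_equal_refl (bl_iden p)) h.
by rewrite iden_den.
Qed.

(** The source of regularity for a given potential and its unknown eigenfunctions: orthogonality to
    psi H^2 makes a Hardy function a quotient of polynomials without pole in the closed disc. *)
Lemma model_smooth f : hardy f -> in_model f -> smooth f.
Proof.
move=> hf mf; set a := fun j : nat => fourier (bl_den p * f) j%:Z.
have n1 : nice (bl_iden p * trig_sum a N).
  apply: bl_iden_mul_nice => //; apply: nice_sum => i _; apply: niceZ; exact: nice_ek.
exact: (smooth_ae_trans n1.1 (hardy_sqi hf) (ae_equal_sym (model_ae hf mf))).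
Qed.

Lemma model_eq0 f : hardy f -> in_model f ->
  (forall j : 'I_N, fourier (bl_den p * f) j%:Z = 0) -> ae_equal f (cst 0).
Proof.
move=> hf mf z; have := model_ae hf mf.
rewrite (_ : trig_sum _ _ = 0) ?mulr0//.
by apply: big1 => i _; rewrite z scale0r.
Qed.

Lemma in_model_sum (I : finType) (F : I -> R -> C) (v : I -> C) :
  (forall i, square_integrable (F i)) -> (forall i, in_model (F i)) ->
  in_model (\sum_i v i *: F i).
Proof.
move=> sF mF k; have sp := nice_sqi (nice_ekM k (bl_psi_nice p1)).
rewrite (inner_suml _ (fun i _ => sqiZ (v i) (sF i)) sp).
by apply: big1 => i _; rewrite (innerZl _ (sF i) sp) mF mulr0.
Qed.

Lemma fourier_den_sum (I : finType) (F : I -> R -> C) (v : I -> C) (j : nat) :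
  (forall i, hardy (F i)) ->
  fourier (bl_den p * \sum_i v i *: F i) j%:Z = \sum_i v i * fourier (bl_den p * F i) j%:Z.
Proof.
move=> hF; have sd i := hardy_sqi (hardy_den_mul (hF i)).
have -> : bl_den p * (\sum_i v i *: F i) = \sum_i v i *: (bl_den p * F i).
  rewrite mulr_sumr; apply: eq_bigr => i _; apply/funext => x.
  by change (bl_den p x * (v i * F i x) = v i * (bl_den p x * F i x)); ring.
rewrite (fourier_sum _ _ (fun i _ => sqiZ (v i) (sd i))).
by apply: eq_bigr => i _; rewrite (fourierZ _ _ (sd i)).
Qed.

(** Each function is encoded by the N coefficients of its product with the denominator, and N + 1
    vectors of length N are dependent. *)
Lemma model_dependent (F : 'I_N.+1 -> R -> C) : (forall i, hardy (F i)) ->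
  (forall i, in_model (F i)) ->
  exists2 v : 'I_N.+1 -> C, (exists i, v i != 0) & ae_equal (\sum_i v i *: F i) (cst 0).
Proof.
move=> hF mF.
pose A : 'M[C]_(N.+1, N) := \matrix_(i, j) fourier (bl_den p * F i) j%:Z.
have : kermx A != 0.
  by rewrite -mxrank_eq0 mxrank_ker subn_eq0 -ltnNge ltnS rank_leq_col.
move/rowV0Pn => [v /sub_kermxP vA /eqP vn0]; exists (v 0).
  apply: contra_notP vn0 => /forallNP vz; apply/rowP => i; rewrite mxE.
  by apply/eqP/negPn/negP/vz.
have sF i := hardy_sqi (hF i).
have hg : hardy (\sum_i v 0 i *: F i) by apply: hardy_sum => i _; exact: hardyZ.
apply: (model_eq0 hg); first exact: in_model_sum.
move=> j; rewrite fourier_den_sum//.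
have := congr1 (fun B : 'rV[C]_N => B 0 j) vA; rewrite !mxE => h; rewrite -[RHS]h.
by apply: eq_bigr => i _; rewrite mxE.
Qed.

Lemma model_dim_le (F : 'I_N.+1 -> R -> C) : (forall i, hardy (F i)) ->
  (forall i, in_model (F i)) -> (forall i j, inner (F i) (F j) = (i == j)%:R) -> False.
Proof.
move=> hF mF oF; have [v [i /eqP vi] g0] := model_dependent hF mF; apply: vi.
have sF j := hardy_sqi (hF j).
have sg : square_integrable (\sum_j v j *: F j) by apply: sqi_sum => j _; exact: sqiZ.
have : inner (\sum_j v j *: F j) (F i) = 0.
  rewrite (inner_ae sg (sqi0 R) (sF i) (sF i) g0 (ae_equal_refl _)).
  exact: inner0l.
rewrite (inner_suml _ (fun j _ => sqiZ (v j) (sF j)) (sF i)) (bigD1 i)//= big1 ?addr0.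
  by rewrite (innerZl _ (sF i) (sF i)) oF eqxx mulr1.
by move=> j ji; rewrite (innerZl _ (sF j) (sF i)) oF (negbTE ji) mulr0.
Qed.

(** For the functions e^{ijx} / den with j < N, the factor conj(num) = e^{-iNx} den cancels the
    denominator and leaves a coefficient of 1 / den at the negative frequency j - k - N. *)
Lemma in_model_basis (j : 'I_N) : in_model (ek j%:Z * bl_iden p).
Proof.
move=> k; have ni := bl_iden_nice p1.
rewrite innerE /bl_psi !cjM cj_ek bl_numE cjM cjK cj_ek.
have -> : ek j%:Z * bl_iden p * (ek (- k%:Z) * (ek (- N%:Z) * bl_den p * cj (bl_iden p))) =
   (bl_den p * bl_iden p) * ((ek j%:Z * ek (- k%:Z) * ek (- N%:Z)) * cj (bl_iden p)) by ring.
rewrite bl_den_iden// mul1r -!ekD -innerE inner_conj; [|exact: nice_sqi|exact: ek_sqi].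
rewrite -fourierE (ni.1.1.2) ?conjC0//.
by rewrite -addrA -opprD -PoszD subr_lt0 ltz_nat (leq_trans (ltn_ord j))// leq_addl.
Qed.

(** Fewer linear conditions than the N independent functions of [in_model_basis] leave a nonzero
    solution. *)
Lemma model_dim_ge r (F : 'I_r -> R -> C) : (r < N)%N -> (forall i, square_integrable (F i)) ->
  exists g, [/\ nice g, in_model g, forall i, inner g (F i) = 0 & ~ ae_equal g (cst 0)].
Proof.
move=> rN sF; have ni := bl_iden_nice p1.
pose b (j : 'I_N) := ek j%:Z * bl_iden p.
have nb j : nice (b j) by exact: nice_ekM.
have sb j := nice_sqi (nb j).
pose A : 'M[C]_(N, r) := \matrix_(j, i) inner (b j) (F i).
have : kermx A != 0.
  by rewrite -mxrank_eq0 mxrank_ker subn_eq0 -ltnNge (leq_ltn_trans (rank_leq_col _)).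
move/rowV0Pn => [v /sub_kermxP vA vn0].
exists (\sum_j v 0 j *: b j); split.
- by apply: nice_sum => j _; exact: niceZ.
- by apply: in_model_sum => // j; exact: in_model_basis.
- move=> i; rewrite (inner_suml _ (fun j _ => sqiZ (v 0 j) (sb j)) (sF i)).
  have := congr1 (fun B : 'rV[C]_r => B 0 i) vA; rewrite !mxE => h; rewrite -[RHS]h.
  by apply: eq_bigr => j _; rewrite (innerZl _ (sb j) (sF i)) mxE.
- move=> g0; case/eqP: vn0; apply/rowP => j; rewrite mxE.
  have hb i : hardy (b i) by case: (nb i) => -[].
  have := fourier_den_sum (fun i => v 0 i) j hb.
  have hg : hardy (\sum_j v 0 j *: b j) by apply: hardy_sum => i _; exact: hardyZ.
  have sz : square_integrable (bl_den p * (cst 0 : R -> C)).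
    by rewrite (_ : _ * _ = 0) ?mulr0//; exact: sqi0.
  rewrite (fourier_ae _ (hardy_sqi (hardy_den_mul hg)) sz (ae_equalM (ae_equal_refl _) g0)).
  rewrite (_ : bl_den p * cst 0 = 0) ?mulr0// fourierE inner0l => ->.
  rewrite (bigD1 j)//= [X in _ = _ + X]big1 ?addr0.
    by rewrite /b mulrCA bl_den_iden// mulr1 fourier_ek eqxx mulr1.
  move=> i ij; rewrite /b mulrCA bl_den_iden// mulr1 fourier_ek eqz_nat.
  by rewrite (_ : (i : nat) == j = false) ?mulr0//; apply: contraNF ij => /eqP e; apply/eqP/val_inj.
Qed.

End ModelSpace.

(** * Construction of a potential from spectral data *)

Section StableRecursion.
Variable R : realType.
Local Notation C := R[i].
Opaque fourier inner circle_mean lax_form.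

Lemma geoM (a b : nat -> C) : geo a -> geo b -> geo (fun k => a k * b k).
Proof.
move=> [K [r [K0 /andP[r0 r1] H]]] [K' [r' [K0' /andP[r0' r1'] H']]].
exists (K * K'), (r * r'); split; first exact: mulr_ge0.
  by rewrite mulr_ge0// (le_lt_trans (ler_piMr r0 (ltW r1')) r1).
by move=> k; rewrite normrM exprMn mulrACA ler_pM.
Qed.

Lemma geoJ (a : nat -> C) : geo a -> geo (fun k => (a k)^*).
Proof. by move=> [K [r [K0 r01 H]]]; exists K, r; split => // k; rewrite norm_conjC. Qed.

Lemma geo_sum (I : Type) (s : seq I) (P : pred I) (F : I -> nat -> C) :
  (forall i, P i -> geo (F i)) -> geo (fun k => \sum_(i <- s | P i) F i k).
Proof.
move=> gF; elim: s => [|i s IH].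
  by apply: (eq_geo _ (geo_cst0 R)) => k; rewrite big_nil.
have [Pi|Pi] := boolP (P i).
  by apply: (eq_geo _ (geoD (gF i Pi) IH)) => k; rewrite big_cons Pi.
by apply: (eq_geo _ IH) => k; rewrite big_cons (negbTE Pi).
Qed.

(** The factor E - z of a linear recurrence, E being the forward shift of sequences; folding it over
    the roots applies the characteristic polynomial. *)
Definition root_step (x : nat -> C) (z : C) : nat -> C := fun k => x k.+1 - z * x k.

Lemma geo_root_steps (s : seq C) (x : nat -> C) : (forall z, z \in s -> `|z| < 1) ->
  (forall k, foldl root_step x s k = 0) -> geo x.
Proof.
elim: s x => [|z s IH] x s1 /= h; first by apply: (eq_geo _ (geo_cst0 R)) => k; rewrite h.
apply: (@geo_recursion _ _ (root_step x z) z); first by apply: s1; rewrite inE eqxx.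
  by apply: IH h => w ws; apply: s1; rewrite inE ws orbT.
by move=> k; rewrite /root_step addrC subrK.
Qed.

(** Each coordinate of an orbit of [T] is annihilated by the characteristic polynomial. The roots
    are returned as a tuple of exactly N elements since they become the zeros of a Blaschke product
    of degree N. *)
Lemma cayley_hamilton_recursion N (T : 'M[C]_N) :
  (forall z (v : 'rV[C]_N), v *m T = z *: v -> v != 0 -> `|z| < 1) ->
  exists s : N.-tuple C, (forall z, z \in s -> `|z| < 1) /\
  forall (x : nat -> 'cV[C]_N) i, (forall k, x k.+1 = T *m x k) ->
    forall k, foldl root_step (fun k => x k i 0) s k = 0.
Proof.
case: N T => [|n] T eT; first by exists [tuple]; split => // x [].
have [r rE] := closed_field_poly_normal (char_poly T).
rewrite (monicP (char_poly_monic T)) scale1r in rE.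
have sr : size r == n.+1.
  by have := size_char_poly T; rewrite rE size_prod_XsubC => -[->].
exists (Tuple sr); split => [z zr|x i xT k] /=.
  have : root (char_poly T) z by rewrite rE root_prod_XsubC.
  by rewrite -eigenvalue_root_char => /eigenvalueP[v]; exact: eT.
(* [B] accumulates the factors T - z already applied, all of which commute with [T]. *)
have H (s : seq C) (B : 'M[C]_n.+1) k' : comm_mx T B ->
    foldl root_step (fun k => (B *m x k) i 0) s k' =
    ((horner_mx T (\prod_(z <- s) ('X - z%:P)) * B) *m x k') i 0.
  elim: s B k' => [|z s IH] B k' cB; first by rewrite big_nil rmorph1 mul1r.
  rewrite /= big_cons.
  have e : root_step (fun k => (B *m x k) i 0) z = (fun k => ((B *m (T - z%:M)) *m x k) i 0).
    apply/funext => j; rewrite /root_step xT.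
    have -> : B *m (T - z%:M) *m x j = B *m (T *m x j) - z *: (B *m x j).
      by rewrite mulmxBr mulmxBl mulmxA mul_mx_scalar -scalemxAl.
    by move: (B *m (T *m x j)) (B *m x j) => P Q; rewrite !mxE.
  have cTz : comm_mx T (T - z%:M) by apply: comm_mxB; [exact: comm_mx_refl|exact: comm_mx_scalar].
  have cBz : comm_mx B (T - z%:M).
    by apply: comm_mxB; [exact: comm_mx_sym|exact: comm_mx_scalar].
  rewrite e IH; last exact: comm_mxM.
  rewrite [('X - _) * _]mulrC rmorphM; congr ((_ *m _) i 0).
  by rewrite rmorphB /= horner_mx_X horner_mx_C -[RHS]mulrA; congr (_ * _).
have := H r 1%:M k (comm_mx1 T); rewrite -rE Cayley_Hamilton mul0r mul0mx mxE => <-.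
by congr (foldl _ _ _ _); apply/funext => j; rewrite mul1mx.
Qed.

(** The adjoint of multiplication by e^{ix} - conj(z) is the backward shift minus z; on coefficients
    this is [root_step], and the frequency -1 created on the way is not seen by the Hardy function
    [g]. *)
Lemma inner_synth_root (x : nat -> C) (z : C) (g : R -> C) : geo x -> geo (root_step x z) -> nice g ->
  inner (synth x) ((ek 1 - cst z^*) * g) = inner (synth (root_step x z)) g.
Proof.
move=> gx gy ng; have sx := synth_sqi gx; have sy := synth_sqi gy; have sg := nice_sqi ng.
have se := ek_mul_sqi (-1) sx.
have -> : (ek 1 - cst z^*) * g = ek 1 * g - z^* *: g.
  by apply/funext => t; change ((ek 1 t - z^*) * g t = ek 1 t * g t - z^* * g t); ring.
rewrite (innerBr (ek_mul_sqi 1 sg) (sqiZ _ sg) sx) (innerZr _ sg sx) conjCK.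
have -> : inner (synth x) (ek 1 * g) = inner (ek (-1) * synth x) g.
  by rewrite inner_bounded_mul cj_ek opprK.
rewrite -(innerZl _ sx sg) -(innerBl se (sqiZ z sx) sg).
have sd := sqiB se (sqiZ z sx); have sdd := sqiB sd sy.
apply/eqP; rewrite -subr_eq0 -(innerBl sd sy sg) (inner_conj sg sdd).
rewrite (inner_smooth0 ng.1 sdd) ?conjC0//.
move=> k; rewrite (fourierB _ sd sy) (fourierB _ se (sqiZ z sx)) (fourierZ _ _ sx).
rewrite fourier_ekM opprK -PoszD addn1 !fourier_synth// /root_step subrr conjC0 mulr0//.
Qed.

(** This turns a recurrence into orthogonality: a function whose coefficients satisfy the recurrence
    with roots z is orthogonal to the multiples of prod (e^{ix} - conj(z)), the numerator of a
    Blaschke product. *)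
Lemma inner_synth_roots (s : seq C) (x : nat -> C) (g : R -> C) :
  (forall z, z \in s -> `|z| < 1) -> (forall k, foldl root_step x s k = 0) -> nice g ->
  inner (synth x) (\prod_(z <- s) (ek 1 - cst z^*) * g) = 0.
Proof.
move=> s1; elim: s x s1 => [|z s IH] x s1 /= h ng.
  rewrite big_nil mul1r (_ : synth x = synth (fun=> 0)).
    by apply: inner_synth0; [exact: geo_cst0|exact: nice_sqi|move=> k; rewrite mul0r].
  by congr synth; apply/funext.
have s2 w : w \in s -> `|w| < 1 by move=> ws; apply: s1; rewrite inE ws orbT.
have gy : geo (root_step x z) by exact: geo_root_steps h.
have gx : geo x by exact: (@geo_root_steps (z :: s)).
rewrite big_cons -mulrA inner_synth_root//; first exact: IH.
elim: (s) => [|w t IHt]; first by rewrite big_nil mul1r.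
by rewrite big_cons -mulrA; exact: shift_sub_nice.
Qed.

End StableRecursion.

(** * The quadratic form in the two bases *)

Section QuadraticForm.
Variable R : realType.
Local Notation C := R[i].
Variables (N : nat) (lam mu : nat -> R).
Local Notation I := 'I_N.+1.
Variables (U : I -> I -> C) (a c : I -> C).
Hypotheses (Ucol : forall p q, \sum_m (U m p)^* * U m q = (p == q)%:R)
  (Ucom : forall m p : I, (lam p - mu m)%:C * U m p = c m * a p)
  (Uexp : forall p, a p = \sum_m (c m)^* * U m p).

(** If V are the coordinates of f in the basis f_p, then W are its coordinates in the vectors S
    f_(m-1). Both sides are the energy <L f | f>: diagonal in the first basis, diagonal plus the
    nonnegative term |<f | u>|^2 in the second. *)
Lemma quad_form (V : I -> C) : let W m := \sum_p (U m p)^* * V p in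
  \sum_(p : I) (lam p)%:C * (V p * (V p)^*) =
  \sum_(m : I) (mu m)%:C * (W m * (W m)^*) + (\sum_m c m * W m) * (\sum_m c m * W m)^*.
Proof.
move=> W.
have VW p : V p = \sum_m U m p * W m.
  rewrite /W (eq_bigr (fun m => \sum_q (V q * ((U m q)^* * U m p)))); last first.
    by move=> m _; rewrite mulr_sumr; apply: eq_bigr => q _; ring.
  rewrite exchange_big /= (bigD1 p)//= -mulr_sumr Ucol eqxx mulr1 big1 ?addr0// => q qp.
  by rewrite -mulr_sumr Ucol (negbTE qp) mulr0.
have WJ m : \sum_p U m p * (V p)^* = (W m)^*.
  by rewrite rmorph_sum; apply: eq_bigr => p _; rewrite rmorphM /= conjCK.
have aV : \sum_p a p * (V p)^* = (\sum_m c m * W m)^*.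
  rewrite rmorph_sum (eq_bigr (fun p => \sum_m (c m)^* * (U m p * (V p)^*))); last first.
    by move=> p _; rewrite Uexp mulr_suml; apply: eq_bigr => m _; rewrite mulrA.
  rewrite exchange_big; apply: eq_bigr => m _.
  by rewrite -mulr_sumr WJ rmorphM.
rewrite -aV mulr_suml -big_split /=.
rewrite (eq_bigr (fun p : I => \sum_(m : I) (((mu m)%:C * W m) * (U m p * (V p)^*) + c m * W m * (a p * (V p)^*)))).
  rewrite exchange_big; apply: eq_bigr => m _ /=.
  by rewrite big_split /= -mulr_sumr -mulr_sumr WJ; ring.
move=> p _; rewrite {1}VW mulr_suml mulr_sumr; apply: eq_bigr => m _.
have := Ucom m p; rewrite rmorphB /= mulrBl => e.
have {}e : (lam p)%:C * U m p = c m * a p + (mu m)%:C * U m p by rewrite -e subrK.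
transitivity ((lam p)%:C * U m p * (W m * (V p)^*)); first by ring.
by rewrite e; ring.
Qed.

End QuadraticForm.

(** * Eigenfunctions and potential built from matrix data *)

Section Build.
Variable R : realType.
Local Notation C := R[i].
Opaque fourier inner circle_mean lax_form.
Variables (N : nat) (lam mu : nat -> R).
Hypotheses (mu0 : mu 0%N = 0) (muS : forall m, mu m.+1 = lam m + 1)
  (mu_lam : forall m, mu m <= lam m).
Local Notation I := 'I_N.+1.
Variables (U : I -> I -> C) (a c : I -> C).
Hypothesis D : gap_data lam mu U a c.

Local Notation w := (widen_ord (leqnSn N)).
Local Notation s := (lift (@ord0 N)).

Lemma build_lam_ge0 m : 0 <= lam m.
Proof.
apply: le_trans (mu_lam m); case: m => [|m]; first by rewrite mu0.
elim: m => [|m IH]; rewrite muS.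
  by have := mu_lam 0%N; rewrite mu0; lra.
by have := mu_lam m.+1; lra.
Qed.

Let rows := unitary_rows (gap_columns D).

(** The top function is left out: the expansion of each f_p involves only f_0, ..., f_(N-1), so the
    recursion closes on these N functions and f_N follows from them. *)
Definition back_mx : 'M[C]_N := \matrix_(i, m) (U (s m) (w i))^*.

(* For a left eigenvector [v] of modulus at least 1, [quad_form] would give
   [sum lam |v|^2 >= sum (lam + 1) |v|^2]. *)
Lemma back_mx_stable z (v : 'rV[C]_N) : v *m back_mx = z *: v -> v != 0 -> `|z| < 1.
Proof.
move=> vz vn0; have lz : `|z| \is Num.real by exact: normr_real.
have [//|z1] := real_ltP lz (@real1 C).
pose V (p : I) : C := \sum_(i < N) v 0 i * ((i : nat) == p)%:R.
have Vw i : V (w i) = v 0 i.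
  rewrite /V (bigD1 i)//= eqxx mulr1 big1 ?addr0// => j ji.
  by rewrite (_ : (j : nat) == i = false) ?mulr0//; apply: contraNF ji => /eqP e; apply/eqP/val_inj.
have VN : V ord_max = 0.
  by apply: big1 => i _; rewrite (_ : (i : nat) == _ = false) ?mulr0// ltn_eqF.
have := quad_form (gap_columns D) (gap_commutator D) (gap_expansion D) V; set W := fun m => _ => /=.
have Ws m : W (s m) = z * v 0 m.
  have := congr1 (fun B : 'rV[C]_N => B 0 m) vz; rewrite !mxE => <-.
  rewrite /W big_ord_recr /= VN mulr0 addr0; apply: eq_bigr => i _.
  by rewrite Vw !mxE mulrC.
rewrite big_ord_recr big_ord_recl /= VN mul0r mulr0 addr0 mu0 mul0r add0r => e.
have {e} : \sum_(i < N) (lam i)%:C * (v 0 i * (v 0 i)^*) =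
    \sum_(i < N) (lam i + 1)%:C * (`|z| ^+ 2 * (v 0 i * (v 0 i)^*)) +
    (\sum_m c m * W m) * (\sum_m c m * W m)^*.
  rewrite -(eq_bigr _ (fun i _ => congr1 (fun t => (lam (w i))%:C * (t * t^*)) (Vw i))) e.
  congr (_ + _); apply: eq_bigr => i _; rewrite -(muS i); congr (_ * _).
  by rewrite Ws rmorphM normCK /=; ring.
move=> e; case/eqP: vn0; apply/rowP => i; rewrite mxE.
have le1 : \sum_(i < N) (lam i + 1)%:C * (v 0 i * (v 0 i)^*) <= \sum_(i < N) (lam i)%:C * (v 0 i * (v 0 i)^*).
  rewrite e -[X in X <= _]addr0 lerD ?mul_conjC_ge0//; apply: ler_sum => j _.
  rewrite ler_wpM2l ?ler0c ?addr_ge0 ?build_lam_ge0//.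
  by rewrite ler_peMl ?mul_conjC_ge0// exprn_ege1.
have : \sum_(i < N) v 0 i * (v 0 i)^* <= 0.
  rewrite -subr_le0 -sumrB in le1; apply: le_trans le1.
  rewrite le_eqVlt; apply/orP; left; apply/eqP/eq_bigr => j _.
  by rewrite rmorphD /= rmorph1; ring.
move=> h.
have : v 0 i * (v 0 i)^* <= 0.
  by apply: le_trans h; rewrite (bigD1 i)//= lerDl sumr_ge0// => j _; exact: mul_conjC_ge0.
rewrite -normCK => h2; apply/eqP; rewrite -normr_eq0 -sqrf_eq0 eq_le h2.
by rewrite exprn_ge0.
Qed.

(* The Fourier coefficients of [f_p], as dictated by
   [f_p = conj (U 0 p) + sum_m conj (U (m + 1) p) S f_m]. *)
Fixpoint build_coef (k : nat) (p : I) : C :=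
  if k is k'.+1 then \sum_(m < N) (U (s m) p)^* * build_coef k' (w m) else (U ord0 p)^*.

(** The roots are kept along with the decay: they will be the zeros of the Blaschke product in
    [build_model]. *)
Lemma build_roots : exists r : N.-tuple C, (forall z, z \in r -> `|z| < 1) /\
  forall x : nat -> 'cV[C]_N, (forall k, x k.+1 = back_mx *m x k) ->
  forall i, (forall k, foldl (@root_step R) (fun k => x k i 0) r k = 0) /\ geo (fun k => x k i 0).
Proof.
have [r [r1 H]] := cayley_hamilton_recursion back_mx_stable.
exists r; split => // x xT i; split; first exact: H.
exact: (geo_root_steps r1 (H x i xT)).
Qed.

Let X k : 'cV[C]_N := \col_i build_coef k (w i).

Let XT k : X k.+1 = back_mx *m X k.
Proof.
apply/colP => i; rewrite !mxE /=; apply: eq_bigr => m _.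
by rewrite !mxE.
Qed.

Lemma geo_build_coef p : geo (build_coef^~ p).
Proof.
have gw (i : 'I_N) : geo (build_coef^~ (w i)).
  have [r [_ H]] := build_roots; have [_ g] := H X XT i.
  by apply: (eq_geo _ g) => k; rewrite mxE.
have : geo (fun k => build_coef k.+1 p).
  by apply: geo_sum => m _; exact: (geoZ _ (gw m)).
move=> g; apply: (@geo_recursion _ _ (fun k => build_coef k.+1 p) 0); rewrite ?normr0 ?ltr01//.
by move=> k; rewrite mul0r add0r.
Qed.

Definition build_fun p : R -> C := synth (build_coef^~ p).

Lemma build_nice p : nice (build_fun p).
Proof. exact/nice_synth/geo_build_coef. Qed.

Lemma predz (k : nat) : k.+1%:Z - 1 = k%:Z.
Proof. by rewrite -addn1 PoszD addrK. Qed.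

Let sF p := nice_sqi (build_nice p).
Let hF p := smooth_hardy (build_nice p).1.

Lemma fourier_build p (k : nat) : fourier (build_fun p) k%:Z = build_coef k p.
Proof. by rewrite fourier_synth//; exact: geo_build_coef. Qed.

Lemma hardy_lincomb (J : finType) (F : J -> R -> C) (v : J -> C) :
  (forall j, hardy (F j)) -> hardy (\sum_j v j *: F j).
Proof. by move=> h; apply: hardy_sum => j _; exact: hardyZ. Qed.

Lemma fourier_lincomb (J : finType) (F : J -> R -> C) (v : J -> C) k :
  (forall j, square_integrable (F j)) ->
  fourier (\sum_j v j *: F j) k = \sum_j v j * fourier (F j) k.
Proof.
move=> h; rewrite (fourier_sum _ _ (fun j _ => sqiZ (v j) (h j))).
by apply: eq_bigr => j _; rewrite (fourierZ _ _ (h j)).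
Qed.

(** Here and in [build_shift], orthonormality of the rows of [U] inverts the recursion that defines
    the coefficients. *)
Lemma build_one : ae_equal 1 (\sum_p U ord0 p *: build_fun p).
Proof.
have h1 : hardy (1 : R -> C) by rewrite -ek0; exact: (hardy_ek R 0).
apply: (hardy_inj h1 (hardy_lincomb _ hF)) => k.
rewrite (fourier_lincomb _ _ sF) -ek0 fourier_ek.
under eq_bigr do rewrite fourier_build.
case: k => [|k] /=; first by rewrite rows eqxx.
under eq_bigr do rewrite mulr_sumr.
rewrite exchange_big big1// => m _ /=.
under eq_bigr do rewrite mulrA.
by rewrite -mulr_suml rows mul0r.
Qed.

Lemma build_shift m : ae_equal (ek 1 * build_fun (w m)) (\sum_p U (s m) p *: build_fun p).
Proof.
apply: (hardy_inj (hardy_shift (hF _)) (hardy_lincomb _ hF)) => k.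
rewrite (fourier_lincomb _ _ sF) fourier_ekM.
under eq_bigr do rewrite fourier_build.
case: k => [|k].
  by rewrite (hF (w m)).2//= rows.
rewrite predz fourier_build /=.
under eq_bigr do rewrite mulr_sumr.
rewrite exchange_big /= (bigD1 m)//=.
under eq_bigr do rewrite mulrA.
rewrite -mulr_suml rows eqxx mul1r big1 ?addr0// => j jm.
under eq_bigr do rewrite mulrA.
by rewrite -mulr_suml rows (inj_eq (@lift_inj _ ord0)) eq_sym (negbTE jm) mul0r.
Qed.

Lemma build_expand p : ae_equal (build_fun p)
  ((U ord0 p)^* *: (1 : R -> C) + \sum_(m < N) (U (s m) p)^* *: (ek 1 * build_fun (w m))).
Proof.
have h1 : hardy (1 : R -> C) by rewrite -ek0; exact: (hardy_ek R 0).
have hS m := hardy_shift (hF (w m)).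
apply: (hardy_inj (hF p) (hardyD (hardyZ _ h1) (hardy_lincomb _ hS))) => k.
rewrite (fourierD _ (sqiZ _ (hardy_sqi h1)) (hardy_sqi (hardy_lincomb _ hS))).
rewrite (fourierZ _ _ (hardy_sqi h1)) (fourier_lincomb _ _ (fun m => hardy_sqi (hS m))).
rewrite fourier_build -ek0 fourier_ek.
case: k => [|k] /=.
  rewrite mulr1 big1 ?addr0// => m _.
  by rewrite fourier_ekM (hF (w m)).2 ?mulr0.
rewrite mulr0 add0r; apply: eq_bigr => m _.
by rewrite fourier_ekM predz fourier_build.
Qed.

Lemma inner_lincomb2 (J : finType) (F : J -> R -> C) (v : J -> C) (g : R -> C) :
  (forall j, square_integrable (F j)) -> square_integrable g ->
  inner (\sum_j v j *: F j) g = \sum_j v j * inner (F j) g.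
Proof.
move=> h sg; rewrite (inner_suml _ (fun j _ => sqiZ (v j) (h j)) sg).
by apply: eq_bigr => j _; rewrite (innerZl _ (h j) sg).
Qed.

Lemma inner_lincombr (J : finType) (F : J -> R -> C) (v : J -> C) (g : R -> C) :
  (forall j, square_integrable (F j)) -> square_integrable g ->
  inner g (\sum_j v j *: F j) = \sum_j (v j)^* * inner g (F j).
Proof.
move=> h sg; rewrite (inner_sumr _ (fun j _ => sqiZ (v j) (h j)) sg).
by apply: eq_bigr => j _; rewrite (innerZr _ (h j) sg).
Qed.

Lemma inner_ek_mul k (f g : R -> C) : inner (ek k * f) (ek k * g) = inner f g.
Proof. by rewrite inner_bounded_mul cj_ek mulrA -ekD addNr ek0 mul1r. Qed.

Let s1 : square_integrable (1 : R -> C). Proof. exact: sqi_cst. Qed.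

Lemma inner_one_shift (f : R -> C) : hardy f -> inner 1 (ek 1 * f) = 0.
Proof.
move=> hf; have sf := hardy_sqi hf; rewrite (inner_conj (ek_mul_sqi 1 sf) s1) -ek0 -fourierE fourier_ekM.
by rewrite (hf.2) ?conjC0.
Qed.

Lemma inner_shift_one (f : R -> C) : hardy f -> inner (ek 1 * f) 1 = 0.
Proof.
move=> hf; have sf := hardy_sqi hf.
by rewrite (inner_conj s1 (ek_mul_sqi 1 sf)) inner_one_shift// conjC0.
Qed.

Let G (p q : I) := inner (build_fun p) (build_fun q).

Let sS m := ek_mul_sqi 1 (sF (w m)).
Let sL p : square_integrable (\sum_(m < N) (U (s m) p)^* *: (ek 1 * build_fun (w m))).
Proof. by apply: sqi_sum => m _; apply: sqiZ; exact: sS. Qed.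
Let sE p : square_integrable ((U ord0 p)^* *: (1 : R -> C) +
  \sum_(m < N) (U (s m) p)^* *: (ek 1 * build_fun (w m))).
Proof. by apply: sqiD; [exact: sqiZ|exact: sL]. Qed.

(** Both functions are expanded by [build_expand]: 1 is orthogonal to the range of S, and S is an
    isometry. *)
Let G_step p q : G p q = (U ord0 p)^* * U ord0 q +
  \sum_(m < N) \sum_(m' < N) (U (s m) p)^* * U (s m') q * G (w m) (w m').
Proof.
rewrite /G (inner_ae (sF p) (sE p) (sF q) (sE q) (build_expand p) (build_expand q)).
have i11 : inner (1 : R -> C) 1 = 1.
  rewrite innerE mul1r (_ : cj 1 = 1) ?circle_mean1//.
  by apply/funext => x; exact: conjC1.
have i1L q' : inner 1 (\sum_(m < N) (U (s m) q')^* *: (ek 1 * build_fun (w m))) = 0.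
  by rewrite (inner_lincombr _ sS s1) big1// => m _; rewrite inner_one_shift ?mulr0.
have iL1 q' : inner (\sum_(m < N) (U (s m) q')^* *: (ek 1 * build_fun (w m))) 1 = 0.
  by rewrite (inner_lincomb2 _ sS s1) big1// => m _; rewrite inner_shift_one ?mulr0.
rewrite (innerDl (sqiZ _ s1) (sL p) (sE q)) (innerDr (sqiZ _ s1) (sL q) (sqiZ _ s1)).
rewrite (innerDr (sqiZ _ s1) (sL q) (sL p)).
rewrite (innerZl _ s1 (sqiZ _ s1)) (innerZr _ s1 s1) conjCK i11 mulr1.
rewrite (innerZl _ s1 (sL q)) i1L mulr0 addr0 (innerZr _ s1 (sL p)) iL1 mulr0 add0r.
rewrite (inner_lincomb2 _ sS (sL q)).
congr (_ + _); apply: eq_bigr => m _.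
rewrite (inner_lincombr _ sS (sS m)) mulr_sumr; apply: eq_bigr => m' _.
by rewrite conjCK inner_ek_mul mulrA.
Qed.

Let Em : 'M[C]_N := \matrix_(i, j) (G (w i) (w j) - (i == j)%:R).

Let G_sub p q : G p q - (p == q)%:R =
  \sum_(m < N) \sum_(m' < N) (U (s m) p)^* * U (s m') q * Em m m'.
Proof.
rewrite G_step -(gap_columns D) big_ord_recl opprD addrACA subrr add0r -sumrB.
apply: eq_bigr => m _.
rewrite (bigD1 m)//= [in RHS](bigD1 m)//= !mxE eqxx mulrBr mulr1 addrAC; congr (_ + _).
by apply: eq_bigr => m' mm'; rewrite !mxE eq_sym (negbTE mm') subr0.
Qed.

Let conj_mx (A : 'M[C]_N) := (map_mx Num.conj A)^T.

(* The defect of orthonormality satisfies [E = T E T^*], hence [E = T^k E (T^k)^*], which tends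
   to 0. *)
Let Em_fix : Em = back_mx *m Em *m conj_mx back_mx.
Proof.
apply/matrixP => i j; rewrite [LHS]mxE.
have -> : (i == j) = (w i == w j) by rewrite -val_eqE.
rewrite G_sub !mxE exchange_big /=; apply: eq_bigr => m' _.
rewrite !mxE mulr_suml; apply: eq_bigr => m _.
by rewrite !mxE conjCK; ring.
Qed.

Let P k : 'M[C]_N := iter k (mulmx back_mx) 1%:M.

Let Em_iter k : Em = P k *m Em *m conj_mx (P k).
Proof.
elim: k => [|k IH].
  by rewrite /P /= mul1mx /conj_mx map_mx1 trmx1 mulmx1.
rewrite {1}Em_fix {1}IH /P iterS -/(P k) /conj_mx map_mxM trmx_mul !mulmxA//.
Qed.

Let geo_P i j : geo (fun k => P k i j).
Proof.
have [r [_ H]] := build_roots.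
have [|_ g] := H (fun k => col j (P k)) _ i.
  by move=> k; rewrite /P iterS -/(P k); rewrite !colE mulmxA.
by apply: (eq_geo _ g) => k; rewrite mxE.
Qed.

Let Em0 i j : Em i j = 0.
Proof.
apply: geo_cst_eq0.
have g : geo (fun k => \sum_q (\sum_l P k i l * Em l q) * (P k j q)^*).
  apply: geo_sum => q _; apply: geoM; last exact/geoJ/geo_P.
  by apply: geo_sum => l _; apply: (eq_geo _ (geoZ (Em l q) (geo_P i l))) => k; rewrite mulrC.
apply: (eq_geo _ g) => k; rewrite [in RHS](Em_iter k) mxE; apply: eq_bigr => q _.
by rewrite mxE !mxE.
Qed.

Lemma build_orthonormal p q : inner (build_fun p) (build_fun q) = (p == q)%:R.
Proof.
apply/eqP; rewrite -subr_eq0 -/(G p q) G_sub; apply/eqP.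
by apply: big1 => m _; apply: big1 => m' _; rewrite Em0 mulr0.
Qed.

Definition build_pot : R -> C := \sum_p a p *: build_fun p.

Lemma build_pot_nice : nice build_pot.
Proof. by apply: nice_sum => p _; apply: niceZ; exact: build_nice. Qed.

Let su := nice_sqi build_pot_nice.

Lemma inner_build_lincomb v q : inner (\sum_p v p *: build_fun p) (build_fun q) = v q.
Proof.
rewrite (inner_lincomb2 _ sF (sF q)) (bigD1 q)//= build_orthonormal eqxx mulr1 big1 ?addr0// => p pq.
by rewrite build_orthonormal (negbTE pq) mulr0.
Qed.

Lemma inner_build_pot p : inner build_pot (build_fun p) = a p.
Proof. exact: inner_build_lincomb. Qed.

Lemma inner_lincomb_pot v : inner (\sum_p v p *: build_fun p) build_pot = \sum_p (a p)^* * v p.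
Proof.
have sv : square_integrable (\sum_p v p *: build_fun p) by apply: sqi_sum => p _; exact: sqiZ.
rewrite /build_pot (inner_lincombr _ sF sv); apply: eq_bigr => p _.
by rewrite inner_build_lincomb.
Qed.

Let sU m : square_integrable (\sum_p U m p *: build_fun p).
Proof. by apply: sqi_sum => p _; exact: sqiZ. Qed.

Lemma inner_one_pot : inner 1 build_pot = c ord0.
Proof.
rewrite (inner_ae s1 (sU ord0) su su build_one (ae_equal_refl _)) inner_lincomb_pot.
by rewrite -(gap_expansion_row D).
Qed.

Lemma inner_shift_pot m : inner (ek 1 * build_fun (w m)) build_pot = c (s m).
Proof.
rewrite (inner_ae (sS m) (sU (s m)) su su (build_shift m) (ae_equal_refl _)) inner_lincomb_pot.
by rewrite -(gap_expansion_row D).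
Qed.

Lemma inner_one_build p : inner 1 (build_fun p) = U ord0 p.
Proof.
by rewrite (inner_ae s1 (sU ord0) (sF p) (sF p) build_one (ae_equal_refl _)) inner_build_lincomb.
Qed.

Lemma inner_shift_build m p : inner (ek 1 * build_fun (w m)) (build_fun p) = U (s m) p.
Proof.
by rewrite (inner_ae (sS m) (sU (s m)) (sF p) (sF p) (build_shift m) (ae_equal_refl _)) inner_build_lincomb.
Qed.

End Build.

Section LaxSums.
Variable R : realType.
Local Notation C := R[i].
Opaque fourier inner circle_mean lax_form lax_op.
Implicit Types (f g h u : R -> C).

Lemma ae_equal_sum (I : Type) (r : seq I) (F G : I -> R -> C) :
  (forall i, ae_equal (F i) (G i)) -> ae_equal (\sum_(i <- r) F i) (\sum_(i <- r) G i).
Proof.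
move=> h; elim: r => [|i r IH]; first by rewrite !big_nil; exact: ae_equal_refl.
by rewrite !big_cons; exact: ae_equalD.
Qed.

Lemma lax_op_lincomb u (I : Type) (r : seq I) (v : I -> C) (F : I -> R -> C) : nice u ->
  (forall i, smooth (F i)) ->
  ae_equal (lax_op u (\sum_(i <- r) v i *: F i)) (\sum_(i <- r) v i *: lax_op u (F i)).
Proof.
move=> nu sF; elim: r => [|i r IH].
  have := lax_opZ 0 nu (smooth_ek R 0).
  by rewrite !scale0r !big_nil.
rewrite !big_cons.
have sr : smooth (\sum_(j <- r) v j *: F j) by apply: smooth_sum => j _; exact: smoothZ.
apply: (ae_equal_trans (lax_opD nu (smoothZ _ (sF i)) sr)).
by apply: ae_equalD => //; exact: lax_opZ.
Qed.

Lemma lax_of_lax_op u f h : nice u -> smooth f -> square_integrable h ->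
  ae_equal (lax_op u f) h -> lax u f h.
Proof.
move=> nu sf sh e; have su := nice_sqi nu.
apply: (lax_ae su su (smooth_sqi sf) sh _ _ e (lax_lax_op nu sf)); exact: ae_equal_refl.
Qed.

End LaxSums.

(** * The eigenvalue equation for the constructed functions *)

Section BuildSpectrum.
Variable R : realType.
Local Notation C := R[i].
Opaque fourier inner circle_mean lax_form lax_op.
Variables (N : nat) (lam mu : nat -> R).
Hypotheses (mu0 : mu 0%N = 0) (muS : forall m, mu m.+1 = lam m + 1)
  (mu_lam : forall m, mu m <= lam m).
Local Notation I := 'I_N.+1.
Variables (U : I -> I -> C) (a c : I -> C).
Hypothesis D : gap_data lam mu U a c.
Local Notation w := (widen_ord (leqnSn N)).
Local Notation s := (lift (@ord0 N)).
Local Notation F := (build_fun U).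
Local Notation u := (build_pot U a).
Local Notation bc := (build_coef U).

Let nF p := build_nice mu0 muS mu_lam D p.
Let sF p := nice_sqi (nF p).
Let hF p := smooth_hardy (nF p).1.
Let nu := build_pot_nice mu0 muS mu_lam D.
Let su := nice_sqi nu.
Let fF := fourier_build mu0 muS mu_lam D.

Let row0 k : \sum_p U ord0 p * bc k p = (k == 0%N)%:R.
Proof.
have := fourier_ae k%:Z _ _ (build_one mu0 muS mu_lam D).
rewrite (_ : (k == 0%N) = (0 == k%:Z)); last by rewrite eq_sym.
rewrite (fourier_lincomb _ _ sF) -ek0 fourier_ek => ->.
- by apply: eq_bigr => p _; rewrite fF.
- exact: ek_sqi.
- by apply: sqi_sum => p _; exact: sqiZ.
Qed.

Let rowS m k : \sum_p U (s m) p * bc k p = fourier (ek 1 * F (w m)) k%:Z.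
Proof.
have := fourier_ae k%:Z _ _ (build_shift mu0 muS mu_lam D m).
rewrite (fourier_lincomb _ _ sF) => ->.
- by apply: eq_bigr => p _; rewrite fF.
- exact: ek_mul_sqi.
- by apply: sqi_sum => p _; exact: sqiZ.
Qed.

Lemma fourier_build_pot_row k : fourier u k%:Z =
  (c ord0)^* * (k == 0%N)%:R + \sum_(m < N) (c (s m))^* * fourier (ek 1 * F (w m)) k%:Z.
Proof.
rewrite /build_pot (fourier_lincomb _ _ sF).
rewrite (eq_bigr (fun p => \sum_m (c m)^* * (U m p * bc k p))); last first.
  by move=> p _; rewrite fF (gap_expansion D) mulr_suml; apply: eq_bigr => m _; rewrite mulrA.
rewrite exchange_big big_ord_recl /= -mulr_sumr row0; congr (_ + _).
by apply: eq_bigr => m _; rewrite -mulr_sumr rowS.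
Qed.

Lemma fourier_build_pot k : fourier u k%:Z = \sum_p a p * bc k p.
Proof.
by rewrite /build_pot (fourier_lincomb _ _ sF); apply: eq_bigr => p _; rewrite fF.
Qed.

Let sm1 : smooth (1 : R -> C). Proof. by rewrite -ek0; exact: (smooth_ek R 0). Qed.
Let smS m : smooth (ek 1 * F (w m)). Proof. exact/smooth_shift/(nF _).1. Qed.

Let aJ p : (a p)^* = \sum_m c m * (U m p)^*.
Proof.
rewrite (gap_expansion D) rmorph_sum; apply: eq_bigr => m _.
by rewrite rmorphM /= conjCK.
Qed.

Let LF m := lax_op u (F m).
Let hL m : hardy (LF m). Proof. exact: lax_op_hardy nu (nF m).1. Qed.

(** L is applied to [build_expand] through the commutator identity and the value of L 1; all
    multiples of [u] collect into sum_m conj(U_mp) c_m = conj(a_p). *)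
Lemma lax_op_build p : ae_equal (LF p)
  ((a p)^* *: u + \sum_(m < N) (U (s m) p)^* *: (ek 1 * LF (w m) + ek 1 * F (w m))).
Proof.
have sL : smooth (\sum_(m < N) (U (s m) p)^* *: (ek 1 * F (w m))).
  by apply: smooth_sum => m _; exact: smoothZ.
apply: (ae_equal_trans (lax_op_ae nu (nF p).1 (smoothD (smoothZ _ sm1) sL)
  (build_expand mu0 muS mu_lam D p))).
apply: (ae_equal_trans (lax_opD nu (smoothZ _ sm1) sL)).
have -> : (a p)^* *: u + \sum_(m < N) (U (s m) p)^* *: (ek 1 * LF (w m) + ek 1 * F (w m)) =
  (U ord0 p)^* *: (c ord0 *: u) +
  \sum_(m < N) (U (s m) p)^* *: (ek 1 * LF (w m) + ek 1 * F (w m) + c (s m) *: u).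
  rewrite aJ big_ord_recl scalerDl scaler_suml [in RHS](eq_bigr (fun m : 'I_N =>
     (U (s m) p)^* *: (ek 1 * LF (w m) + ek 1 * F (w m)) + (c (s m) * (U (s m) p)^*) *: u)); last first.
    by move=> m _; rewrite scalerDr scalerA [_^* * _]mulrC.
  by rewrite big_split /= scalerA [_^* * _]mulrC addrAC addrA.
apply: ae_equalD.
  apply: (ae_equal_trans (lax_opZ _ nu sm1)); apply: ae_equalZ.
  by rewrite -(inner_one_pot mu0 muS mu_lam D); exact: lax_op1.
apply: (ae_equal_trans (lax_op_lincomb _ _ nu smS)).
apply: ae_equal_sum => m; apply: ae_equalZ.
by rewrite -(inner_shift_pot mu0 muS mu_lam D); exact: lax_op_shift nu (nF _).1.
Qed.

Let fourier_LF p k : fourier (LF p) k%:Z = (a p)^* * fourier u k%:Z +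
  \sum_(m < N) (U (s m) p)^* * (fourier (LF (w m)) (k%:Z - 1) + fourier (F (w m)) (k%:Z - 1)).
Proof.
have s1 m := ek_mul_sqi 1 (hardy_sqi (hL (w m))).
have s2 m := ek_mul_sqi 1 (sF (w m)).
have s3 m := sqiD (s1 m) (s2 m).
have s4 : square_integrable (\sum_(m < N) (U (s m) p)^* *: (ek 1 * LF (w m) + ek 1 * F (w m))).
  by apply: sqi_sum => m _; exact: sqiZ.
have su' := sqiZ (a p)^* su.
apply: (etrans (fourier_ae _ (hardy_sqi (hL p)) (sqiD su' s4) (lax_op_build p))).
apply: (etrans (fourierD _ su' s4)); congr (_ + _); first exact: fourierZ.
apply: (etrans (fourier_lincomb _ _ s3)).
apply: eq_bigr => m _.
by rewrite (fourierD _ (s1 m) (s2 m)) !fourier_ekM.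
Qed.

(** [lax_op_build] expresses the coefficient of L f_p at frequency k by those of L f_m at k - 1, and
    lam_p f_p obeys the same recursion by the matrix commutator relation; induction on k, for all p
    at once, identifies them. *)
Lemma build_lax_op p : ae_equal (LF p) ((lam p)%:C *: F p).
Proof.
have H k : forall q, fourier (LF q) k%:Z = (lam q)%:C * bc k q.
  have cJ (q m : I) : (lam q - mu m)%:C * (U m q)^* = (a q)^* * (c m)^*.
    rewrite -rmorphM /= [a q * _]mulrC -(gap_commutator D) rmorphM /=.
    by congr (_ * _); apply/esym; exact: conjc_real.
  elim: k => [|k IH] q; rewrite fourier_LF fourier_build_pot_row.
    rewrite eqxx mulr1 !big1 ?addr0.
    - by rewrite -cJ mu0 subr0.
    - by move=> m _; rewrite (hL _).2 ?(hF _).2 ?addr0 ?mulr0.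
    - by move=> m _; rewrite fourier_ekM (hF _).2 ?mulr0.
  rewrite mulr0 add0r mulr_sumr -big_split /= mulr_sumr; apply: eq_bigr => m _.
  rewrite fourier_ekM predz IH fF.
  rewrite mulrA -cJ (_ : mu (s m) = lam m + 1) ?muS// rmorphB rmorphD rmorph1 /=; ring.
apply: (hardy_inj (hL p) (hardyZ _ (hF p))) => k.
by rewrite H (fourierZ _ _ (sF p)) fF.
Qed.

End BuildSpectrum.

(** * The complete eigenbasis and the Birkhoff coordinates *)

Section BuildEigenbasis.
Variable R : realType.
Local Notation C := R[i].
Opaque fourier inner circle_mean lax_form lax_op.
Variables (N : nat) (lam mu : nat -> R).
Hypotheses (mu0 : mu 0%N = 0) (muS : forall m, mu m.+1 = lam m + 1)
  (mu_lam : forall m, mu m <= lam m) (lamN : forall n, (N < n)%N -> lam n = mu n).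
Local Notation I := 'I_N.+1.
Variables (U : I -> I -> C) (a c : I -> C).
Hypothesis D : gap_data lam mu U a c.
Local Notation w := (widen_ord (leqnSn N)).
Local Notation s := (lift (@ord0 N)).
Local Notation F := (build_fun U).
Local Notation FN := (build_fun U ord_max).
Local Notation u := (build_pot U a).

Let nF p := build_nice mu0 muS mu_lam D p.
Let sF p := nice_sqi (nF p).
Let nu := build_pot_nice mu0 muS mu_lam D.
Let su := nice_sqi nu.
Let onF := build_orthonormal mu0 muS mu_lam D.
Let nk k p := nice_ekM k (nF p).
Let sk k p := nice_sqi (nk k p).

Lemma ekS_mul (k : nat) (f : R -> C) : ek k.+1%:Z * f = ek 1 * (ek k%:Z * f).
Proof. by rewrite mulrA -ekD. Qed.

Lemma scale_mulr (k : C) (f g : R -> C) : k *: (f * g) = f * (k *: g).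
Proof. by apply/funext => x; change (k * (f x * g x) = f x * (k * g x)); rewrite mulrCA. Qed.

Lemma inner_ek_build_expand f p : hardy f ->
  inner (ek 1 * f) (F p) = \sum_(m < N) U (s m) p * inner f (F (w m)).
Proof.
move=> hf; have sf := hardy_sqi hf; have s1 : square_integrable (1 : R -> C) by exact: sqi_cst.
have sf1 := ek_mul_sqi 1 sf.
have sS m := ek_mul_sqi 1 (sF (w m)).
have sL : square_integrable (\sum_(m < N) (U (s m) p)^* *: (ek 1 * F (w m))).
  by apply: sqi_sum => m _; exact: sqiZ.
have sE := sqiD (sqiZ (U ord0 p)^* s1) sL.
rewrite (inner_ae sf1 sf1 (sF p) sE (ae_equal_refl _) (build_expand mu0 muS mu_lam D p)).
rewrite (innerDr (sqiZ _ s1) sL sf1) (innerZr _ s1 sf1) inner_shift_one// mulr0 add0r.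
rewrite (inner_lincombr _ sS sf1); apply: eq_bigr => m _.
by rewrite conjCK inner_ek_mul.
Qed.

(** The adjoint of S sends every f_p into the span of f_0, ..., f_(N-1), by [build_expand], and f_N
    is orthogonal to that span. *)
Lemma inner_shift_top (j : nat) p : inner (ek j.+1%:Z * FN) (F p) = 0.
Proof.
elim: j p => [|j IH] p; rewrite ekS_mul inner_ek_build_expand; try exact: (smooth_hardy (nk _ _).1).
  by rewrite big1// => m _; rewrite ek0 mul1r onF -val_eqE/= gtn_eqF ?mulr0.
by rewrite big1// => m _; rewrite IH mulr0.
Qed.

Lemma inner_top (i j : nat) : inner (ek i%:Z * FN) (ek j%:Z * FN) = (i == j)%:R.
Proof.
have H (k l : nat) : inner (ek (k + l)%N%:Z * FN) (ek k%:Z * FN) = (l == 0%N)%:R.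
  rewrite PoszD ekD -mulrA inner_ek_mul; case: l => [|l]; last exact: inner_shift_top.
  by rewrite ek0 mul1r onF eqxx.
have [ij|/ltnW ji] := leqP i j.
  rewrite inner_conj; [|exact: sk|exact: sk].
  by have := H i (j - i)%N; rewrite subnKC// => ->; rewrite conjC_nat subn_eq0 eqn_leq ij.
by have := H j (i - j)%N; rewrite subnKC// => ->; rewrite subn_eq0 [in RHS]eqn_leq ji andbT.
Qed.

(** The sequence f_0, ..., f_N, S f_N, S^2 f_N, ... in one formula: the truncated difference is the
    power of S and the minimum caps the index. *)
Definition build_eigenfun n : R -> C := ek (n - N)%N%:Z * F (inord (minn n N)).
Local Notation phi := build_eigenfun.

Lemma build_eigenfun_low (p : I) : phi p = F p.
Proof.
rewrite /phi (_ : (p - N = 0)%N) ?ek0 ?mul1r; last by apply/eqP; rewrite subn_eq0 -ltnS.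
by rewrite (minn_idPl _) ?inord_val// -ltnS.
Qed.

Lemma build_eigenfun_high j : phi (N + j) = ek j%:Z * FN.
Proof.
rewrite /phi addKn (minn_idPr (leq_addr _ _)); congr (_ * F _).
by apply/val_inj; rewrite /= inordK.
Qed.

Lemma build_eigenfun_nice n : nice (phi n).
Proof. exact: nk. Qed.

Variant build_index_spec : nat -> Prop :=
  | BuildLow (p : I) : (p < N)%N -> build_index_spec p
  | BuildHigh j : build_index_spec (N + j).

Lemma build_indexP n : build_index_spec n.
Proof.
have [nN|Nn] := ltnP n N; last by rewrite -(subnKC Nn); exact: BuildHigh.
have h : (n < N.+1)%N by exact: ltnW.
exact: (@BuildLow (Ordinal h)).
Qed.

Lemma build_eigenfun_orthonormal m n : inner (phi m) (phi n) = (m == n)%:R.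
Proof.
have lo_hi (p : I) j : (p < N)%N -> inner (ek j%:Z * FN) (F p) = 0.
  case: j => [|j] pN; last exact: inner_shift_top.
  by rewrite ek0 mul1r onF -val_eqE /= gtn_eqF.
case: (build_indexP m) => [p pN|i]; case: (build_indexP n) => [q qN|j].
- by rewrite !build_eigenfun_low onF.
- rewrite build_eigenfun_low build_eigenfun_high inner_conj; [|exact: sk|exact: sF].
  by rewrite lo_hi// conjC0 ltn_eqF// (leq_trans pN)// leq_addr.
- by rewrite build_eigenfun_low build_eigenfun_high lo_hi// gtn_eqF// (leq_trans qN)// leq_addr.
- by rewrite !build_eigenfun_high inner_top eqn_add2l.
Qed.

(** [g] is orthogonal to every S^k f_p, by induction on k: for p < N because S f_p is in the span of
    the f_q, for p = N by hypothesis. Since 1 is in that span too, [g] is orthogonal to every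
    e^{ikx}. *)
Lemma build_eigenfun_total g : hardy g -> (forall n, inner g (phi n) = 0) -> ae_equal g (cst 0).
Proof.
move=> hg g0; have sg := hardy_sqi hg.
have H k : forall p, inner g (ek k%:Z * F p) = 0.
  elim: k => [|k IH] p; first by rewrite ek0 mul1r -build_eigenfun_low.
  have [pN|Np] := ltnP p N; last first.
    have -> : p = ord_max by apply/val_inj/eqP; rewrite eqn_leq Np -ltnS /= ltn_ord.
    by rewrite -build_eigenfun_high.
  have -> : p = w (Ordinal pN) by apply/val_inj.
  have sL : square_integrable (\sum_q U (s (Ordinal pN)) q *: (ek k%:Z * F q)).
    by apply: sqi_sum => q _; apply: sqiZ; exact: sk.
  rewrite (inner_ae sg sg (sk _ _) sL (ae_equal_refl _)).
    rewrite (inner_lincombr _ (sk k) sg) big1// => q _; by rewrite IH mulr0.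
  have := ae_equalM (ae_equal_refl (ek k%:Z)) (build_shift mu0 muS mu_lam D (Ordinal pN)).
  rewrite mulr_sumr ekS_mul [X in _ -> ae_equal X _]mulrCA.
  by under eq_bigr do rewrite -scale_mulr.
apply: (hardy_inj hg (hardy0 R)) => k.
rewrite !fourierE inner0l.
have sL : square_integrable (\sum_q U ord0 q *: (ek k%:Z * F q)).
  by apply: sqi_sum => q _; apply: sqiZ; exact: sk.
rewrite (inner_ae sg sg (ek_sqi _ _) sL (ae_equal_refl _)).
  rewrite (inner_lincombr _ (sk k) sg) big1// => q _; by rewrite H mulr0.
have := ae_equalM (ae_equal_refl (ek k%:Z)) (build_one mu0 muS mu_lam D).
rewrite mulr_sumr mulr1.
by under eq_bigr do rewrite -scale_mulr.
Qed.

Lemma build_gauge0 : 0 < inner 1 (phi 0%N).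
Proof.
rewrite -[0%N]/(val (@ord0 N)) build_eigenfun_low (inner_one_build mu0 muS mu_lam D).
exact: gap_gauge D _.
Qed.

Lemma build_gaugeS n : 0 < inner (ek 1 * phi n) (phi n.+1).
Proof.
have [nN|Nn] := ltnP n N; last first.
  rewrite -(subnKC Nn) -addnS !build_eigenfun_high -ekS_mul inner_top eqxx; exact: ltr01.
have -> : phi n = F (w (Ordinal nN)) by rewrite -build_eigenfun_low.
have -> : phi n.+1 = F (s (Ordinal nN)) by rewrite -build_eigenfun_low.
by rewrite (inner_shift_build mu0 muS mu_lam D) (gap_gauge D).
Qed.

(** The rank-one term of the commutator thus vanishes on S^j f_N, so that S raises its eigenvalue by
    exactly 1. *)
Lemma inner_shift_top_pot (j : nat) : inner (ek j.+1%:Z * FN) u = 0.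
Proof.
rewrite /build_pot (inner_lincombr _ sF (sk _ _)) big1// => p _.
by rewrite inner_shift_top mulr0.
Qed.

Lemma lam_top j : lam (N + j) = lam N + j%:R.
Proof.
elim: j => [|j IH]; first by rewrite addn0 addr0.
by rewrite addnS lamN ?ltnS ?leq_addr// muS IH -natr1 addrA.
Qed.

Lemma lax_op_top (j : nat) : ae_equal (lax_op u (ek j%:Z * FN)) ((lam N + j%:R)%:C *: (ek j%:Z * FN)).
Proof.
elim: j => [|j IH]; first by rewrite ek0 mul1r addr0; exact: (build_lax_op mu0 muS mu_lam D).
rewrite [in lax_op _ _]ekS_mul.
apply: (ae_equal_trans (lax_op_shift nu (nk j _).1)).
rewrite -ekS_mul inner_shift_top_pot scale0r addr0.
have -> : (lam N + j.+1%:R)%:C *: (ek j.+1%:Z * FN) =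
    ek 1 * ((lam N + j%:R)%:C *: (ek j%:Z * FN)) + ek j.+1%:Z * FN.
  by rewrite -scale_mulr -ekS_mul -natr1 addrA rmorphD rmorph1 scalerDl scale1r.
by apply: ae_equalD; [apply: ae_equalM => //; exact: ae_equal_refl|exact: ae_equal_refl].
Qed.

Lemma build_eigenfun_eigen n : ae_equal (lax_op u (phi n)) ((lam n)%:C *: phi n).
Proof.
case: (build_indexP n) => [p _|j].
  by rewrite build_eigenfun_low; exact: (build_lax_op mu0 muS mu_lam D).
by rewrite build_eigenfun_high lam_top; exact: lax_op_top.
Qed.

Lemma lam_lt n : lam n < lam n.+1.
Proof. by apply: lt_le_trans (mu_lam n.+1); rewrite muS ltrDl. Qed.

Lemma lam_ge n : n%:R <= lam n.
Proof.
elim: n => [|n IH]; first by apply: le_trans (mu_lam 0%N); rewrite mu0.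
by apply: le_trans (mu_lam n.+1); rewrite muS -natr1 lerD2r.
Qed.

Lemma lam_cvg : lam n @[n --> \oo] --> +oo.
Proof.
apply/cvgryPge => A; near=> n; apply: le_trans (lam_ge n).
near: n; exact: nbhs_infty_ger.
Unshelve. all: end_near. Qed.

Variable (H : L2 R).
Hypothesis Hu : ae_equal H u.

Lemma lax_of_ae (f h : R -> C) : smooth f -> square_integrable h -> ae_equal (lax_op u f) h ->
  lax H f h.
Proof.
move=> sf sh e.
exact: (lax_ae su (L2_sqi H) (smooth_sqi sf) sh (ae_equal_sym Hu) (ae_equal_refl _) (ae_equal_refl _)
   (lax_of_lax_op nu sf sh e)).
Qed.

Lemma build_spectrum : exists f : nat -> L2 R, [/\ eigenbasis H lam f, forall n, ae_equal (f n) (phi n),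
    lambda H = lam & forall n, inner H (eigenfun H n) = inner u (phi n)].
Proof.
have sn n := nice_sqi (build_eigenfun_nice n).
have [||||||||f [bf ef lf if_]] := @spectral_data R H lam phi (L2_sqi H).
- by move=> n; exact: (build_eigenfun_nice n).1.
- exact: lam_lt.
- exact: lam_cvg.
- move=> n; apply: lax_of_ae; [exact: (build_eigenfun_nice n).1|exact: sqiZ|].
  exact: build_eigenfun_eigen.
- exact: build_eigenfun_orthonormal.
- exact: build_eigenfun_total.
- exact: build_gauge0.
- exact: build_gaugeS.
exists f; split => // n; rewrite if_.
exact: (inner_ae (L2_sqi H) su (sn n) (sn n) Hu (ae_equal_refl _)).
Qed.

Lemma build_gap n : gap H n = lam n - mu n.
Proof.
have [f [_ _ e _]] := build_spectrum; rewrite /gap e; case: n => [|n]; first by rewrite mu0 subr0.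
by rewrite muS opprD addrA.
Qed.

Lemma build_birkhoff (p : I) : birkhoff H p = (Num.sqrt (lam p - mu p))%:C * phase (a p).
Proof.
have [f [_ _ _ e]] := build_spectrum.
by rewrite /birkhoff build_gap e build_eigenfun_low (inner_build_pot mu0 muS mu_lam D).
Qed.

Lemma build_birkhoff_high n : (N < n)%N -> birkhoff H n = 0.
Proof. by move=> Nn; rewrite /birkhoff build_gap lamN// subrr sqrtr0 mul0r. Qed.

End BuildEigenbasis.

Section BlaschkeFactors.
Variable R : realType.
Local Notation C := R[i].
Opaque fourier inner circle_mean lax_form lax_op.

Lemma bl_psi_lift N (p : 'I_N.+1 -> C) j :
  bl_psi p = (ek 1 - cst (p j)^*) * inv_factor (p j) * bl_psi (p \o lift j).
Proof. by rewrite /bl_psi /bl_num /bl_iden !(bigD1_ord j)//=; ring. Qed.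

Lemma inv_factor0 : inv_factor 0 = 1 :> (R -> C).
Proof.
have := @inv_factorE R 0; rewrite normr0 ltr01 => /(_ isT).
by rewrite scale0r subr0 mul1r.
Qed.

Lemma bl_psi_zero N (p : 'I_N.+1 -> C) j : p j = 0 -> bl_psi p = ek 1 * bl_psi (p \o lift j).
Proof.
by move=> pj; rewrite (bl_psi_lift p j) pj conjC0 inv_factor0 mulr1 (_ : cst 0 = 0)// subr0.
Qed.

(** S psi is a Blaschke product with an additional zero at 0; this makes the lemmas on model spaces
    available for the space of dimension N + 1 that contains psi and the potential. *)
Lemma bl_psi_extend N (p : 'I_N -> C) : (forall k, `|p k| < 1) ->
  exists2 p' : 'I_N.+1 -> C, (forall k, `|p' k| < 1) & bl_psi p' = ek 1 * bl_psi p.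
Proof.
move=> p1; pose p' k := if unlift ord_max k is Some j then p j else 0; exists p'; rewrite /p'.
  by move=> k; case: unliftP => // _; rewrite normr0 ltr01.
apply: (etrans (@bl_psi_zero _ p' ord_max _)); first by rewrite /p' unlift_none.
by congr (_ * bl_psi _); apply/funext => k; rewrite /p' /= liftK.
Qed.

End BlaschkeFactors.

(** * The spectral index of the constructed potential *)

Section BuildIndex.
Variable R : realType.
Local Notation C := R[i].
Opaque fourier inner circle_mean lax_form lax_op.
Variables (N : nat) (lam mu : nat -> R).
Hypotheses (mu0 : mu 0%N = 0) (muS : forall m, mu m.+1 = lam m + 1)
  (mu_lam : forall m, mu m <= lam m) (lamN : forall n, (N < n)%N -> lam n = mu n).
Local Notation I := 'I_N.+1.
Variables (U : I -> I -> C) (a c : I -> C).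
Hypothesis D : gap_data lam mu U a c.
Local Notation w := (widen_ord (leqnSn N)).
Local Notation F := (build_fun U).
Local Notation FN := (build_fun U ord_max).
Local Notation u := (build_pot U a).
Local Notation phi := (build_eigenfun U).

Let nF p := build_nice mu0 muS mu_lam D p.
Let sF p := nice_sqi (nF p).
Let hF p := smooth_hardy (nF p).1.
Let onF := build_orthonormal mu0 muS mu_lam D.

(** The zeros are the eigenvalues of [back_mx]: the coefficients of f_0, ..., f_(N-1) satisfy its
    characteristic recurrence, which [inner_synth_roots] converts into orthogonality to psi H^2. *)
Lemma build_model : exists2 p : 'I_N -> C, (forall k, `|p k| < 1) &
  forall m, in_model p (F (w m)).
Proof.
have [r [r1 Hr]] := build_roots mu0 muS mu_lam D.
exists (tnth r) => [k|m k]; first exact/r1/mem_tnth.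
have p1 j : `|tnth r j| < 1 by exact/r1/mem_tnth.
pose x k : 'cV[C]_N := \col_i build_coef U k (w i).
have xT j : x j.+1 = back_mx U *m x j.
  by apply/colP => i; rewrite !mxE /=; apply: eq_bigr => q _; rewrite !mxE.
have [x0 _] := Hr x xT m.
have xE : (fun k => x k m 0) = build_coef U ^~ (w m) by apply/funext => j; rewrite mxE.
rewrite xE in x0.
have ng := nice_ekM k (bl_iden_nice p1).
have pE : bl_num (tnth r) = \prod_(z <- r) (ek 1 - cst z^*) by rewrite /bl_num big_tuple.
have -> : ek k%:Z * bl_psi (tnth r) = \prod_(z <- r) (ek 1 - cst z^*) * (ek k%:Z * bl_iden (tnth r)).
  by rewrite -pE; exact: (mulrCA (ek k%:Z) (bl_num (tnth r)) (bl_iden (tnth r))).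
exact: (inner_synth_roots r1 x0 ng).
Qed.

Section Zeros.
Variable p : 'I_N -> C.
Hypotheses (p1 : forall k, `|p k| < 1) (mp : forall m, in_model p (F (w m))).
Let psi := bl_psi p.
Let npsi := bl_psi_nice p1.
Let spsi := nice_sqi npsi.
Let nk (k : nat) := nice_ekM k npsi.
Let sk (k : nat) := nice_sqi (nk k).

Let top_psi (k : nat) : inner FN (ek k.+1%:Z * psi) = 0.
Proof.
rewrite inner_conj; [|exact: sk|exact: sF].
rewrite ekS_mul (inner_ek_build_expand mu0 muS mu_lam D); last exact: (smooth_hardy (nk k).1).
rewrite big1 ?conjC0// => m _; rewrite inner_conj; [|exact: sF|exact: sk].
by rewrite mp conjC0 mulr0.
Qed.

Let psi_psi (k : nat) : inner psi (ek k.+1%:Z * psi) = 0.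
Proof.
rewrite innerE cjM cj_ek mulrCA bl_psi_unimodular// mulr1 circle_mean_ek.
by rewrite oppr_eq0.
Qed.

(* [f_0 .. f_N] and [psi] are [N + 2] functions of the model space of [S psi], of dimension
   [N + 1]. *)
Lemma build_psi_proportional : exists2 z : C, z != 0 & ae_equal psi (z *: FN).
Proof.
have [p' p'1 e] := bl_psi_extend p1.
pose G (i : 'I_N.+2) : R -> C := if unlift ord_max i is Some q then F q else psi.
have hG i : hardy (G i) by rewrite /G; case: unlift => [q|]; [exact: hF|exact: (smooth_hardy npsi.1)].
have mG i : in_model p' (G i).
  move=> k; rewrite e mulrA [ek _ * ek 1]mulrC -mulrA -ekS_mul /G.
  case: unliftP => [q _|_]; last exact: psi_psi.
  have [qN|Nq] := ltnP q N; last first.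
    have -> : q = ord_max by apply/val_inj/eqP; rewrite eqn_leq Nq -ltnS /= ltn_ord.
    exact: top_psi.
  have -> : q = w (Ordinal qN) by apply/val_inj.
  exact: mp.
have [v [i vi]] := model_dependent p'1 hG mG.
rewrite big_ord_recr /= /G unlift_none.
under eq_bigr => q _.
  have -> : widen_ord (leqnSn N.+1) q = lift ord_max q by apply/val_inj/esym; exact: lift_max.
  rewrite liftK.
  over.
set y := v ord_max; set t := fun q : I => v (lift ord_max q); move=> z0.
have {}z0 : ae_equal (\sum_q t q *: F q + y *: psi) (cst 0) := z0.
have sL : square_integrable (\sum_q t q *: F q) by apply: sqi_sum => q _; exact: sqiZ.
have inn q : t q + y * inner psi (F q) = 0.
  have := inner_ae (sqiD sL (sqiZ y spsi)) (sqi_cst 0) (sF q) (sF q) z0 (ae_equal_refl _).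
  rewrite (innerDl sL (sqiZ y spsi) (sF q)) (innerZl _ spsi (sF q)).
  by rewrite (inner_build_lincomb mu0 muS mu_lam D) inner0l.
have y0 : y != 0.
  apply: contraNneq vi => yE; case: (unliftP ord_max i) => [q ->|->]; last exact/eqP.
  by have := inn q; rewrite yE mul0r addr0 => h; exact/eqP.
have tw m : t (w m) = 0.
  have := inn (w m); rewrite (inner_conj (sF _) spsi).
  by have := mp m 0; rewrite ek0 mul1r => ->; rewrite conjC0 mulr0 addr0.
have {z0} : ae_equal psi ((- (t ord_max / y)) *: FN).
  move: z0; rewrite big_ord_recr /= big1 ?add0r; last by move=> m _; rewrite tw scale0r.
  move=> z0; have := ae_equalD (ae_equalZ y^-1 z0) (ae_equal_refl (- (t ord_max / y) *: FN)).
  have -> : y^-1 *: (t ord_max *: FN + y *: psi) + - (t ord_max / y) *: FN = psi.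
    rewrite scalerDr !scalerA mulVf// scale1r [y^-1 * _]mulrC scaleNr addrAC subrr add0r//.
  by rewrite (_ : y^-1 *: cst 0 = 0) ?add0r// scaler0.
move=> h; exists (- (t ord_max / y)) => //; apply/eqP => z0; move: h; rewrite z0 scale0r => h.
have := inner_ae spsi (sqi0 R) spsi spsi h (ae_equal_refl _).
by rewrite inner_bl_psi_self// inner0l => /eqP; rewrite oner_eq0.
Qed.

End Zeros.

Variable (H : L2 R).
Hypothesis Hu : ae_equal H u.

Lemma build_shifted_eigenvectors : shifted_blaschke_eigenvectors H N.
Proof.
have [p p1 mp] := build_model; have [z z0 e] := build_psi_proportional p1 mp.
exists (lam N), (bl_psi p).
  by have := blaschke_bl_psi p1 0; rewrite expi0 scale1r.
move=> k; rewrite iter_shift.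
have nk := nice_ekM k (bl_psi_nice p1); have nkF := nice_ekM k (nF ord_max).
have ek_e : ae_equal (ek k%:Z * bl_psi p) (z *: (ek k%:Z * FN)).
  by rewrite scale_mulr; apply: ae_equalM => //; exact: ae_equal_refl.
have nu := build_pot_nice mu0 muS mu_lam D.
apply: (lax_of_ae mu0 muS mu_lam D Hu nk.1 (sqiZ (lam N + k%:R)%:C (nice_sqi nk))).
apply: (ae_equal_trans (lax_op_ae nu nk.1 (smoothZ z nkF.1) ek_e)).
apply: (ae_equal_trans (lax_opZ z nu nkF.1)).
have lt := lax_op_top mu0 muS mu_lam D k.
apply: (ae_equal_trans (ae_equalZ z lt)).
rewrite scalerA mulrC -scalerA; apply: ae_equalZ; exact: ae_equal_sym.
Qed.

Hypothesis lam_mu_N : mu N < lam N.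

(* Since [lam N > lam (N - 1) + 1], the eigenvalues [l + k] can only be those of the
   [S^j f_N]; then [f_0 .. f_M] all lie in a model space of dimension [M]. *)
Lemma build_index_le M : shifted_blaschke_eigenvectors H M -> (N <= M)%N.
Proof.
move=> [l [psi0 /blaschkeP[theta [p p1 ->]] L]]; rewrite leqNgt; apply/negP => MN.
set psi := expi theta *: bl_psi p in L.
have th1 : expi theta * (expi theta)^* = 1 by exact: expiK.
have th0 : expi theta != 0 by apply/eqP => e; move/eqP: th1; rewrite e mul0r eq_sym oner_eq0.
have npsi : nice psi := niceZ _ (bl_psi_nice p1).
have nk (k : nat) := nice_ekM k npsi.
have onpsi : inner psi psi = 1.
  have sb := nice_sqi (bl_psi_nice p1).
  by rewrite (innerZl _ sb (nice_sqi npsi)) (innerZr _ sb sb) mulrA th1 mul1r inner_bl_psi_self.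
have [f [bf ef lE _]] := build_spectrum mu0 muS mu_lam lamN D Hu.
have sphi n := (build_eigenfun_nice mu0 muS mu_lam D n).1.
have sf n : smooth (f n) by exact: (smooth_ae_trans (sphi n) (L2_sqi _) (ae_equal_sym (ef n))).
have Lk (k : nat) : exists n, l + k%:R = lam n.
  apply: (smooth_eigenvalue bf sf (g := ek k%:Z * psi)).
    by have := L k; rewrite iter_shift.
  by rewrite inner_ek_mul onpsi oner_eq0.
(* Consecutive eigenvalues are at least 1 apart, so two eigenvalues at distance exactly 1 are
   consecutive and enclose a closed gap. *)
have lam_succ n m : lam n + 1 = lam m -> m = n.+1 /\ lam n.+1 = mu n.+1.
  move=> e; have nm : (n < m)%N.
    rewrite ltnNge; apply/negP => mn.
    have : lam m <= lam n.
      move: mn; rewrite leq_eqVlt => /predU1P[->//|mn]; exact/ltW/(lt_lam bf).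
    by rewrite -e; lra.
  have := mu_lam n.+1; rewrite muS => h.
  have [mE|nm'] := eqVneq m n.+1.
    by split => //; rewrite e mE.
  have : lam n.+1 < lam m by apply: (lt_lam bf); rewrite ltn_neqAle eq_sym nm'.
  by rewrite -e; lra.
have [n0 ln0] := Lk 0%N.
have Lk' k : l + k%:R = lam (n0 + k) /\ (0 < k -> lam (n0 + k) = mu (n0 + k))%N.
  elim: k => [|k [IH _]]; first by rewrite addn0.
  have [m hm] := Lk k.+1.
  have [|mE gm] := lam_succ (n0 + k)%N m; first by rewrite -hm -IH -natr1 addrA.
  by rewrite hm mE addnS; split.
have Nn0 : (N <= n0)%N.
  rewrite leqNgt; apply/negP => n0N.
  have [_] := Lk' (N - n0)%N; rewrite subnKC ?(ltnW n0N)// => /(_ _).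
  by rewrite subn_gt0 => /(_ n0N) e; move: lam_mu_N; rewrite e ltxx.
have pr : ae_equal psi (inner psi (f n0) *: (f n0 : R -> C)).
  apply: (eigenfun_proportional bf sf); rewrite -ln0.
  by have := L 0%N.
have {pr} pr : ae_equal psi (inner psi (f n0) *: (ek (n0 - N)%N%:Z * FN)).
  apply: (ae_equal_trans pr); apply: ae_equalZ.
  by rewrite -(build_eigenfun_high U) subnKC.
set z := inner psi (f n0) in pr.
have nFN j := nice_ekM j (nF ord_max).
have hM (i : 'I_M.+1) : (i < N.+1)%N by apply: leq_trans (ltn_ord i) _; rewrite ltnS ltnW.
apply: (model_dim_le p1 (F := fun i => F (Ordinal (hM i)))).
- by move=> i; exact: hF.
- move=> i k.
  have sb := nice_sqi (nice_ekM k (bl_psi_nice p1)).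
  have sp := nice_sqi (nk k).
  suff e : inner (F (Ordinal (hM i))) (ek k%:Z * psi) = 0.
    move: e; rewrite -scale_mulr (innerZr _ sb (sF _)) => /eqP.
    by rewrite mulf_eq0 conjC_eq0 (negbTE th0) => /eqP.
  have sr := sqiZ z (nice_sqi (nFN (k + (n0 - N))%N)).
  have e : ae_equal (ek k%:Z * psi) (z *: (ek (k + (n0 - N))%N%:Z * FN)).
    rewrite PoszD ekD -mulrA scale_mulr; apply: ae_equalM => //; exact: ae_equal_refl.
  rewrite (inner_ae (sF _) (sF _) sp sr (ae_equal_refl _) e).
  rewrite (innerZr _ (nice_sqi (nFN _)) (sF _)).
  rewrite -(build_eigenfun_high U) -(build_eigenfun_low U) (build_eigenfun_orthonormal mu0 muS mu_lam D).
  rewrite /= ltn_eqF ?mulr0//.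
  by apply: (leq_trans (ltn_ord i)); apply: (leq_trans MN); exact: leq_addr.
- by move=> i j; rewrite onF.
Qed.

Lemma build_finite_gap : finite_gap H.
Proof.
split.
  exact: (hardy_ae_trans (smooth_hardy (build_pot_nice mu0 muS mu_lam D).1) (L2_sqi H) (ae_equal_sym Hu)).
exists N.+1 => // n Nn.
by rewrite (build_gap mu0 muS mu_lam lamN D Hu) lamN// subrr.
Qed.

(** With N = 0 the recursion is an empty sum and only frequency 0 survives; the constant is nonzero
    because the open gap forces c_0 a_0 > 0. *)
Lemma build_constant : N = 0%N -> exists2 z : C, z != 0 & ae_equal H (cst z).
Proof.
move=> N0; have nu := build_pot_nice mu0 muS mu_lam D; have su := nice_sqi nu.
have e : ae_equal u (fourier u 0 *: (1 : R -> C)).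
  apply: (hardy_inj (smooth_hardy nu.1)); first by rewrite -ek0; apply: hardyZ; exact: (hardy_ek R 0).
  move=> k; rewrite -[in RHS]ek0 (fourierZ _ _ (ek_sqi R 0)) fourier_ek.
  case: k => [|k]; first by rewrite mulr1.
  rewrite mulr0 (fourier_build_pot mu0 muS mu_lam D) big1// => q _ /=.
  by rewrite big1 ?mulr0// => -[m mN]; exfalso; rewrite N0 in mN.
exists (fourier u 0).
  apply/eqP => z0; move: e; rewrite z0 scale0r => e.
  have := inner_build_pot mu0 muS mu_lam D ord_max.
  rewrite (inner_ae su (sqi0 R) (sF _) (sF _) e (ae_equal_refl _)) inner0l => a0.
  have lam_mu m : lam m < mu m.+1 by rewrite muS ltrDl.
  have := gap_nondegenerate mu_lam D (m := ord_max).
  by rewrite /= gt_eqF// -a0 mulr0 ltxx => /(_ isT).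
apply: (ae_equal_trans Hu); apply: (ae_equal_trans e).
rewrite (_ : cst (fourier u 0) = fourier u 0 *: (1 : R -> C)); first exact: ae_equal_refl.
by apply/funext => x; change (fourier u 0 = fourier u 0 * 1); rewrite mulr1.
Qed.

Lemma build_calU : calU R N H.
Proof.
have [N0|N0] := posnP N; first by have := build_constant N0; rewrite N0.
have : finite_gap H /\ is_spectral_index H N.
  by split; [exact: build_finite_gap|split; [exact: build_shifted_eigenvectors|exact: build_index_le]].
by case: N N0.
Qed.

End BuildIndex.

(** * Potentials carrying a spectral model *)

Section SpectralModel.
Variable R : realType.
Local Notation C := R[i].
Opaque fourier inner circle_mean lax_form lax_op.

(** The meeting point of the two directions: points of [Omega R N] are realised by such potentials,
    and every element of [calU R N] is shown to be one. *)
Record spectral_model N (u : L2 R) (lam mu : nat -> R) U a c : Prop := {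
  model_mu0 : mu 0%N = 0;
  model_muS : forall m, mu m.+1 = lam m + 1;
  model_mu_lam : forall m, mu m <= lam m;
  model_lamN : forall n, (N < n)%N -> lam n = mu n;
  model_top : mu N < lam N;
  model_data : @gap_data R N lam mu U a c;
  model_pot : ae_equal u (build_pot U a) }.

(** Telescoping gamma_k = lam_k - lam_(k-1) - 1 = |z_k|^2 gives lam_n. *)
Definition eigenvalues_of (z : nat -> C) n : R := n%:R + \sum_(k < n.+1) sqnorm (z k).
Definition shifted_eigenvalues (lam : nat -> R) n : R := if n is m.+1 then lam m + 1 else 0.

Lemma eigenvalues_of_sub z n :
  eigenvalues_of z n - shifted_eigenvalues (eigenvalues_of z) n = sqnorm (z n).
Proof.
case: n => [|n]; first by rewrite /eigenvalues_of big_ord1 add0r subr0.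
by rewrite /= /eigenvalues_of big_ord_recr -natr1 /=; lra.
Qed.

Lemma sqnorm_ge0 (z : C) : 0 <= sqnorm z.
Proof. by rewrite addr_ge0// sqr_ge0. Qed.

Lemma sqnorm_eq0 (z : C) : (sqnorm z == 0) = (z == 0).
Proof. by case: z => x y; rewrite /sqnorm /= paddr_eq0 ?sqr_ge0// !sqrf_eq0 eq_complex. Qed.

Lemma norm_phase (z : C) : z != 0 -> `|phase z| = 1.
Proof. by move=> z0; rewrite /phase normrM normfV normr_id divff// normr_eq0. Qed.

Section Properties.
Variables (N : nat) (u : L2 R) (lam mu : nat -> R) (U : 'I_N.+1 -> 'I_N.+1 -> C) (a c : 'I_N.+1 -> C).
Hypothesis M : spectral_model u lam mu U a c.

Let mu0 := model_mu0 M.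
Let muS := model_muS M.
Let mu_lam := model_mu_lam M.
Let lamN := model_lamN M.
Let D := model_data M.
Let Hu := model_pot M.

Lemma model_lam_mu m : lam m < mu m.+1. Proof. by rewrite muS ltrDl. Qed.

Lemma model_birkhoff (p : 'I_N.+1) : birkhoff u p = (Num.sqrt (lam p - mu p))%:C * phase (a p).
Proof. exact: (build_birkhoff mu0 muS mu_lam lamN D Hu). Qed.

Lemma model_birkhoff_high n : (N < n)%N -> birkhoff u n = 0.
Proof. exact: (build_birkhoff_high mu0 muS mu_lam lamN D Hu). Qed.

Lemma sqnormE (z : C) : (sqnorm z)%:C = `|z| ^+ 2.
Proof. by rewrite norm_sqnorm -rmorphXn /= sqr_sqrtr// sqnorm_ge0. Qed.

Lemma model_sqnorm n : sqnorm (birkhoff u n) = lam n - mu n.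
Proof.
have [nN|Nn] := ltnP n N.+1; last first.
  by rewrite model_birkhoff_high// lamN// subrr; apply/eqP; rewrite sqnorm_eq0.
rewrite -[n]/(val (Ordinal nN)) model_birkhoff.
have [->|ne] := eqVneq (lam (Ordinal nN)) (mu (Ordinal nN)).
  by rewrite subrr sqrtr0 mul0r; apply/eqP; rewrite sqnorm_eq0.
have a0 : a (Ordinal nN) != 0.
  by have := gap_nondegenerate mu_lam D ne; apply: contraTneq => ->; rewrite mulr0 ltxx.
apply: (@complexI R); rewrite sqnormE normrM norm_phase// mulr1.
rewrite normc_def /= expr0n addr0 sqrtr_sqr ger0_norm ?sqrtr_ge0// -rmorphXn /= sqr_sqrtr//.
by rewrite subr_ge0.
Qed.

Lemma model_eigenvalues : lam = eigenvalues_of (birkhoff u).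
Proof.
apply/funext => n; rewrite /eigenvalues_of; elim: n => [|n IH].
  by rewrite big_ord1 model_sqnorm mu0 subr0 add0r.
by rewrite big_ord_recr /= model_sqnorm muS IH -natr1 /=; lra.
Qed.

Lemma model_shifted : mu = shifted_eigenvalues lam.
Proof. by apply/funext; case. Qed.

Lemma model_lambda : lambda u = lam.
Proof. by have [f [_ _]] := build_spectrum mu0 muS mu_lam lamN D Hu. Qed.

Lemma model_lambda0 : lambda u 0%N = sqnorm (birkhoff u 0%N).
Proof. by rewrite model_lambda model_sqnorm mu0 subr0. Qed.

Lemma model_Omega : Omega R N (birkhoff u).
Proof.
split; last exact: model_birkhoff_high.
by rewrite -sqnorm_eq0 model_sqnorm subr_eq0 gt_eqF// (model_top M).
Qed.

Lemma model_calU : calU R N u.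
Proof. exact: (build_calU mu0 muS mu_lam lamN D Hu (model_top M)). Qed.

Lemma model_phase (p : 'I_N.+1) : lam p != mu p -> phase (a p) = phase (birkhoff u p).
Proof.
move=> ne; rewrite model_birkhoff; set r := Num.sqrt _.
have r0 : 0 < r by rewrite sqrtr_gt0 subr_gt0 lt_neqAle eq_sym ne mu_lam.
have rC : (r%:C : C) != 0 by rewrite real_complex_eq0 gt_eqF.
have nr : `|(r%:C : C)| = r%:C by rewrite gtr0_norm// ltcR.
have a0 : a p != 0.
  by have := gap_nondegenerate mu_lam D ne; apply: contraTneq => ->; rewrite mulr0 ltxx.
by rewrite [in RHS]/phase normrM nr norm_phase// mulr1 mulrC mulKf.
Qed.

End Properties.

(** The moduli of the coordinates give [lam] and [mu], their phases those of [a], and then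
    [gap_data_unique] gives the matrix, from which the potential is built. *)
Lemma model_inj N (u u' : L2 R) lam mu U a c lam' mu' U' a' c' :
  @spectral_model N u lam mu U a c -> @spectral_model N u' lam' mu' U' a' c' ->
  birkhoff u = birkhoff u' -> u = u'.
Proof.
move=> M M' e.
have el : lam' = lam by rewrite (model_eigenvalues M) (model_eigenvalues M') e.
have em : mu' = mu by rewrite (model_shifted M) (model_shifted M') el.
subst lam' mu'.
have ph (m : 'I_N.+1) : lam m != mu m -> phase (a m) = phase (a' m).
  by move=> ne; rewrite (model_phase M ne) (model_phase M' ne) e.
have [eU ea] := gap_data_unique (model_mu_lam M) (model_lam_mu M) (model_data M) (model_data M') ph.
have eU' : U = U' by apply/funext => m; apply/funext => p; exact: eU.
have ea' : a = a' by apply/funext.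
apply: L2_eq; apply: (ae_equal_trans (model_pot M)).
by rewrite eU' ea'; exact: ae_equal_sym (model_pot M').
Qed.

Lemma model_exists N (z : nat -> C) : Omega R N z ->
  exists (u : L2 R) lam mu U a c, @spectral_model N u lam mu U a c /\ birkhoff u = z.
Proof.
move=> [zN z0]; pose lam := eigenvalues_of z; pose mu := shifted_eigenvalues lam.
have lm n : lam n - mu n = sqnorm (z n) by exact: eigenvalues_of_sub.
have mu_lam m : mu m <= lam m by rewrite -subr_ge0 lm sqnorm_ge0.
have lamN n : (N < n)%N -> lam n = mu n.
  by move=> Nn; apply/eqP; rewrite -subr_eq0 lm sqnorm_eq0 z0.
have lam_mu m : lam m < mu m.+1 by rewrite ltrDl.
have zn0 m : (lam m != mu m) = (z m != 0) by rewrite -subr_eq0 lm sqnorm_eq0.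
have [|U [a [c [D ph]]]] := @gap_data_exists R N lam mu mu_lam lam_mu (fun p => phase (z p)).
  by move=> m; rewrite zn0; exact: norm_phase.
have nu := build_pot_nice (erefl : mu 0%N = 0) (fun=> erefl) mu_lam D.
have [u Hu] := L2_of (nice_sqi nu).
have M : spectral_model u lam mu U a c.
  by split => //; rewrite lt_neqAle mu_lam eq_sym zn0 zN.
exists u, lam, mu, U, a, c; split => //; apply/funext => n.
have [nN|Nn] := ltnP n N.+1; last by rewrite (model_birkhoff_high M)// z0.
rewrite -[n]/(val (Ordinal nN)) (model_birkhoff M) lm [RHS]phase_norm norm_sqnorm.
have [->|zn] := eqVneq (z (Ordinal nN)) 0.
  by rewrite (_ : sqnorm 0 = 0) ?sqrtr0 ?mul0r//; apply/eqP; rewrite sqnorm_eq0.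
by rewrite ph// zn0.
Qed.

End SpectralModel.

(** * Spectral data of a finite-gap potential *)

Section SpectralMatrix.
Variable R : realType.
Local Notation C := R[i].
Opaque fourier inner circle_mean lax_form lax_op.
Variables (N : nat) (lam mu : nat -> R).
Hypotheses (mu0 : mu 0%N = 0) (muS : forall m, mu m.+1 = lam m + 1)
  (lam_mono : forall i j, (i < j)%N -> lam i < lam j).
Local Notation I := 'I_N.+1.
Local Notation w := (widen_ord (leqnSn N)).
Local Notation s := (lift (@ord0 N)).
Variables (v : R -> C) (f : I -> R -> C).
Hypotheses (nv : nice v) (sf : forall p, smooth (f p))
  (onf : forall p q, inner (f p) (f q) = (p == q)%:R)
  (eigf : forall p, lax v (f p) ((lam p)%:C *: f p)).

Definition transported (m : I) : R -> C := if unlift ord0 m is Some j then ek 1 * f (w j) else 1.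
Local Notation h := transported.
Hypotheses (exph : forall m, ae_equal (h m) (\sum_p inner (h m) (f p) *: f p))
  (expv : ae_equal v (\sum_p inner v (f p) *: f p)).

Lemma transported0 : h ord0 = 1. Proof. by rewrite /h unlift_none. Qed.
Lemma transportedS m : h (s m) = ek 1 * f (w m). Proof. by rewrite /h liftK. Qed.

Let U (m p : I) := inner (h m) (f p).
Let a (p : I) := inner v (f p).
Let c (m : I) := inner (h m) v.

Let sq p := smooth_sqi (sf p).
Let sv := nice_sqi nv.

Lemma transported_smooth m : smooth (h m).
Proof.
rewrite /h; case: unliftP => [j _|_]; first exact: smooth_shift.
by rewrite -ek0; exact: (smooth_ek R 0).
Qed.
Let sh := transported_smooth.
Let shq m := smooth_sqi (sh m).

Let sL (x : I -> C) : square_integrable (\sum_p x p *: f p).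
Proof. by apply: sqi_sum => p _; exact: sqiZ. Qed.

Lemma transported_orthonormal m m' : inner (h m) (h m') = (m == m')%:R.
Proof.
have h1 p := smooth_hardy (sf p).
case: (unliftP ord0 m) => [j ->|->]; case: (unliftP ord0 m') => [j' ->|->].
- rewrite !transportedS inner_ek_mul onf (inj_eq (@lift_inj _ _)); congr (nat_of_bool _)%:R.
- by rewrite transportedS transported0 inner_shift_one// eq_sym (negbTE (neq_lift _ _)).
- by rewrite transportedS transported0 inner_one_shift// (negbTE (neq_lift _ _)).
- by rewrite !transported0 -ek0 inner_ek !eqxx.
Qed.

Lemma inner_lincomb_on (x : I -> C) p : inner (\sum_q x q *: f q) (f p) = x p.
Proof.
rewrite (inner_lincomb2 _ sq (sq p)) (bigD1 p)//= onf eqxx mulr1 big1 ?addr0// => q qp.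
by rewrite onf (negbTE qp) mulr0.
Qed.

Lemma inner_transported g m : square_integrable g -> ae_equal g (\sum_p inner g (f p) *: f p) ->
  inner g (h m) = \sum_p inner g (f p) * (U m p)^*.
Proof.
move=> sg eg; rewrite (inner_ae sg (sL _) (shq m) (sL _) eg (exph m)).
rewrite (inner_lincomb2 _ sq (sL _)); apply: eq_bigr => p _.
by rewrite (inner_conj (sL _) (sq p)) inner_lincomb_on.
Qed.

(** The rows are orthonormal because the transported vectors are and lie in the span of the f_p; the
    columns follow, the matrix being square. *)
Lemma spectral_columns p q : \sum_m (U m p)^* * U m q = (p == q)%:R.
Proof.
have rows m m' : \sum_p U m p * (U m' p)^* = (m == m')%:R.
  by rewrite -transported_orthonormal (inner_transported m' (shq m) (exph m)).
have := @unitary_rows R N (fun p m => (U m p)^*).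
move=> /(_ _ p q) <-; last by move=> m m'; rewrite -[RHS]rows; apply: eq_bigr => r _; rewrite conjCK.
by apply: eq_bigr => m _; rewrite conjCK.
Qed.

Lemma lax_transported (m : I) : lax v (h m) ((mu m)%:C *: h m + c m *: v).
Proof.
apply: (lax_of_lax_op nv (sh m)); first by apply: sqiD; exact: sqiZ.
rewrite /c; case: (unliftP ord0 m) => [j ->|->]; last first.
  by rewrite transported0 mu0 scale0r add0r; exact: lax_op1.
rewrite transportedS (_ : (mu (s j))%:C = (lam j)%:C + 1); last by rewrite muS rmorphD.
apply: (ae_equal_trans (lax_op_shift nv (sf _))).
rewrite scalerDl scale1r; apply: ae_equalD; last exact: ae_equal_refl.
apply: ae_equalD; last exact: ae_equal_refl.
rewrite scale_mulr; apply: ae_equalM; first exact: ae_equal_refl.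
exact: (lax_unique (lax_lax_op nv (sf _)) (eigf (w j))).
Qed.

Lemma inner_rscale (r : R) g k : square_integrable g -> square_integrable k ->
  inner g (r%:C *: k) = r%:C * inner g k.
Proof.
by move=> sg sk; rewrite (innerZr _ sk sg); congr (_ * _); exact: conjc_real.
Qed.

(** Symmetry of L between a transported vector and an eigenvector. *)
Lemma spectral_commutator (m p : I) : (lam p - mu m)%:C * U m p = c m * a p.
Proof.
have e := lax_sym (sh m) (lax_transported m) (eigf p).
rewrite (innerDl (sqiZ _ (shq m)) (sqiZ _ sv) (sq p)) (innerZl _ (shq m) (sq p)) in e.
rewrite (innerZl _ sv (sq p)) inner_rscale// -/(U m p) -/(a p) in e.
by rewrite rmorphB /= mulrBl -e addrAC subrr add0r.
Qed.

Lemma spectral_expansion p : a p = \sum_m (c m)^* * U m p.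
Proof.
under eq_bigr => m _.
  rewrite -(inner_conj (shq m) sv) (inner_transported m sv expv) mulr_suml.
  under eq_bigr => q _ do rewrite -mulrA.
  over.
rewrite exchange_big /= (bigD1 p)//= -mulr_sumr spectral_columns eqxx mulr1 big1 ?addr0// => q qp.
by rewrite -mulr_sumr spectral_columns (negbTE qp) mulr0.
Qed.

(* A nonzero [V] in the span of [f_0 .. f_m] is orthogonal to the first [m] transported
   vectors, and [quad_form] compares its two energies. *)
Lemma courant_fischer (t : R) (m : I) : (forall j : I, (m <= j)%N -> t <= mu j) -> t <= lam m.
Proof.
move=> tmu.
pose wi : 'I_m.+1 -> I := widen_ord (ltn_ord m).
pose wj : 'I_m -> I := widen_ord (ltnW (ltn_ord m)).
pose A : 'M[C]_(m.+1, m) := \matrix_(i, j) (U (wj j) (wi i))^*.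
have : kermx A != 0.
  by rewrite kermx_eq0 /row_free; apply: contraTneq (rank_leq_col A) => ->; rewrite ltnn.
move/rowV0Pn => [x /sub_kermxP xA xn0].
pose V (p : I) : C := \sum_i x 0 i * (wi i == p)%:R.
have Vw i : V (wi i) = x 0 i.
  rewrite /V (bigD1 i)//= eqxx mulr1 big1 ?addr0// => j ji.
  rewrite (_ : (_ == _) = false) ?mulr0//; apply: contraNF ji => /eqP e.
  by apply/eqP/val_inj; have := congr1 val e.
have V0 (p : I) : (m < p)%N -> V p = 0.
  move=> mp; apply: big1 => i _; rewrite (_ : (_ == _) = false) ?mulr0//.
  apply: contraTF mp => /eqP <-; rewrite -leqNgt; exact: (ltn_ord i).
pose W (j : I) := \sum_p (U j p)^* * V p.
have W0 (j : I) : (j < m)%N -> W j = 0.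
  move=> jm; have := congr1 (fun B : 'rV[C]_m => B 0 (Ordinal jm)) xA; rewrite !mxE => e.
  rewrite -[RHS]e /W /V.
  under eq_bigr => p _ do rewrite mulr_sumr.
  rewrite exchange_big /=; apply: eq_bigr => i _.
  rewrite (bigD1 (wi i))//= eqxx mulr1 big1 ?addr0.
    rewrite mulrC mxE (_ : wj (Ordinal jm) = j)//; exact: val_inj.
  by move=> p pi; rewrite eq_sym (negbTE pi) !mulr0.
have q := quad_form spectral_columns spectral_commutator spectral_expansion V.
have q1 : \sum_(p : I) V p * (V p)^* = \sum_(p : I) W p * (W p)^*.
  have c1 (r p : I) : ((1 - 1 : R)%:C : C) * U r p = 0 * 0 by rewrite subrr mul0r mul0r.
  have c2 (p : I) : 0 = \sum_m 0^* * U m p by rewrite big1// => r _; rewrite conjC0 mul0r.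
  have := @quad_form R N (fun=> 1) (fun=> 1) U (fun=> 0) (fun=> 0) spectral_columns c1 c2 V.
  rewrite /= [in X in _ = _ + X * _]big1 ?mul0r ?addr0 => [|p _]; last by rewrite mul0r.
  by under eq_bigr do rewrite mul1r; under [in RHS]eq_bigr do rewrite mul1r.
have S0 : 0 < \sum_(p : I) V p * (V p)^*.
  have [i xi] : exists i, x 0 i != 0.
    by apply/existsP; apply: contraNT xn0 => /existsPn x0; apply/eqP/rowP => i; rewrite mxE; apply/eqP; have := x0 i; rewrite negbK.
  rewrite lt_neqAle sumr_ge0 ?andbT; last by move=> p _; exact: mul_conjC_ge0.
  rewrite eq_sym psumr_neq0; last by move=> p _; exact: mul_conjC_ge0.
  by apply/hasP; exists (wi i); rewrite ?mem_index_enum//= Vw lt_neqAle mul_conjC_ge0 eq_sym mul_conjC_eq0 xi.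
rewrite -lecR -(ler_pM2r S0).
have le1 : \sum_(p : I) (lam p)%:C * (V p * (V p)^*) <= (lam m)%:C * \sum_(p : I) V p * (V p)^*.
  rewrite mulr_sumr; apply: ler_sum => p _.
  have [mp|pm] := ltnP m p; first by rewrite V0// !mul0r !mulr0.
  rewrite ler_wpM2r ?mul_conjC_ge0// lecR.
  by move: pm; rewrite leq_eqVlt => /predU1P[->//|/lam_mono/ltW].
apply: le_trans le1; rewrite q.
apply: (le_trans _ (y := \sum_(j : I) (mu j)%:C * (W j * (W j)^*))); last first.
  by rewrite lerDl mul_conjC_ge0.
rewrite q1 mulr_sumr; apply: ler_sum => j _.
have [jm|mj] := ltnP j m; first by rewrite W0// !mul0r !mulr0.
by rewrite ler_wpM2r ?mul_conjC_ge0// lecR tmu.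
Qed.

(** The order of mu_0 = 0 and mu_1 = lam_0 + 1 is not known beforehand. If lam_0 + 1 were at most 0,
    it would bound every mu_j from below and [courant_fischer] would give lam_0 + 1 <= lam_0; so 0
    is the lower bound, and it passes to lam_0. *)
Lemma spectral_lam_ge0 : 0 <= lam 0%N.
Proof.
have H (t : R) : t <= 0 -> t <= lam 0%N + 1 -> t <= lam 0%N.
  move=> t0 t1; apply: (@courant_fischer t ord0) => -[[|j] jN] _ /=; first by rewrite mu0.
  rewrite muS; apply: (le_trans t1); rewrite lerD2r.
  by case: j {jN} => [//|j]; apply/ltW/lam_mono.
have := H 0 (lexx _); have := H (lam 0%N + 1); lra.
Qed.

Lemma spectral_mu_lam m : (m <= N)%N -> mu m <= lam m.
Proof.
move=> mN; have := @courant_fischer (mu m) (Ordinal (mN : (m < N.+1)%N)); apply => /= j.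
case: m {mN} => [_|m].
  rewrite mu0; case: (val j) => [|k]; rewrite ?mu0// muS.
  have : lam 0%N <= lam k by case: k => [//|k]; apply/ltW/lam_mono.
  by have := spectral_lam_ge0; lra.
case: (val j) => [//|k]; rewrite !muS lerD2r ltnS leq_eqVlt => /predU1P[->//|h].
exact/ltW/lam_mono.
Qed.

(* Otherwise [c m = 0] or [a m = 0], so that a whole row or column of [U] would be
   concentrated off the diagonal, at an index excluded by interlacing. *)
Lemma spectral_diagonal_neq0 (m : I) : U m m != 0.
Proof.
have lm i : (i <= N)%N -> mu i <= lam i := @spectral_mu_lam i.
have lt_mu i j : (i < j)%N -> lam i < mu j.
  case: j => // j; rewrite ltnS muS leq_eqVlt => /predU1P[->|/lam_mono]; lra.
have inj (i j : I) : lam i = mu j -> i = j.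
  move=> e; apply/val_inj; have [ij|ji|//] := ltngtP i j.
    by have := lt_mu _ _ ij; rewrite e ltxx.
  have h1 := lm j (ltn_ord j : (j <= N)%N); by have := @lam_mono j i ji; rewrite e => /lt_le_trans/(_ h1); rewrite ltxx.
apply/eqP => U0; have := spectral_commutator m m; rewrite U0 mulr0 => /esym/eqP.
have lm0 (i j : I) : (lam i - mu j)%:C * U j i = 0 -> i != j -> U j i = 0.
  move=> /eqP; rewrite mulf_eq0 real_complex_eq0 subr_eq0 => /orP[/eqP/inj ->|/eqP//].
  by rewrite eqxx.
rewrite mulf_eq0 => /orP[/eqP c0|/eqP a0].
  have := transported_orthonormal m m; rewrite (inner_transported m (shq m) (exph m)) eqxx big1.
    by move/eqP; rewrite eq_sym oner_eq0.
  move=> p _; have [->|pm] := eqVneq p m; first by rewrite [inner _ _]U0 mul0r.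
  have -> : inner (h m) (f p) = 0 by apply: (lm0 p m) => //; rewrite spectral_commutator c0 mul0r.
  by rewrite mul0r.
have := spectral_columns m m; rewrite eqxx big1; first by move/eqP; rewrite eq_sym oner_eq0.
move=> p _; have [->|pm] := eqVneq p m; first by rewrite U0 mulr0.
have -> : U p m = 0 by apply: (lm0 m p); rewrite 1?eq_sym// spectral_commutator a0 mulr0.
by rewrite mulr0.
Qed.

Lemma spectral_gap_data : (forall m, 0 < U m m) -> gap_data lam mu U a c.
Proof.
by move=> g; split => //; [exact: spectral_columns|exact: spectral_commutator|exact: spectral_expansion].
Qed.

Lemma spectral_expand p : ae_equal (f p) (\sum_m (U m p)^* *: h m).
Proof.
apply: ae_equal_sym; have e1 : ae_equal (\sum_m (U m p)^* *: h m) (\sum_m (U m p)^* *: (\sum_q U m q *: f q)).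
  by apply: ae_equal_sum => m; apply: ae_equalZ; exact: exph.
apply: (ae_equal_trans e1).
have -> : \sum_m (U m p)^* *: (\sum_q U m q *: f q) = f p.
  under eq_bigr => m _ do (rewrite scaler_sumr; under eq_bigr => q _ do rewrite scalerA).
  rewrite exchange_big /= (bigD1 p)//= -scaler_suml spectral_columns eqxx scale1r big1 ?addr0// => q qp.
  by rewrite -scaler_suml spectral_columns eq_sym (negbTE qp) scale0r.
exact: ae_equal_refl.
Qed.

(** The unitary matrix inverts the expansion of the transported vectors, so the coefficients of the
    f_p obey the recursion of [build_coef] and are determined by [U]. *)
Lemma spectral_coef (k : nat) p : fourier (f p) k%:Z = build_coef U k p.
Proof.
have sT q : square_integrable (\sum_m (U m q)^* *: h m) by apply: sqi_sum => m _; exact: sqiZ.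
elim: k p => [|k IH] p; rewrite (fourier_ae _ (sq p) (sT p) (spectral_expand p)) (fourier_lincomb _ _ shq) big_ord_recl.
  rewrite big1 ?addr0 => [|m _]; first by rewrite transported0 -ek0 fourier_ek mulr1.
  by rewrite transportedS fourier_ekM (smooth_hardy (sf _)).2 ?mulr0.
rewrite transported0 -ek0 fourier_ek mulr0 add0r; apply: eq_bigr => m _.
by rewrite transportedS fourier_ekM predz IH.
Qed.

Lemma spectral_potential : (forall m, mu m <= lam m) -> (forall m, 0 < U m m) ->
  ae_equal v (build_pot U a).
Proof.
move=> ml g; have D := spectral_gap_data g.
have nu := build_pot_nice mu0 muS ml D.
apply: (hardy_inj (smooth_hardy nv.1) (smooth_hardy nu.1)) => k.
rewrite (fourier_build_pot mu0 muS ml D) (fourier_ae _ sv (sL _) expv) (fourier_lincomb _ _ sq).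
by apply: eq_bigr => p _; rewrite spectral_coef.
Qed.

End SpectralMatrix.

(** * Consequences of having shifted Blaschke eigenvectors *)

Section BlaschkeEigenvectors.
Variable R : realType.
Local Notation C := R[i].
Opaque fourier inner circle_mean lax_form.
Implicit Types (f g h u : R -> C).

Lemma szego_ek u (j : nat) : hardy u -> ae_equal (szego (cj u * ek j%:Z))
  (\sum_(n < j.+1) (fourier u (j - n)%N%:Z)^* *: ek n%:Z).
Proof.
move=> hu; have sz := szego_smooth hu (smooth_ek R j).
have hs : hardy (szego (cj u * ek j%:Z)).
  by split; [exact: L2_sqi|move=> k k0; rewrite sz leNgt k0].
have se (n : 'I_j.+1) : square_integrable (@ek R n%:Z) by exact: ek_sqi.
apply: (hardy_inj hs).
  by apply: hardy_sum => n _; apply: hardyZ; exact: hardy_ek.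
move=> k; rewrite sz /= (fourier_lincomb _ _ se) fourier_cjM.
under [RHS]eq_bigr => n _ do rewrite fourier_ek.
rewrite (@sum_delta R j.+1 (fun n => (fourier u (j - n)%N%:Z)^*) k).
have su := hardy_sqi hu.
have e : inner (ek j%:Z) (u * ek k%:Z) = (fourier u (j%:Z - k%:Z))^*.
  rewrite fourierE (inner_conj (mul_ek_sqi k%:Z su) (ek_sqi _ _)); congr (_ ^*).
  by rewrite [u * _]mulrC inner_bounded_mul cj_ek -ekD [- _ + _]addrC.
rewrite e ltnS; have [kj|jk] := leqP k j; first by rewrite subzn.
by rewrite hu.2 ?conjC0// subr_lt0 ltz_nat.
Qed.

Lemma lax_form_ek u g (j : nat) : hardy u -> smooth g -> lax_form u g (ek j%:Z) =
  j%:R * fourier g j%:Z + \sum_(n < j.+1) fourier u (j - n)%N%:Z * inner g (u * ek n%:Z).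
Proof.
move=> hu sg; rewrite lax_formE; congr (_ + _).
  rewrite (_ : (fun k => _) = (fun k : nat => fourier (diff_op g) k%:Z * (fourier (ek j%:Z) k%:Z)^*)).
    rewrite (inner_smooth (diff_op_nice sg).1 (ek_sqi _ _)) -fourierE.
    exact: fourier_diff_op.
  by apply/funext => k; rewrite fourier_diff_op// mulrA.
have sz := szego_smooth hu sg.
have se (n : 'I_j.+1) : square_integrable (@ek R n%:Z) by exact: ek_sqi.
have sS : square_integrable (\sum_(n < j.+1) (fourier u (j - n)%N%:Z)^* *: ek n%:Z).
  by apply: sqi_sum => n _; apply: sqiZ; exact: ek_sqi.
rewrite (inner_ae (L2_sqi _) (L2_sqi _) (L2_sqi _) sS (ae_equal_refl _) (szego_ek j hu)).
rewrite (inner_lincombr _ se (L2_sqi _)); apply: eq_bigr => n _.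
by rewrite conjCK -fourierE sz /= fourier_cjM.
Qed.

(* Comparing the Fourier coefficients of the eigenvalue equations of [S^k psi] and
   [S^(k+1) psi] leaves [u^(j) <S^(k+1) psi | u> = 0]. *)
Lemma eigenvector_shift_orthogonal u psi (l : R) : hardy u -> ~ ae_equal u (cst 0) -> nice psi ->
  (forall k : nat, lax u (ek k%:Z * psi) ((l + k%:R)%:C *: (ek k%:Z * psi))) ->
  forall k : nat, inner (ek k.+1%:Z * psi) u = 0.
Proof.
move=> hu un0 np L k; have nk i := nice_ekM i np; have sk i := nice_sqi (nk i).
have E (i j : nat) : j%:R * fourier (ek i%:Z * psi) j%:Z +
    \sum_(n < j.+1) fourier u (j - n)%N%:Z * inner (ek i%:Z * psi) (u * ek n%:Z) =
    (l + i%:R)%:C * fourier (ek i%:Z * psi) j%:Z.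
  have [_ _ H] := L i.
  have := H _ (hardy_half_smooth (smooth_ek R j)).
  rewrite lax_form_ek//; last exact: (nk i).1.
  by move=> ->; rewrite (innerZl _ (sk i) (ek_sqi _ _)) -fourierE.
have ik (n : nat) : inner (ek k.+1%:Z * psi) (u * ek n.+1%:Z) = inner (ek k%:Z * psi) (u * ek n%:Z).
  have -> : u * ek n.+1%:Z = ek 1 * (u * ek n%:Z) by rewrite [RHS]mulrCA -ekD.
  by rewrite ekS_mul inner_ek_mul.
have fk j : fourier (ek k.+1%:Z * psi) j.+1%:Z = fourier (ek k%:Z * psi) j%:Z.
  by rewrite ekS_mul fourier_ekM predz.
have f0 : fourier (ek k.+1%:Z * psi) 0 = 0.
  by rewrite ekS_mul fourier_ekM (smooth_hardy (nk k).1).2.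
set eta := inner _ u.
have H (j : nat) : fourier u j%:Z * eta = 0.
  case: j => [|j].
    have := E k.+1 0%N; rewrite big_ord1 f0 !mulr0 add0r /= subn0 ek0 mulr1; exact.
  have := E k.+1 j.+1; rewrite big_ord_recl /= subn0 ek0 mulr1 -/eta fk.
  have := E k j; under [X in _ -> _ + (_ + X) = _ -> _]eq_bigr => n _ do rewrite ik.
  move=> e1 e2; have e3 : \sum_(i < j.+1) fourier u (j.+1 - fintype.bump 0 i)%N%:Z * inner (ek k%:Z * psi) (u * ek i%:Z) =
     \sum_(n < j.+1) fourier u (j - n)%N%:Z * inner (ek k%:Z * psi) (u * ek n%:Z) by [].
  rewrite e3 in e2; move: e1 e2; set S := \sum_(n < _) _; set x := fourier (ek _ * _) _ => e1 e2.
  have -> : fourier u j.+1%:Z * eta = (j.+1%:R * x + (fourier u j.+1%:Z * eta + S)) - (j%:R * x + S) - x.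
    by rewrite -natr1; ring.
  by rewrite e1 e2 -natr1 !rmorphD rmorph1 /=; ring.
apply/eqP; apply/negPn/negP => eta0; apply: un0.
apply: (hardy_inj hu (hardy0 R)) => j; rewrite [RHS]fourierE inner0l.
by have /eqP := H j; rewrite mulf_eq0 (negbTE eta0) orbF => /eqP.
Qed.

(** For u = 0 the operator is -i d/dx and psi = 1 works, so a potential of positive index is
    nonzero. *)
Lemma zero_potential_index u : square_integrable u -> ae_equal u (cst 0) ->
  shifted_blaschke_eigenvectors u 0%N.
Proof.
move=> su u0; have n0 : nice (0 : R -> C) by have := niceZ 0 (nice1 R); rewrite scale0r.
pose p (k : 'I_0) : C := 0; have p1 k : `|p k| < 1 by rewrite normr0 ltr01.
exists 0, 1.
  have := blaschke_bl_psi p1 0; rewrite expi0 scale1r.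
  by rewrite /bl_psi /bl_num /bl_iden !big_ord0 mulr1.
move=> k; rewrite iter_shift mulr1 add0r.
have sk := smooth_ek R k; have sqk := smooth_sqi sk.
have sc : square_integrable (((k%:R : R)%:C : C) *: ek k%:Z) by exact: sqiZ.
apply: (lax_ae (nice_sqi n0) su sqk sc (ae_equal_sym u0) (ae_equal_refl _) _ (lax_lax_op n0 sk)).
have -> : lax_op (0 : R -> C) (ek k%:Z) = diff_op (ek k%:Z).
  apply/funext => x.
  change (diff_op (ek k%:Z) x + 0 * toeplitz_conj (0 : R -> C) (ek k%:Z) x = diff_op (ek k%:Z) x).
  by rewrite mul0r addr0.
apply: (hardy_inj (smooth_hardy (diff_op_nice sk).1) (hardyZ _ (smooth_hardy sk))) => j.
rewrite fourier_diff_op// (fourierZ _ _ sqk) !fourier_ek.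
by have [[->]|_] := eqVneq (k%:Z) (j%:Z); rewrite ?mulr0// rmorph_nat.
Qed.

(** Without any eigenbasis [lambda u] would be its default value, the zero sequence, whose gaps at
    positive indices are -1 and not 0. *)
Lemma finite_gap_eigenbasis u : finite_gap u -> exists f : nat -> L2 R, eigenbasis u (lambda u) f.
Proof.
move=> [_ [[|m]// _ g]].
have [e|ne] := pselect (exists lam, exists f : nat -> L2 R, eigenbasis u lam f).
  have [lam bl] := e; exact: (@xgetI _ (cst 0) [set l | exists f : nat -> L2 R, eigenbasis u l f] lam bl).
have : gap u m.+1 = 0 by exact: g.
rewrite /gap /lambda xgetPN; first by move=> /eqP; rewrite /= subrr sub0r oppr_eq0 oner_eq0.
by move=> lam [f bf]; apply: ne; exists lam, f.
Qed.

End BlaschkeEigenvectors.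

Section BlaschkeConstantTerm.
Variable R : realType.
Local Notation C := R[i].
Opaque fourier inner circle_mean lax_form lax_op.

(** Constant terms of these Hardy factors multiply: 1 / den contributes 1 and num contributes prod
    (- conj(p_k)). *)
Lemma bl_psi_constant_term N (p : 'I_N -> C) : (forall k, `|p k| < 1) ->
  fourier (bl_psi p) 0 = 0 -> exists k, p k = 0.
Proof.
move=> p1; have ni := bl_iden_nice p1.
have den (s : seq 'I_N) g : nice g ->
    fourier (\prod_(k <- s) (1 - p k *: ek 1) * g) 0 = fourier g 0.
  move=> ng; elim: s => [|k s IH]; first by rewrite big_nil mul1r.
  rewrite big_cons -mulrA.
  have ns := prod_den_nice p s ng.
  by rewrite (fourier_sub_scale _ _ (nice_sqi ns)) IH (smooth_hardy ns.1).2// mulr0 subr0.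
have num (s : seq 'I_N) g : nice g -> nice (\prod_(k <- s) (ek 1 - cst (p k)^*) * g) /\
    fourier (\prod_(k <- s) (ek 1 - cst (p k)^*) * g) 0 = \prod_(k <- s) (- (p k)^*) * fourier g 0.
  move=> ng; elim: s => [|k s [ns IH]]; first by rewrite !big_nil !mul1r.
  rewrite !big_cons -mulrA; split; first exact: shift_sub_nice.
  set q := _ * g in ns IH *.
  have -> : (ek 1 - cst (p k)^*) * q = ek 1 * q + (- (p k)^*) *: q.
    by apply/funext => x; change ((ek 1 x - (p k)^*) * q x = ek 1 x * q x + - (p k)^* * q x); ring.
  have sq := nice_sqi ns.
  rewrite (fourierD _ (ek_mul_sqi 1 sq) (sqiZ _ sq)) fourier_ekM (fourierZ _ _ sq) IH.
  by rewrite (smooth_hardy ns.1).2// add0r mulrA.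
have i1 : fourier (bl_iden p) 0 = 1.
  rewrite -(den (index_enum 'I_N) _ ni) -/(bl_den p) bl_den_iden// -ek0 fourier_ek//.
have [_ e] := num (index_enum 'I_N) _ ni; rewrite /bl_psi /bl_num e i1 mulr1 => /eqP.
by rewrite prodf_seq_eq0 => /hasP[k _ /=]; rewrite oppr_eq0 conjC_eq0 => /eqP; exists k.
Qed.

End BlaschkeConstantTerm.

Section Expansions.
Variable R : realType.
Local Notation C := R[i].
Opaque fourier inner circle_mean lax_form lax_op.
Variables (u : R -> C) (lam : nat -> R) (f : nat -> L2 R).
Hypothesis bf : eigenbasis u lam f.

Let onf m n : inner (f m) (f n) = (m == n)%:R. Proof. exact: (eigenvector_orthonormal bf). Qed.
Let sq n : square_integrable (f n) := L2_sqi (f n).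
Let hf n : hardy (f n). Proof. by have [[]] := eigenvector_lax bf n. Qed.

Lemma finite_expansion g m : hardy g -> (forall n, (m < n)%N -> inner g (f n) = 0) ->
  ae_equal g (\sum_(p < m.+1) inner g (f p) *: (f p : R -> C)).
Proof.
move=> hg g0; have sg := hardy_sqi hg.
have hL : hardy (\sum_(p < m.+1) inner g (f p) *: (f p : R -> C)).
  by apply: hardy_sum => p _; exact: hardyZ.
have sL := hardy_sqi hL.
have := eigenvector_total bf (hardyB hg hL); have z n : inner (g - \sum_(p < m.+1) inner g (f p) *: (f p : R -> C)) (f n) = 0.
  rewrite (innerBl sg sL (sq n)) (inner_lincomb2 _ (fun p : 'I_m.+1 => sq p) (sq n)).
  have [nm|mn] := ltnP n m.+1; last first.
    rewrite g0// big1 ?subrr// => p _; rewrite onf ltn_eqF ?mulr0//.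
    exact: (leq_trans (ltn_ord p)).
  rewrite (bigD1 (Ordinal nm))//= onf eqxx mulr1 big1 ?addr0 ?subrr// => p pn.
  by rewrite onf (_ : (p == n :> nat) = false) ?mulr0//; apply: contraNF pn => /eqP e; apply/eqP/val_inj.
move=> /(_ z) d; have := ae_equalD d (ae_equal_refl (\sum_(p < m.+1) inner g (f p) *: (f p : R -> C))).
by rewrite subrK add0r.
Qed.

(** The counterpart of [eigenfun_proportional] when regularity is known for [g] but not for the
    basis. *)
Lemma smooth_eigenfun_proportional g n : smooth g -> lax u g ((lam n)%:C *: g) ->
  ae_equal g (inner g (f n) *: (f n : R -> C)).
Proof.
move=> smg lg; have sg := smooth_sqi smg; have hg := smooth_hardy smg.
have z m : m != n -> inner g (f m) = 0.
  move=> mn; apply: (eigen_orthogonal smg lg (eigenvector_lax bf m)).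
  by apply: contra_neq mn => /(lam_inj bf).
have hL := hardyZ (inner g (f n)) (hf n).
have d : ae_equal (g - inner g (f n) *: (f n : R -> C)) (cst 0).
  apply: (eigenvector_total bf (hardyB hg hL)) => m.
  rewrite (innerBl sg (hardy_sqi hL) (sq m)) (innerZl _ (sq n) (sq m)) onf.
  by have [->|mn] := eqVneq n m; rewrite ?mulr1 ?subrr// z 1?eq_sym// mulr0 subrr.
have := ae_equalD d (ae_equal_refl (inner g (f n) *: (f n : R -> C))).
by rewrite subrK add0r.
Qed.

End Expansions.

(** * Position of the Blaschke eigenvalues in the spectrum *)

Section SpectrumStructure.
Variable R : realType.
Local Notation C := R[i].
Opaque fourier inner circle_mean lax_form lax_op.
Variables (N : nat) (p : 'I_N -> C) (e : C) (u : R -> C) (l : R) (lam : nat -> R) (f : nat -> L2 R).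
Hypotheses (p1 : forall k, `|p k| < 1) (e1 : `|e| = 1) (hu : hardy u) (un0 : ~ ae_equal u (cst 0))
  (Lpsi : forall k : nat, lax u (ek k%:Z * (e *: bl_psi p))
     ((l + k%:R)%:C *: (ek k%:Z * (e *: bl_psi p))))
  (bf : eigenbasis u lam f).
Local Notation psi := (e *: bl_psi p).
Local Notation g k := (ek k%:Z * psi).

Let e0 : e != 0. Proof. by rewrite -normr_eq0 e1 oner_eq0. Qed.
Let nb := bl_psi_nice p1.
Let ng (k : nat) : nice (g k) := nice_ekM k (niceZ e nb).
Let sg (k : nat) := nice_sqi (ng k).
Let sq n : square_integrable (f n) := L2_sqi (f n).
Let hf n : hardy (f n). Proof. by have [[]] := eigenvector_lax bf n. Qed.
Let onf := eigenvector_orthonormal bf.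

Lemma psi_inner_eq0 h (k : nat) : square_integrable h ->
  (inner h (g k) = 0) <-> (inner h (ek k%:Z * bl_psi p) = 0).
Proof.
move=> sh; rewrite -scale_mulr (innerZr _ (nice_sqi (nice_ekM k nb)) sh); split => [/eqP|->].
  by rewrite mulf_eq0 conjC_eq0 (negbTE e0) => /eqP.
by rewrite mulr0.
Qed.

Lemma psi_norm (k : nat) : inner (g k) (g k) = 1.
Proof.
have sb := nice_sqi nb.
rewrite inner_ek_mul (innerZl _ sb (sqiZ _ sb)) (innerZr _ sb sb) mulrA -normCK e1 expr1n mul1r.
exact: inner_bl_psi_self.
Qed.

Lemma psi_potential (k : nat) : inner u (g k.+1) = 0.
Proof.
rewrite (inner_conj (sg _) (hardy_sqi hu)).
by rewrite (eigenvector_shift_orthogonal hu un0 (niceZ e nb) Lpsi) conjC0.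
Qed.

Let su := hardy_sqi hu.

(** Orthogonality to every S^(k+1) psi places [u] in the model space of S psi, whose elements are
    all smooth. *)
Lemma structure_potential_smooth : smooth u.
Proof.
have [p' p'1 pE] := bl_psi_extend p1.
apply: (model_smooth p'1 hu) => k; rewrite pE.
have -> : ek k%:Z * (ek 1 * bl_psi p) = ek k.+1%:Z * bl_psi p by rewrite [RHS]ekS_mul mulrCA.
exact: ((psi_inner_eq0 k.+1 su).1 (psi_potential k)).
Qed.

(** A bounded representative of the class of [u], for which the explicit [lax_op] can be used. *)
Let v := synth (fun k => fourier u k%:Z).
Let nv : nice v. Proof. by apply: nice_synth; case: structure_potential_smooth. Qed.
Let uv : ae_equal u v. Proof. exact: smooth_ae structure_potential_smooth. Qed.
Let sv := nice_sqi nv.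

Let lax_uv h k : square_integrable h -> square_integrable k -> lax u h k -> lax v h k.
Proof.
by move=> sh sk; exact: (lax_ae su sv sh sk uv (ae_equal_refl _) (ae_equal_refl _)).
Qed.

Lemma psi_eigenvalue (k : nat) : exists n, l + k%:R = lam n.
Proof. by apply: (eigenbasis_eigenvalue bf (ng k).1 (Lpsi k)); rewrite psi_norm oner_eq0. Qed.

Lemma psi_proportional (k n : nat) : lam n = l + k%:R ->
  exists2 z : C, `|z| = 1 & ae_equal (g k) (z *: (f n : R -> C)).
Proof.
move=> ln; exists (inner (g k) (f n)).
  have h : ae_equal (g k) (inner (g k) (f n) *: (f n : R -> C)).
    by apply: (smooth_eigenfun_proportional bf (ng k).1); rewrite ln.
  have := psi_norm k; rewrite (inner_ae (sg k) (sqiZ _ (sq n)) (sg k) (sqiZ _ (sq n)) h h).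
  rewrite (innerZl _ (sq n) (sqiZ _ (sq n))) (innerZr _ (sq n) (sq n)) onf eqxx mulr1 -normCK.
  by move/eqP; rewrite sqrp_eq1 ?normr_ge0// => /eqP.
by apply: (smooth_eigenfun_proportional bf (ng k).1); rewrite ln.
Qed.

Lemma psi_proportional_inv (k n : nat) : lam n = l + k%:R ->
  exists2 z : C, `|z| = 1 & ae_equal (f n) (z *: g k).
Proof.
move=> /psi_proportional[z z1 h]; exists z^-1; first by rewrite normfV z1 invr1.
have z0 : z != 0 by rewrite -normr_eq0 z1 oner_eq0.
have := ae_equalZ z^-1 (ae_equal_sym h).
by rewrite scalerA mulVf// scale1r.
Qed.

Let inK n := in_model p (f n).

(** An eigenfunction whose eigenvalue is none of the l + k is orthogonal to all S^k psi; the others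
    are multiples of some S^k psi by [psi_proportional]. *)
Lemma model_or_shift n : inK n \/ exists k : nat, lam n = l + k%:R.
Proof.
have [k|nk] := pselect (exists k : nat, lam n = l + k%:R); [by right|left => k].
apply: (psi_inner_eq0 k (sq n)).1; rewrite (inner_conj (sg k) (sq n)).
rewrite (eigen_orthogonal (ng k).1 (Lpsi k) (eigenvector_lax bf n)) ?conjC0//.
by apply/eqP => h; apply: nk; exists k.
Qed.

Lemma model_not_shift n (k : nat) : inK n -> lam n != l + k%:R.
Proof.
move=> mn; apply/eqP => /psi_proportional[z z1 h].
have o := (psi_inner_eq0 k (sq n)).2 (mn k).
have := psi_norm k; rewrite (inner_ae (sg k) (sqiZ _ (sq n)) (sg k) (sg k) h (ae_equal_refl _)).
by rewrite (innerZl _ (sq n) (sg k)) o mulr0 => /eqP; rewrite eq_sym oner_eq0.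
Qed.

Lemma structure_smooth n : smooth (f n).
Proof.
have [mn|[k ln]] := model_or_shift n; first exact: (model_smooth p1 (hf n)).
have [z _ h] := psi_proportional_inv ln.
exact: (smooth_ae_trans (smoothZ z (ng k).1) (sq n) (ae_equal_sym h)).
Qed.

(* The vector [S f n] lies in the span of [psi] and of the [f n'] of the model
   space, and [<L S f n | S f n> >= lam n + 1]: it has a component on some [f n'] with [n' > n]. *)
Lemma model_next n : inK n -> l < lam n -> exists n', [/\ inK n', (n < n')%N & l < lam n'].
Proof.
move=> mn ln; apply: contrapT => nx.
pose h : R -> C := ek 1 * (f n : R -> C).
have smh : smooth h := smooth_shift (structure_smooth n).
have sh := smooth_sqi smh.
have h0 n' : (n < n')%N -> inner h (f n') = 0.
  move=> nn'; have ll : l < lam n' by exact: lt_trans ln (lt_lam bf nn').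
  have [mn'|[[|k] ln']] := model_or_shift n'; first by exfalso; apply: nx; exists n'.
    by move: ll; rewrite ln' addr0 ltxx.
  have [z _ hz] := psi_proportional_inv ln'.
  rewrite (inner_ae sh sh (sq n') (sqiZ z (sg k.+1)) (ae_equal_refl _) hz).
  rewrite (innerZr _ (sg _) sh) ekS_mul inner_ek_mul.
  by rewrite ((psi_inner_eq0 k (sq n)).2 (mn k)) mulr0.
have hE := finite_expansion bf (smooth_hardy smh) h0.
have sL : square_integrable (\sum_(i < n.+1) inner h (f i) *: (f i : R -> C)).
  by apply: sqi_sum => i _; exact: sqiZ.
have hh : inner h h = 1 by rewrite inner_ek_mul onf eqxx.
have L1 : ae_equal (lax_op v h) ((lam n + 1)%:C *: h + inner h v *: v).
  apply: (ae_equal_trans (lax_op_shift nv (structure_smooth n))).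
  apply: ae_equalD; last exact: ae_equal_refl.
  rewrite rmorphD rmorph1 scalerDl scale1r; apply: ae_equalD; last exact: ae_equal_refl.
  rewrite /h scale_mulr; apply: ae_equalM; first exact: ae_equal_refl.
  apply: (lax_unique (lax_lax_op nv (structure_smooth n))).
  by apply: lax_uv; [exact: sq|exact: sqiZ|exact: (eigenvector_lax bf n)].
have sLh := hardy_sqi (lax_op_hardy nv smh).
have sR : square_integrable ((lam n + 1)%:C *: h + inner h v *: v) by apply: sqiD; exact: sqiZ.
have Lhh : inner (lax_op v h) h = (lam n + 1)%:C + inner h v * (inner h v)^*.
  rewrite (inner_ae sLh sR sh sh L1 (ae_equal_refl _)).
  rewrite (innerDl (sqiZ _ sh) (sqiZ _ sv) sh) (innerZl _ sh sh) hh mulr1.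
  by rewrite (innerZl _ sv sh) (inner_conj sh sv).
have Li i : inner (lax_op v h) (f i) = (lam i)%:C * inner h (f i).
  have lv : lax v (f i) ((lam i)%:C *: (f i : R -> C)).
    by apply: lax_uv; [exact: sq|exact: sqiZ|exact: (eigenvector_lax bf i)].
  by rewrite (lax_sym smh (lax_lax_op nv smh) lv) inner_rscale.
have hhS : \sum_(i < n.+1) (inner h (f i))^* * inner h (f i) = 1.
  by rewrite -hh [RHS](inner_ae sh sh sh sL (ae_equal_refl _) hE) (inner_lincombr _ (fun i : 'I_n.+1 => sq i) sh).
have LhhS : inner (lax_op v h) h = \sum_(i < n.+1) (lam i)%:C * ((inner h (f i))^* * inner h (f i)).
  rewrite (inner_ae sLh sLh sh sL (ae_equal_refl _) hE) (inner_lincombr _ (fun i : 'I_n.+1 => sq i) sLh).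
  by apply: eq_bigr => i _; rewrite Li mulrCA.
have : (lam n + 1)%:C <= (lam n)%:C * (\sum_(i < n.+1) (inner h (f i))^* * inner h (f i)).
  apply: (le_trans _ (y := inner (lax_op v h) h)).
    by rewrite Lhh lerDl mul_conjC_ge0.
  rewrite LhhS mulr_sumr; apply: ler_sum => i _.
  rewrite ler_wpM2r//; first by rewrite mulrC mul_conjC_ge0.
  rewrite lecR; have := ltn_ord i; rewrite ltnS leq_eqVlt => /predU1P[->//|h1].
  exact/ltW/(lt_lam bf).
by rewrite hhS mulr1 lecR; lra.
Qed.

(** Otherwise [model_next] would produce infinitely many orthonormal elements of a space of
    dimension N. *)
Lemma model_below n : inK n -> lam n < l.
Proof.
move=> mn; have n0 := model_not_shift 0 mn; rewrite addr0 in n0.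
rewrite lt_neqAle n0 leNgt; apply/negP => ln.
have nexts m : exists m', inK m /\ l < lam m -> [/\ inK m', (m < m')%N & l < lam m'].
  have [[mm lm]|nm] := pselect (inK m /\ l < lam m); last by exists 0%N.
  by have [m' h] := model_next mm lm; exists m'.
have [nx nxP] := boolp.choice nexts.
pose t i := iter i nx n.
have tP i : inK (t i) /\ l < lam (t i).
  by elim: i => [//|i IH]; have [? _ ?] := nxP _ IH.
have tlt i : (t i < t i.+1)%N by have [] := nxP _ (tP i).
have tmono i j : (i < j)%N -> (t i < t j)%N.
  by move=> ij; apply: (homo_ltn (@ltn_trans) tlt).
apply: (model_dim_le p1 (F := fun i => f (t i))).
- by move=> i; exact: hf.
- by move=> i; exact: (tP i).1.
- move=> i j; rewrite onf; congr (nat_of_bool _)%:R.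
  apply/eqP/eqP => [h|->//]; apply/val_inj.
  by have [/tmono|/tmono|//] := ltngtP i j; rewrite h ltnn.
Qed.

(** If l is the eigenvalue of index n0, the eigenfunctions in the model space are f_0, ...,
    f_(n0-1). More than N of them exceed its dimension; with fewer, some nonzero element would be
    orthogonal to them and to all S^k psi, against totality. *)
Lemma lam_N : l = lam N.
Proof.
have [n0 hn0] := psi_eigenvalue 0; rewrite addr0 in hn0.
have K_lt n : (n < n0)%N -> inK n.
  move=> nn0; have [//|[k h]] := model_or_shift n.
  have := lt_lam bf nn0; rewrite -hn0 h gtrDl ltNge ler0n//.
have K_ge n : (n0 <= n)%N -> ~ inK n.
  move=> nn0 /model_below; rewrite hn0 ltNge; move: nn0; rewrite leq_eqVlt => /predU1P[->|/(lt_lam bf)/ltW ->//].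
  by rewrite lexx.
have [n0N|Nn0|<-//] := ltngtP n0 N.
  have [h [nh mh h0 []]] := model_dim_ge p1 (F := fun i : 'I_n0 => (f i : R -> C)) n0N (fun i => sq i).
  have sh := nice_sqi nh.
  apply: (eigenvector_total bf (smooth_hardy nh.1)) => n.
  have [nn0|nn0] := ltnP n n0; first exact: (h0 (Ordinal nn0)).
  have [/K_ge|[k ln]] := model_or_shift n; first by move=> /(_ nn0).
  have [z _ hz] := psi_proportional_inv ln.
  rewrite (inner_ae sh sh (sq n) (sqiZ z (sg k)) (ae_equal_refl _) hz) (innerZr _ (sg k) sh).
  by rewrite ((psi_inner_eq0 k sh).2 (mh k)) mulr0.
exfalso; apply: (model_dim_le p1 (F := fun i => f i)).
- by move=> i; exact: hf.
- by move=> i; apply: K_lt; exact: leq_ltn_trans (ltn_ord i : (i <= N)%N) _.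
- by move=> i j; rewrite onf.
Qed.

Lemma lam_above j : lam (N + j) = l + j%:R.
Proof.
have shift_of n : (N <= n)%N -> exists k : nat, lam n = l + k%:R.
  move=> Nn; have [/model_below|//] := model_or_shift n; rewrite lam_N ltNge => /negP[].
  by move: Nn; rewrite leq_eqVlt => /predU1P[->//|/(lt_lam bf)/ltW].
suff E : (fun j => lam (N + j)) = (fun j : nat => l + j%:R) by exact: (congr1 (@^~ j) E).
apply: increasing_enum_eq.
- by move=> n; rewrite addnS; exact: eigenvalue_lt bf _.
- by move=> n; rewrite ltrD2l ltr_nat.
- by move=> n; apply: shift_of; exact: leq_addr.
- move=> n; have [m hm] := psi_eigenvalue n; exists (m - N)%N; rewrite subnKC//.
  rewrite leqNgt; apply/negP => /(lt_lam bf); rewrite -hm -lam_N gtrDl ltNge ler0n//.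
Qed.

(** The f_n with n > N are multiples of S^(k+1) psi, so the hypothesis truncates the expansion; it
    applies to the potential and to the transported vectors. *)
Lemma expansion_model h : hardy h -> (forall k : nat, inner h (g k.+1) = 0) ->
  ae_equal h (\sum_(q < N.+1) inner h (f q) *: (f q : R -> C)).
Proof.
move=> hh h0; apply: (finite_expansion bf hh) => n Nn.
have sh := hardy_sqi hh.
have e' : lam n = l + (n - N.+1).+1%:R by rewrite -lam_above subnSK// subnKC// ltnW.
have [z _ hz] := psi_proportional_inv e'.
by rewrite (inner_ae sh sh (sq n) (sqiZ z (sg _)) (ae_equal_refl _) hz) (innerZr _ (sg _) sh) h0 mulr0.
Qed.

Lemma model_low n : (n < N)%N -> inK n.
Proof.
move=> nN; have [//|[k h]] := model_or_shift n.
by have := lt_lam bf nN; rewrite -lam_N h gtrDl ltNge ler0n.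
Qed.

End SpectrumStructure.

(** * Every potential of index N carries a spectral model *)

Section SpectralModelOfPotential.
Variable R : realType.
Local Notation C := R[i].
Opaque fourier inner circle_mean lax_form lax_op.

Lemma ae_equal_eq (f g : R -> C) : f = g -> ae_equal f g.
Proof. by move=> ->; exact: ae_equal_refl. Qed.

Lemma norm_expi (theta : R) : `|expi theta| = 1.
Proof.
have := expiK theta; rewrite -normCK => /eqP; rewrite sqrp_eq1 ?normr_ge0//.
by move/eqP.
Qed.

(** [phase] vanishes at 0; the value 1 there keeps the correcting factors unimodular at all indices,
    while the gauge products are shown to be nonzero only at finitely many. *)
Definition unit_phase (z : C) : C := if z == 0 then 1 else phase z.

Lemma norm_unit_phase z : `|unit_phase z| = 1.
Proof. by rewrite /unit_phase; case: eqVneq => [_|/norm_phase//]; rewrite normr1. Qed.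

Lemma unit_phase_mul z : z != 0 -> 0 < (unit_phase z)^* * z.
Proof.
move=> z0; rewrite /unit_phase (negbTE z0) {2}[z]phase_norm mulrCA [_^* * _]mulrC -normCK.
by rewrite norm_phase// expr1n mulr1 normr_gt0.
Qed.

Section Positive.
Variables (N : nat) (u : L2 R).
Hypotheses (fu : finite_gap u) (iu : is_spectral_index u N.+1).
Local Notation I := 'I_N.+2.
Local Notation w := (widen_ord (leqnSn N.+1)).
Local Notation s := (lift (@ord0 N.+1)).

Lemma positive_index_neq0 : ~ ae_equal u (cst 0).
Proof.
by move=> u0; have := iu.2 0%N (zero_potential_index (L2_sqi u) u0).
Qed.

Lemma positive_index_model : exists lam mu U a c, @spectral_model R N.+1 u lam mu U a c.
Proof.
have hu := fu.1; have un0 := positive_index_neq0.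
have [f bf] := finite_gap_eigenbasis fu; set lam := lambda u in bf.
have [[l [psi0 /blaschkeP[theta [p p1 psiE]] L0]] minN] := iu.
have e1 := norm_expi theta; set e := expi theta in psiE e1.
have L (k : nat) : lax u (ek k%:Z * (e *: bl_psi p)) ((l + k%:R)%:C *: (ek k%:Z * (e *: bl_psi p))).
  by have := L0 k; rewrite iter_shift psiE.
have smu := structure_potential_smooth p1 e1 hu un0 L.
have smf := structure_smooth p1 e1 L bf.
have lE := lam_N p1 e1 hu un0 L bf.
have lamA := lam_above p1 e1 hu un0 L bf.
have low := model_low p1 e1 hu un0 L bf.
have expm := expansion_model p1 e1 hu un0 L bf.
have upsi := psi_potential p1 hu un0 L.
have onf := eigenvector_orthonormal bf.
pose v := synth (fun k => fourier u k%:Z).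
have nv : nice v by apply: nice_synth; case: smu.
have uv : ae_equal u v by exact: smooth_ae.
have su := L2_sqi u; have sv := nice_sqi nv.
have sq n := L2_sqi (f n).
pose mu := shifted_eigenvalues lam.
have mu0 : mu 0%N = 0 by []. have muS m : mu m.+1 = lam m + 1 by [].
have lam_mono := @lt_lam R u lam f bf.
(* The gauge products of the uncorrected basis. With f'_n = th_n f_n one has <S f'_m | f'_(m+1)> =
   th_m conj(th_(m+1)) t_(m+1), so [th] accumulates the phases of [t]. *)
pose t n := if n is m.+1 then inner (ek 1 * (f m : R -> C)) (f m.+1) else inner 1 (f 0%N).
pose th := fix th n := if n is m.+1 then th m * unit_phase (t n) else unit_phase (t 0%N).
pose F (c : nat -> C) := fun n => c n *: (f n : R -> C).
have nb := bl_psi_nice p1; have ng k := nice_ekM k (niceZ e nb); have sg k := nice_sqi (ng k).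
have sF (c : nat -> C) n : smooth (F c n) by exact: smoothZ.
have exps (c : nat -> C) h : (forall n, `|c n| = 1) -> hardy h -> (forall k : nat, inner h (ek k.+1%:Z * (e *: bl_psi p)) = 0) ->
    ae_equal h (\sum_(q < N.+2) inner h (F c q) *: F c q).
  move=> c1 hh h0; apply: (ae_equal_trans (expm _ hh h0)); apply: ae_equal_eq.
  apply: eq_bigr => q _; rewrite /F (innerZr _ (sq q) (hardy_sqi hh)) scalerA mulrAC.
  by rewrite -[X in (X * _) *: _]mulrC -normCK c1 expr1n mul1r.
have onF (c : nat -> C) (c1 : forall n, `|c n| = 1) (q r : I) : inner (F c q) (F c r) = (q == r)%:R.
  rewrite /F (innerZl _ (sq q) (sqiZ _ (sq r))) (innerZr _ (sq r) (sq q)) onf.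
  rewrite val_eqE; have [->|_] := eqVneq q r; last by rewrite !mulr0.
  by rewrite mulr1 -normCK c1 expr1n.
have eigF (c : nat -> C) n : lax v (F c n) ((lam n)%:C *: F c n).
  have lv : lax v (f n) ((lam n)%:C *: (f n : R -> C)).
    apply: (lax_ae su sv (sq n) (sqiZ _ (sq n)) uv (ae_equal_refl _) (ae_equal_refl _)).
    exact: (eigenvector_lax bf n).
  apply: (lax_of_lax_op nv (sF c n) (sqiZ _ (smooth_sqi (sF c n)))).
  apply: (ae_equal_trans (lax_opZ _ nv (smf n))).
  rewrite [X in ae_equal _ X]scalerA mulrC -scalerA; apply: ae_equalZ.
  exact: (lax_unique (lax_lax_op nv (smf n)) lv).
have hyF (c : nat -> C) : (forall n, `|c n| = 1) ->
    (forall m : I, ae_equal (transported (fun q : I => F c q) m)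
      (\sum_(q : I) inner (transported (fun q : I => F c q) m) (F c q) *: F c q)) /\
    ae_equal v (\sum_(q : I) inner v (F c q) *: F c q).
  move=> c1; split => [m|]; apply: (exps c _ c1).
  - exact: (smooth_hardy (@transported_smooth R N.+1 (fun q : I => F c q) (fun q => sF c q) m)).
  - move=> k; case: (unliftP ord0 m) => [j ->|->].
      rewrite (@transportedS R N.+1 (fun q : I => F c q) j) (ekS_mul k) inner_ek_mul.
      have sj := smooth_sqi (sF c (w j)).
      rewrite /F (innerZl _ (sq (w j)) (sg k)) ((psi_inner_eq0 p1 e1 k (sq (w j))).2 _) ?mulr0//.
      exact: (low (w j) (ltn_ord j) k).
    by rewrite (@transported0 R N.+1 (fun q : I => F c q)) (ekS_mul k) inner_one_shift//; exact: (smooth_hardy (ng k).1).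
  - exact: (smooth_hardy nv.1).
  - move=> k; rewrite -(upsi k); apply: (inner_ae sv su (sg _) (sg _) (ae_equal_sym uv) (ae_equal_refl _)).
have one1 (n : nat) : `|(fun=> 1 : C) n| = 1 by rewrite normr1.
(* The gauge can be imposed only once these products are known to be nonzero, so nonvanishing is
   proved for arbitrary phases and applied with all phases equal to 1. *)
have diag (c : nat -> C) (c1 : forall n, `|c n| = 1) (m : I) :
    inner (transported (fun q : I => F c q) m) (F c m) != 0.
  have [h1 h2] := hyF c c1.
  exact: (spectral_diagonal_neq0 mu0 muS lam_mono nv (fun q : I => sF c q) (onF c c1) (fun q : I => eigF c q) h1 h2 m).
have F1 n : F (fun=> 1) n = f n by rewrite /F scale1r.
have t0 (m : I) : t m != 0.
  have := diag _ one1 m; case: (unliftP ord0 m) => [j ->|->].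
    by rewrite (@transportedS R N.+1 (fun q : I => F (fun=> 1) q) j) !F1 => h; rewrite lift0.
  by rewrite transported0 F1.
have c1 n : `|th n| = 1.
  by elim: n => [|n IH] /=; rewrite ?normrM ?IH ?mul1r norm_unit_phase.
have [h1 h2] := hyF th c1.
pose G (q : I) := F th q.
pose U m q := inner (transported G m) (G q).
pose a q := inner v (G q).
have sG q : smooth (G q) := sF th q.
have Gq q : square_integrable (G q) := smooth_sqi (sG q).
have gauge m : 0 < U m m.
  have tm := unit_phase_mul (t0 m); rewrite /U.
  case: (unliftP ord0 m) tm => [j ->|->].
    rewrite (@transportedS R N.+1 G j) lift0 => tm; rewrite /G /F lift0 -scale_mulr.
    have sj := ek_mul_sqi 1 (sq (w j)).
    rewrite (innerZl _ sj (sqiZ _ (sq j.+1))) (innerZr _ (sq j.+1) sj) mulrA [th j.+1]/=.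
    rewrite rmorphM /= mulrA -normCK c1 expr1n mul1r; exact: tm.
  rewrite transported0 /G /F => tm; have s1 : square_integrable (1 : R -> C) by exact: sqi_cst.
  by rewrite (innerZr _ (sq _) s1).
have D : gap_data lam mu U a (fun m => inner (transported G m) v).
  exact: (spectral_gap_data mu0 muS nv sG (onF th c1) (fun q : I => eigF th q) h1 h2 gauge).
have lamN n : (N.+1 < n)%N -> lam n = mu n.
  by case: n => [//|n] Nn; rewrite muS -(subnKC (Nn : (N.+1 <= n)%N)) -addnS !lamA -natr1 addrA.
have mu_lam m : mu m <= lam m.
  have [mN|Nm] := leqP m N.+1; last by rewrite lamN.
  exact: (spectral_mu_lam mu0 muS lam_mono nv sG (onF th c1) (fun q : I => eigF th q) h1 h2 mN).
have lam_mu m : lam m < mu m.+1 by rewrite muS ltrDl.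
exists lam, mu, U, a, (fun m => inner (transported G m) v); split => //; last first.
  apply: (ae_equal_trans uv).
  exact: (spectral_potential mu0 muS nv sG (onF th c1) (fun q : I => eigF th q) h1 h2 mu_lam gauge).
(* If the last gap were closed, S f_N would be f_(N+1) up to a phase, hence proportional to psi;
   then psi vanishes at the origin and factors as S psi1, and the shifts of psi1 are eigenvectors
   too, contradicting minimality of the index N + 1. *)
rewrite lt_neqAle mu_lam andbT; apply/eqP => deg.
have UN (q : I) := (gap_U_degenerate mu_lam lam_mu D q (m := ord_max) (esym deg)).1.
have top : ae_equal (ek 1 * G (w ord_max)) (G ord_max).
  have E : \sum_(q : I) U ord_max q *: G q = G ord_max.
    rewrite (bigD1 ord_max)//= UN eqxx scale1r big1 ?addr0// => q qN.
    by rewrite UN eq_sym (negbTE qN) scale0r.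
  have h : ae_equal (transported G ord_max) (\sum_(q : I) U ord_max q *: G q) := h1 ord_max.
  rewrite E in h; rewrite -(@transportedS R N.+1 G ord_max).
  by rewrite (_ : s ord_max = ord_max)//; exact: val_inj.
have lN : l = lam N + 1 by rewrite lE -deg.
have [z _ zpsi] := psi_proportional p1 e1 L bf (k := 0) (n := N.+1) (etrans (esym lE) (esym (addr0 l))).
rewrite ek0 mul1r in zpsi.
have thN0 : th N.+1 != 0 by rewrite -normr_eq0 c1 oner_eq0.
pose z' := z / th N.+1 * th N.
have psi_top : ae_equal (e *: bl_psi p) (z' *: (ek 1 * (f N : R -> C))).
  apply: (ae_equal_trans zpsi).
  have := ae_equalZ (z / th N.+1) (ae_equal_sym top).
  rewrite /G /F scalerA divfK// -scale_mulr scalerA; exact.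
have sb := nice_sqi nb; have sfN := ek_mul_sqi 1 (sq N).
have hfN : hardy (f N) := smooth_hardy (smf N).
have : fourier (bl_psi p) 0 = 0.
  have := fourier_ae 0 (sqiZ e sb) (sqiZ z' sfN) psi_top.
  rewrite (fourierZ _ _ sb) (fourierZ _ _ sfN) fourier_ekM hfN.2// mulr0 => /eqP.
  by rewrite mulf_eq0 -normr_eq0 e1 oner_eq0 /= => /eqP.
case/(bl_psi_constant_term p1) => k pk.
have psi1E : e *: bl_psi p = ek 1 * (e *: bl_psi (p \o lift k)) by rewrite (bl_psi_zero pk) scale_mulr.
set psi1 := e *: bl_psi (p \o lift k) in psi1E.
have n1 : nice psi1 by apply: niceZ; apply: bl_psi_nice => j; exact: p1.
have psi1_f : ae_equal psi1 (z' *: (f N : R -> C)).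
  have := ae_equalM (ae_equal_refl (ek (-1))) psi_top.
  have canc (h : R -> C) : ek (-1) * (ek 1 * h) = h by rewrite mulrA -ekD addNr ek0 mul1r.
  by rewrite psi1E canc -scale_mulr canc.
have : (N.+1 <= N)%N; last by rewrite ltnn.
apply: minN; exists (lam N), psi1; first by apply: blaschke_bl_psi => j; exact: p1.
case=> [|j]; rewrite iter_shift.
  rewrite ek0 mul1r addr0.
  have lv : lax v (f N) ((lam N)%:C *: (f N : R -> C)).
    apply: (lax_ae su sv (sq N) (sqiZ _ (sq N)) uv (ae_equal_refl _) (ae_equal_refl _)).
    exact: (eigenvector_lax bf N).
  have s1 := nice_sqi n1.
  have lv1 : lax v psi1 ((lam N)%:C *: psi1).
    apply: (lax_of_lax_op nv n1.1 (sqiZ _ s1)).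
    apply: (ae_equal_trans (lax_op_ae nv n1.1 (smoothZ z' (smf N)) psi1_f)).
    apply: (ae_equal_trans (lax_opZ z' nv (smf N))).
    apply: (ae_equal_trans (ae_equalZ z' (lax_unique (lax_lax_op nv (smf N)) lv))).
    rewrite scalerA mulrC -scalerA; apply: ae_equalZ; exact: ae_equal_sym.
  exact: (lax_ae sv su s1 (sqiZ _ s1) (ae_equal_sym uv) (ae_equal_refl _) (ae_equal_refl _) lv1).
have := L j; rewrite psi1E.
have -> : l + j%:R = lam N + j.+1%:R by rewrite lN -natr1 -addrA [1 + _]addrC.
by rewrite [ek j%:Z * (ek 1 * _)]mulrCA -(ekS_mul j).
Qed.

End Positive.

(** For a constant z the eigenfunctions are e^{inx} with eigenvalues |z|^2 + n, and the matrix has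
    the single entry 1. Index 0 is treated apart because [calU R 0] is defined by constants. *)
Lemma constant_model (u : L2 R) (z : C) : z != 0 -> ae_equal u (cst z) ->
  exists lam mu U a c, @spectral_model R 0 u lam mu U a c.
Proof.
move=> z0 uz; pose lam n : R := sqnorm z + n%:R.
pose mu := shifted_eigenvalues lam.
have mu0 : mu 0%N = 0 by []. have muS m : mu m.+1 = lam m + 1 by [].
have zpos : 0 < sqnorm z by rewrite lt_neqAle sqnorm_ge0 eq_sym sqnorm_eq0 z0.
have mu_lam m : mu m <= lam m.
  by case: m => [|m]; rewrite /mu /lam /= ?addr0 ?sqnorm_ge0// -natr1 addrA.
have D : @gap_data R 0 lam mu (fun _ _ => 1) (fun=> z) (fun=> z^*).
  split=> [q r|m q|q|m]; rewrite ?ord1 ?big_ord1 ?conjC1 ?mulr1 ?conjCK ?ltr01//.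
  by rewrite mu0 subr0 /lam addr0 sqnormE normCK mulrC.
exists lam, mu, (fun _ _ => 1), (fun=> z), (fun=> z^*); split => //.
- by case=> [//|n] _; rewrite muS /lam -natr1 addrA.
- by rewrite mu0 /lam addr0.
apply: (ae_equal_trans uz).
have := ae_equalZ z (build_one mu0 muS mu_lam D).
rewrite /build_pot !big_ord1 scale1r; congr (ae_equal _ _).
by apply/funext => x; change (z * 1 = z); rewrite mulr1.
Qed.

Lemma calU_model N (u : L2 R) : calU R N u -> exists lam mu U a c, @spectral_model R N u lam mu U a c.
Proof.
case: N => [[z z0 uz]|N [fu iu]]; first exact: constant_model z0 uz.
exact: positive_index_model.
Qed.

End SpectralModelOfPotential.

Lemma L2_zero_ae (R : realType) : ae_equal (L2_zero R) (0 : R -> R[i]).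
Proof.
rewrite /L2_zero; set x := MkL2fun _.
have : (repr (\pi_(L2 R) x)%qT = x %[mod L2 R])%qT by rewrite reprK.
by move/eqmodP => /asboolP.
Qed.

Theorem theorem1p5 (R : realType) :
  (forall N : nat,
    [/\ set_bij (calU R N) (Omega R N) (fun u : L2 R => birkhoff u),
        [set birkhoff u | u in [set u : L2 R | calU R N u /\ 0 < lambda u 0%N]]
          = [set z | Omega R N z /\ z 0%N != 0] &
        [set birkhoff u | u in [set u : L2 R | calU R N u /\ lambda u 0%N = 0]]
          = [set z | Omega R N z /\ z 0%N = 0]]) /\
  birkhoff (L2_zero R) = (fun=> 0).
Proof.
split=> [N|]; last first.
  (* The product of the zero class with any function is 0 and [phase 0] is 0, whatever [gap] and
     [eigenfun] are here. *)
  apply/funext => n; rewrite /birkhoff.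
  rewrite (inner_ae (L2_sqi _) (sqi0 R) (L2_sqi _) (L2_sqi _) (L2_zero_ae R) (ae_equal_refl _)).
  by rewrite inner0l /phase mul0r mulr0.
have inO u : calU R N u -> Omega R N (birkhoff u).
  by move=> /calU_model[lam [mu [U [a [c M]]]]]; exact: model_Omega M.
(* gamma_0 = lambda_0 = |zeta_0|^2, from which the last two images are read off. *)
have lam0 u : calU R N u -> lambda u 0%N = sqnorm (birkhoff u 0%N).
  by move=> /calU_model[lam [mu [U [a [c M]]]]]; exact: model_lambda0 M.
have surj z : Omega R N z -> exists2 u : L2 R, calU R N u & birkhoff u = z.
  by move=> /model_exists[u [lam [mu [U [a [c [M e]]]]]]]; exists u; [exact: model_calU M|].
split.
- split => [u /inO//|u u' /set_mem Uu /set_mem Uu' e|z /surj[u Uu e]]; last by exists u.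
  have [lam [mu [U [a [c M]]]]] := calU_model Uu.
  have [lam' [mu' [U' [a' [c' M']]]]] := calU_model Uu'.
  exact: model_inj M M' e.
- apply/seteqP; split => [_ [u [Uu l0] <-]|z [/surj[u Uu <-] z0]].
    split; first exact: inO.
    by move: l0; rewrite lam0// lt_neqAle eq_sym sqnorm_eq0 => /andP[].
  by exists u => //; split => //; rewrite lam0// lt_neqAle sqnorm_ge0 eq_sym sqnorm_eq0 z0.
- apply/seteqP; split => [_ [u [Uu l0] <-]|z [/surj[u Uu <-] z0]].
    split; first exact: inO.
    by apply/eqP; rewrite -sqnorm_eq0 -lam0// l0.
  by exists u => //; split => //; rewrite lam0// z0; apply/eqP; rewrite sqnorm_eq0.
Qed.
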